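(* Let $f\in\mathrm{Aut}(\mathbb{Q},<)$. The conjugacy class of $f$ is non-Haar null if and only if $\mathrm{fix}(f)$ is finite and for each pair of orbitals $O_1,O_2\in\mathcal{O}^*_f$ with $O_1<O_2$ such that $s_f(O_1)=s_f(O_2)=1$ or $s_f(O_1)=s_f(O_2)=-1$, there exists an orbital $O_3\in\mathcal{O}^*_f$ with $O_1<O_3<O_2$ and $s_f(O_3)\neq s_f(O_1)$. Moreover, every non-Haar null conjugacy class is compact biter, and those non-Haar null conjugacy classes whose elements have no fixed points are compact catchers.
   Context: $\mathrm{Aut}(\mathbb{Q},<)$ is the group of order-preserving bijections of $\mathbb{Q}$ with the topology of pointwise convergence (a Polish group); $\mathrm{fix}(f)$ is the set of fixed points of $f$. For $f$, the set of orbitals is $\mathcal{O}^*_f=\{\mathrm{conv}(\{f^n(r):n\in\mathbb{Z}\}): r\in\mathbb{Q}\}$ (convex hulls relative to $\mathbb{Q}$); orbitals partition $\mathbb{Q}$, and for distinct orbitals $O_1<O_2$ means $p_1<p_2$ for some (equivalently all) $p_1\in O_1,p_2\in O_2$. The parity $s_f(O)$ is $0$ if $O$ is a singleton fixed point, $1$ if $f(p)>p$ for $p\in O$, and $-1$ if $f(p)<p$ for $p\in O$. For a Polish group $G$, a Borel set $B\subseteq G$ is Haar null if there is a Borel probability measure $\mu$ on $G$ with $\mu(gBh)=0$ for all $g,h\in G$; an arbitrary set is Haar null if contained in a Borel Haar null set. A set $A\subseteq G$ is compact catcher if for every compact $K\subseteq G$ there exist $g,h\in G$ with $gKh\subseteq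 A$; it is compact biter if for every non-empty compact $K\subseteq G$ there exist an open $U$ and $g,h\in G$ with $U\cap K\neq\emptyset$ and $g(U\cap K)h\subseteq A$. *)

(* Defs.v *)
From HB Require Import structures.
From mathcomp Require Import all_boot all_order all_algebra.
From mathcomp Require Import all_classical all_reals all_analysis.

Set Implicit Arguments.
Unset Strict Implicit.
Unset Printing Implicit Defensive.

Import Order.TTheory GRing.Theory Num.Theory.

Local Open Scope classical_set_scope.
Local Open Scope ring_scope.

HB.mixin Record isTopGroup G of PointedTopological G & Group G := {
  mulg_continuous : continuous (fun p : G * G => (p.1 * p.2)%g) ;
  invg_continuous : continuous (fun x : G => (x^-1)%g)
}.

#[short(type="topGroupType")]
HB.structure Definition TopGroup :=
  {G of isTopGroup G & PointedTopological G & Group G}.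

Section HaarNull.
Variable G : topGroupType.
Implicit Types A B K : set G.

Definition translate (g h : G) A : set G := [set (g * x * h)%g | x in A].

Definition borel : set (set G) := <<s @open G >>.

Definition borel_haar_null (R : realType) B : Prop :=
  borel B /\
  exists mu : probability (g_sigma_algebraType (@open G)) R,
    forall g h : G, mu (translate g h B) = 0%E.

Definition haar_null (R : realType) A : Prop :=
  exists B, borel_haar_null R B /\ A `<=` B.

Definition compact_catcher A : Prop :=
  forall K, compact K -> exists g h : G, translate g h K `<=` A.

Definition compact_biter A : Prop :=
  forall K, K !=set0 -> compact K ->
    exists (U : set G) (g h : G),
      [/\ open U, U `&` K !=set0 & translate g h (U `&` K) `<=` A].

Definition conjugacy_class (x : G) : set G :=
  [set (x ^ y)%g | y in [set: G]].

End HaarNull.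

Definition zexpg (G : groupType) (x : G) (n : int) : G :=
  match n with Posz k => (x ^+ k)%g | Negz k => (x ^- k.+1)%g end.

Record autQ := AutQ {
  autQ_fun :> rat -> rat ;
  autQ_homo : {homo autQ_fun : x y / x < y} ;
  autQ_bij : bijective autQ_fun
}.

HB.instance Definition _ := gen_eqMixin autQ.
HB.instance Definition _ := gen_choiceMixin autQ.

Lemma autQ_ext (f g : autQ) : f =1 g -> f = g.
Proof.
case: f g => [f fh fb] [g gh gb] /= /funext fg.
by case: _ / fg in gh gb *; congr AutQ; exact: Prop_irrelevance.
Qed.

Definition autQ_one : autQ :=
  @AutQ idfun (fun _ _ => id) (Bijective (fun _ => erefl) (fun _ => erefl)).

Definition autQ_mul (f g : autQ) : autQ :=
  @AutQ (f \o g) (fun x y xy => autQ_homo f (autQ_homo g xy))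
    (bij_comp (autQ_bij f) (autQ_bij g)).

Lemma autQ_inv_ex (f : autQ) : exists g : autQ, cancel f g /\ cancel g f.
Proof.
have [g fK gK] := autQ_bij f.
suff gh : {homo g : x y / x < y} by exists (AutQ gh (Bijective gK fK)).
move=> x y xy; rewrite ltNge; apply/negP; rewrite le_eqVlt => /predU1P[e|yx].
  by move: xy; rewrite -(gK x) -(gK y) e ltxx.
by have := autQ_homo f yx; rewrite !gK => /(lt_trans xy); rewrite ltxx.
Qed.

Definition autQ_inv (f : autQ) : autQ := projT1 (cid (autQ_inv_ex f)).

Lemma autQ_invK (f : autQ) : cancel f (autQ_inv f).
Proof. by rewrite /autQ_inv; case: cid => g []. Qed.

Lemma autQ_Kinv (f : autQ) : cancel (autQ_inv f) f.
Proof. by rewrite /autQ_inv; case: cid => g []. Qed.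

Lemma autQ_mulA : associative autQ_mul.
Proof. by move=> f g h; exact: autQ_ext. Qed.

Lemma autQ_mul1 : left_id autQ_one autQ_mul.
Proof. by move=> f; exact: autQ_ext. Qed.

Lemma autQ_mulr1 : right_id autQ_one autQ_mul.
Proof. by move=> f; exact: autQ_ext. Qed.

Lemma autQ_mulV : left_inverse autQ_one autQ_inv autQ_mul.
Proof. by move=> f; apply: autQ_ext => x; exact: autQ_invK. Qed.

Lemma autQ_mulrV : right_inverse autQ_one autQ_inv autQ_mul.
Proof. by move=> f; apply: autQ_ext => x; exact: autQ_Kinv. Qed.

HB.instance Definition _ := isGroup.Build autQ
  autQ_mulA autQ_mul1 autQ_mulr1 autQ_mulV autQ_mulrV.

HB.instance Definition _ := isPointed.Build autQ autQ_one.

(* Pointwise convergence is with respect to the discrete topology on Q, not to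
   the order topology that rat carries by default. *)
HB.instance Definition _ := Topological.copy autQ
  (initial_topology
    (autQ_fun : autQ -> {ptws rat -> discrete_topology rat})).

Lemma cvg_autQP (F : set_system autQ) (f : autQ) : Filter F ->
  F --> f <-> forall q : rat, F [set g : autQ | g q = f q].
Proof.
move=> FF; split=> [Ff q|Ff].
  apply: Ff; set P := ({ptws rat -> discrete_topology rat} : Type).
  exists [set g : autQ | g q = f q]; split => //=.
  exists ((fun h : P => h q) @^-1` [set f q]) => //.
  by apply: open_comp; [move=> h _; exact: proj_continuous|exact: discrete_open].
move=> U [_ [[W oW <-] Wf] /filterS]; apply; rewrite /= in Wf.
suff : autQ_fun @ F --> (autQ_fun f : {ptws rat -> discrete_topology rat}).
  by apply; exact: open_nbhs_nbhs.
apply/cvg_sup => q V [_ [[B oB <-] /= Bf] /filterS]; apply.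
suff : F (autQ_fun @^-1` (fun h => B (h q))) by [].
by apply: filterS (Ff q) => g; rewrite /preimage /= => ->.
Qed.

Lemma autQ_near (f : autQ) (q : rat) : nbhs f [set g : autQ | g q = f q].
Proof. by have /cvg_autQP : nbhs f --> f by []. Qed.

Lemma autQ_mul_continuous :
  continuous (fun p : autQ * autQ => (p.1 * p.2)%g).
Proof.
move=> [f g]; apply/cvg_autQP => q.
exists ([set f' : autQ | f' (g q) = f (g q)], [set g' : autQ | g' q = g q]).
  by split; exact: autQ_near.
by move=> [f' g'] [/= ff gg]; rewrite /= gg ff.
Qed.

Lemma autQ_inv_continuous : continuous (fun f : autQ => (f^-1)%g).
Proof.
move=> f; apply/cvg_autQP => [|q]; first exact/fmap_filter/nbhs_filter.
apply: filterS (autQ_near f (autQ_inv f q)) => g /=.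
by rewrite autQ_Kinv => gq; rewrite -[in LHS]gq; exact: autQ_invK.
Qed.

HB.instance Definition _ :=
  isTopGroup.Build autQ autQ_mul_continuous autQ_inv_continuous.

Definition fixed_points (f : autQ) : set rat := [set x | f x = x].

Definition convex_hull (S : set rat) : set rat := smallest (@is_interval rat) S.

Definition orbitals (f : autQ) : set (set rat) :=
  [set convex_hull [set zexpg f n r | n in [set: int]] | r in [set: rat]].

Definition orbital_lt (O1 O2 : set rat) : Prop :=
  O1 <> O2 /\ exists p1 p2, [/\ O1 p1, O2 p2 & p1 < p2].

(* On an orbital O of f exactly one of the three cases of the parity holds, so
   the last branch is the case where f p < p for all p in O. *)
Definition parity (f : autQ) (O : set rat) : int :=
  if `[< exists p, O = [set p] /\ f p = p >] then 0
  else if `[< forall p, O p -> p < f p >] then 1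
  else -1.

(* Main.v *)
From HB Require Import structures.
Require Import Defs.
From mathcomp Require Import all_boot all_order all_algebra.
From mathcomp Require Import all_classical all_reals all_analysis.
From mathcomp Require Import lra zify ring.

(** Two automorphisms are conjugate as soon as a relation matches their orbitals
    in an order- and sign-preserving way. When orbitals of [f] with the same sign
    are separated by a different sign, such a matching can be read off the sign
    of [f p - p] alone.

    Catching. Let [K] be a set of automorphisms that agree on the fixed points of
    [f] and for which each [k q] and each [k^-1 q] takes finitely many values;
    compact sets have such pieces, and every probability measure charges one. After
    a translation [K] fixes the fixed points of [f], and one works separately on
    each interval between them. There [phi] is built by finite approximations,
    whose nodes carry labels that tell which orbital of [f] each [k] has reached,
    such that every [k] crosses [phi] with the sign pattern of [f]. Then
    [phi^-1 * k] is conjugate to [f] for all [k] in [K] simultaneously.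

    Haar nullness. A random automorphism [kappa] is built by back and forth, each
    of its points being drawn uniformly from a long descending staircase. A fixed
    [psi] passes between two consecutive points of the staircase at most once, so
    by Borel-Cantelli it almost surely separates only finitely many points of
    [kappa] from their successors. Then [psi^-1 * kappa] has finitely many fixed
    points. The points are drawn in interlocked triples, so that moreover no
    invariant cut of [psi^-1 * kappa] is approached from both sides while all
    points near it move up. If [f] has infinitely many fixed points or two
    orbitals with the same sign that are not separated, then all conjugates of
    [f], or all those of [f^-1], have one of these two defects. *)

Set Implicit Arguments.
Unset Strict Implicit.
Unset Printing Implicit Defensive.

Import Order.TTheory GRing.Theory Num.Theory.

Local Open Scope classical_set_scope.
Local Open Scope ring_scope.

(** * Order-preserving relations on the rationals *)

Lemma finite_separation (lo hi : seq rat) :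
  (forall a b, a \in lo -> b \in hi -> a < b) ->
  exists c, (forall a, a \in lo -> a < c) /\ (forall b, b \in hi -> c < b).
Proof.
move=> lo_hi; pose M := \big[Num.min/0]_(b <- hi) b.
pose m := \big[Num.max/(M - 1)]_(a <- lo) a.
have m_hi b : b \in hi -> m < b.
  move=> b_hi; rewrite /m big_seq; apply: bigmax_lt => [|a /lo_hi]; last exact.
  have : M <= b by exact: ge_bigmin_seq.
  by lra.
pose M' := \big[Num.min/(m + 1)]_(b <- hi) b.
have mM' : m < M' by rewrite /M' big_seq; apply: lt_bigmin => //; rewrite ltrDl.
exists ((m + M') / 2%:R); split=> [a a_lo|b b_hi].
  have : a <= m by exact: le_bigmax_seq.
  by lra.
have : M' <= b by exact: ge_bigmin_seq.
by lra.
Qed.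

Lemma right_gap (vs : seq rat) (a b : rat) : a < b ->
  exists c, [/\ a < c, c < b & forall v, v \in vs -> a < v -> c < v].
Proof.
move=> ab; have [|c [ac cP]] := @finite_separation [:: a] (b :: [seq v <- vs | a < v]).
  by move=> u v; rewrite !inE mem_filter => /eqP -> /predU1P[->//|/andP[]].
exists c; split=> [||v v_vs av].
- by apply: ac; rewrite inE.
- by apply: cP; rewrite inE eqxx.
- by apply: cP; rewrite inE mem_filter av v_vs orbT.
Qed.

Lemma left_gap (vs : seq rat) (a b : rat) : a < b ->
  exists c, [/\ a < c, c < b & forall v, v \in vs -> v < b -> v < c].
Proof.
move=> ab; have [|c [ac cP]] := @finite_separation (a :: [seq v <- vs | v < b]) [:: b].
  by move=> u v; rewrite !inE mem_filter => /predU1P[->|/andP[ub _]] /eqP ->.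
exists c; split=> [||v v_vs vb].
- by apply: ac; rewrite inE eqxx.
- by apply: cP; rewrite inE.
- by apply: ac; rewrite inE mem_filter vb v_vs orbT.
Qed.

Lemma no_max_finite_ub d (T : orderType d) (A : set T) (vs : seq T) : A !=set0 ->
  (forall x, A x -> exists2 y, A y & (x < y)%O) ->
  exists2 u, A u & forall v, v \in vs -> A v -> (v < u)%O.
Proof.
move=> [x0 Ax0] no_max; elim: vs => [|v vs [u Au uP]]; first by exists x0.
have [Av|nAv] := pselect (A v); last first.
  by exists u => // w /[1!inE] /predU1P[->|/uP].
have [v' Av' vv'] := no_max _ Av.
exists (Order.max u v'); first by rewrite maxEle; case: ifP.
by move=> w /[1!inE] /predU1P[->|/uP wu Aw]; rewrite lt_max ?vv' ?orbT// wu.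
Qed.

Lemma no_min_finite_lb d (T : orderType d) (A : set T) (vs : seq T) : A !=set0 ->
  (forall x, A x -> exists2 y, A y & (y < x)%O) ->
  exists2 u, A u & forall v, v \in vs -> A v -> (u < v)%O.
Proof. exact: (@no_max_finite_ub _ T^d). Qed.

Record convex_equiv (E : rat -> rat -> Prop) : Prop := {
  equiv_refl : forall x, E x x;
  equiv_sym : forall x y, E x y -> E y x;
  equiv_trans : forall y x z, E x y -> E y z -> E x z;
  equiv_convex : forall x y z, E x z -> x <= y <= z -> E x y }.

Definition repr (E : rat -> rat -> Prop) (x : rat) : rat := xget 0 (E x).

Section ConvexEquivalence.
Variable E : rat -> rat -> Prop.
Hypothesis E_equiv : convex_equiv E.

Lemma equiv_repr x : E x (repr E x).
Proof. by apply: (@xgetPex _ _ (E x)); exists x; exact: equiv_refl E_equiv x. Qed.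

Lemma equiv_class_eq x y : E x y -> E x = E y.
Proof.
move=> xy; apply/seteqP; split=> z; last exact: equiv_trans E_equiv _ _ _ xy.
exact: equiv_trans E_equiv _ _ _ (equiv_sym E_equiv xy).
Qed.

Lemma repr_eq x y : E x y -> repr E x = repr E y.
Proof. by rewrite /repr => /equiv_class_eq ->. Qed.

Lemma repr_id x : repr E (repr E x) = repr E x.
Proof. exact/esym/repr_eq/equiv_repr. Qed.

Lemma equiv_repr_eq x y : repr E x = repr E y -> E x y.
Proof.
move=> xy; apply: (equiv_trans E_equiv (equiv_repr x)); rewrite xy.
exact/(equiv_sym E_equiv)/equiv_repr.
Qed.

Lemma convex_equiv_lt x y x' y' : E x x' -> E y y' -> ~ E x y -> x < y -> x' < y'.
Proof.
move=> xx' yy' nxy xy; rewrite ltNge; apply/negP => y'x'; apply: nxy.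
have [y'x|/ltW xy'] := leP y' x.
  apply/(equiv_sym E_equiv)/(equiv_trans E_equiv yy').
  by apply: (equiv_convex E_equiv (equiv_sym E_equiv yy')); rewrite y'x ltW.
apply: (equiv_trans E_equiv _ (equiv_sym E_equiv yy')).
by apply: (equiv_convex E_equiv xx'); rewrite xy'.
Qed.

End ConvexEquivalence.

Record increasing_graph (C D : set rat) (H : rat -> rat -> Prop) : Prop := {
  graph_dom : forall x, C x -> exists y, H x y;
  graph_img : forall y, D y -> exists x, H x y;
  graph_sub : forall x y, H x y -> C x /\ D y;
  graph_mono : forall x y x' y', H x y -> H x' y' -> (x < x') = (y < y') }.

Lemma graph_functional C D H x y y' : increasing_graph C D H ->
  H x y -> H x y' -> y = y'.
Proof.
move=> gH xy xy'; apply/le_anti; rewrite !leNgt.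
by rewrite -(graph_mono gH xy xy') -(graph_mono gH xy' xy) ltxx.
Qed.

Lemma graph_injective C D H x x' y : increasing_graph C D H ->
  H x y -> H x' y -> x = x'.
Proof.
move=> gH xy x'y; apply/le_anti; rewrite !leNgt.
by rewrite (graph_mono gH xy x'y) (graph_mono gH x'y xy) ltxx.
Qed.

Lemma autQ_le_mono (f : autQ) : {mono f : x y / x <= y}.
Proof. exact: le_mono (@autQ_homo f). Qed.

Lemma autQ_lt_mono (f : autQ) : {mono f : x y / x < y}.
Proof. exact: leW_mono (@autQ_le_mono f). Qed.

Lemma autQ_inj (f : autQ) : injective f.
Proof. exact: bij_inj (autQ_bij f). Qed.

Lemma autQK (f : autQ) : cancel f (f^-1)%g.
Proof. exact: autQ_invK. Qed.

Lemma autQVK (f : autQ) : cancel (f^-1)%g f.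
Proof. exact: autQ_Kinv. Qed.

Lemma autQM (f g : autQ) x : (f * g)%g x = f (g x).
Proof. by []. Qed.

Lemma autQ_eqV (f : autQ) x y : ((f^-1)%g y = x) <-> (f x = y).
Proof. by split=> [<-|<-]; rewrite ?autQVK ?autQK. Qed.

Lemma autQ_ltV (f : autQ) x y : ((f^-1)%g y < x) = (y < f x).
Proof. by rewrite -(autQ_lt_mono f) autQVK. Qed.

Lemma autQ_gtV (f : autQ) x y : (x < (f^-1)%g y) = (f x < y).
Proof. by rewrite -(autQ_lt_mono f) autQVK. Qed.

Lemma autQ_leV (f : autQ) x y : ((f^-1)%g y <= x) = (y <= f x).
Proof. by rewrite -(autQ_le_mono f) autQVK. Qed.

Lemma autQ_geV (f : autQ) x y : (x <= (f^-1)%g y) = (f x <= y).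
Proof. by rewrite -(autQ_le_mono f) autQVK. Qed.

Lemma graph_autQ H : increasing_graph setT setT H ->
  exists h : autQ, forall x y, H x y <-> h x = y.
Proof.
move=> gH; have [h hP] := choice (fun x => graph_dom gH (I : setT x)).
have [h' h'P] := choice (fun y => graph_img gH (I : setT y)).
have h_homo : {homo h : x y / x < y} by move=> x y; rewrite (graph_mono gH (hP x) (hP y)).
have h_bij : bijective h.
  exists h' => x; first exact: graph_injective gH (h'P _) (hP _).
  exact: graph_functional gH (hP _) (h'P _).
by exists (AutQ h_homo h_bij) => x y /=; split=> [/(graph_functional gH (hP x))|<-].
Qed.

Lemma glue_graphs (E E' : rat -> rat -> Prop) (tau : rat -> rat)
    (H : rat -> rat -> rat -> Prop) :
  convex_equiv E -> convex_equiv E' ->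
  (forall p q, E' (tau p) (tau q) <-> E p q) ->
  (forall p q, ~ E p q -> p < q -> tau p < tau q) ->
  (forall y, exists p, E' (tau p) y) ->
  (forall p, increasing_graph (E p) (E' (tau p)) (H p)) ->
  exists h : autQ, forall x y, H (repr E x) x y <-> h x = y.
Proof.
move=> E_equiv E'_equiv tauE tau_lt tau_surj gH; apply: graph_autQ; split=> //.
- move=> x _; apply: (graph_dom (gH _)).
  exact: equiv_sym E_equiv _ _ (equiv_repr E_equiv x).
- move=> y _; have [p py] := tau_surj y.
  have [|x xy] := @graph_img _ _ _ (gH (repr E p)) y.
    rewrite (equiv_class_eq (y := tau p) E'_equiv)//.
    exact/tauE/(equiv_sym E_equiv)/(equiv_repr E_equiv).
  have [px _] := graph_sub (gH _) xy; exists x.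
  by rewrite -(repr_eq E_equiv px) repr_id.
have H_lt x y x' y' : H (repr E x) x y -> H (repr E x') x' y' -> x < x' -> y < y'.
  move=> xy x'y' xx'; have [e|ne] := pselect (E x x').
    by rewrite -(repr_eq E_equiv e) in x'y'; rewrite -(graph_mono (gH _) xy x'y').
  have [_ ry] := graph_sub (gH _) xy; have [_ ry'] := graph_sub (gH _) x'y'.
  have nrr : ~ E (repr E x) (repr E x').
    by move=> /(repr_eq E_equiv) rr; apply/ne/(equiv_repr_eq E_equiv);
      rewrite -(repr_id E_equiv x) rr repr_id.
  apply: (convex_equiv_lt E'_equiv ry ry'); first by move=> /tauE/nrr.
  apply: tau_lt => //.
  exact: (convex_equiv_lt E_equiv (equiv_repr E_equiv x) (equiv_repr E_equiv x') ne xx').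
move=> x y x' y' xy x'y'; apply/idP/idP; first exact: H_lt.
case: (ltgtP x x') => // [x'x yy'|e].
  by rewrite ltNge (ltW (H_lt _ _ _ _ x'y' xy x'x)) in yy'.
by rewrite -e in x'y'; rewrite (graph_functional (gH _) xy x'y') ltxx.
Qed.

(** * Orbitals *)

Section IntegerPowers.
Variable G : groupType.
Implicit Types (x y : G) (m n : int).

Lemma zexpgS x n : zexpg x (n + 1) = (x * zexpg x n)%g.
Proof.
case: n => [k|[|k]].
- by rewrite -PoszD addn1 /= expgS.
- by rewrite NegzE addNr /= expg1 mulgV.
- rewrite (_ : Negz k.+1 + 1 = Negz k); last by rewrite !NegzE; lia.
  by rewrite /= (expgSr x k.+1) invgM mulVKg.
Qed.

Lemma zexpg_pred x n : zexpg x (n - 1) = (x^-1 * zexpg x n)%g.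
Proof. by rewrite -[in RHS](subrK 1 n) zexpgS mulKg. Qed.

Lemma zexpgD x m n : zexpg x (m + n) = (zexpg x m * zexpg x n)%g.
Proof.
elim: m => [|k IH|k IH]; first by rewrite add0r /= mul1g.
- by rewrite intS -addrA addrC zexpgS IH [1 + _]addrC zexpgS mulgA.
- by rewrite intS opprD -addrA addrC zexpg_pred IH [-1 + _]addrC zexpg_pred mulgA.
Qed.

Lemma zexpgV x n : zexpg (x^-1)%g n = zexpg x (- n).
Proof.
elim: n => [//|k IH|k IH].
- by rewrite intS addrC zexpgS IH opprD -zexpg_pred.
- by rewrite opprK [in LHS]intS opprD addrC zexpg_pred invgK IH opprK intS addrC zexpgS.
Qed.

Lemma zexpgJ x y n : zexpg (x ^ y)%g n = (zexpg x n ^ y)%g.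
Proof. by case: n => k /=; rewrite ?conjVg conjXg. Qed.

End IntegerPowers.

Definition same_orbital (f : autQ) (p q : rat) : Prop :=
  exists i j : int, zexpg f i p <= q <= zexpg f j p.

Definition sg_at (f : autQ) (p : rat) : int := sgz (f p - p).

Lemma sg_at_eq0 f p : (sg_at f p == 0) = (f p == p).
Proof. by rewrite sgz_eq0 subr_eq0. Qed.

Lemma sg_at_eq1 f p : (sg_at f p == 1) = (p < f p).
Proof. by rewrite sgz_cp0 subr_gt0. Qed.

Lemma sg_at_eqN1 f p : (sg_at f p == -1) = (f p < p).
Proof. by rewrite sgz_cp0 subr_lt0. Qed.

Variant sg_at_spec (f : autQ) (p : rat) : int -> Type :=
  | SgAtPos of p < f p : sg_at_spec f p 1
  | SgAtNeg of f p < p : sg_at_spec f p (-1)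
  | SgAtFix of f p = p : sg_at_spec f p 0.

Lemma sg_atP f p : sg_at_spec f p (sg_at f p).
Proof.
case: (ltgtP p (f p)) => [up|down|fixed].
- by rewrite (eqP (etrans (sg_at_eq1 f p) up)); constructor.
- by rewrite (eqP (etrans (sg_at_eqN1 f p) down)); constructor.
- by rewrite (eqP (etrans (sg_at_eq0 f p) (introT eqP (esym fixed)))); constructor.
Qed.

Lemma sg_at_inj (f g : autQ) p q : (p < f p) = (q < g q) -> (f p < p) = (g q < q) ->
  sg_at f p = sg_at g q.
Proof.
by rewrite -!sg_at_eq1 -!sg_at_eqN1; case: (sg_atP f p) => _; case: (sg_atP g q) => _.
Qed.

Section Orbitals.
Variable f : autQ.
Implicit Types p q r : rat.

Lemma zexpg_addE m n p : zexpg f (m + n) p = zexpg f m (zexpg f n p).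
Proof. by rewrite zexpgD. Qed.

Lemma zexpg_succE n p : zexpg f (n + 1) p = f (zexpg f n p).
Proof. by rewrite zexpgS. Qed.

Lemma zexpg_succEr n p : zexpg f (n + 1) p = zexpg f n (f p).
Proof. by rewrite zexpg_addE /= expg1. Qed.

Lemma zexpg_fix n p : f p = p -> zexpg f n p = p.
Proof.
move=> fp; elim: n => [//|k IH|k IH]; first by rewrite intS addrC zexpg_succE IH.
by apply: (@autQ_inj f); rewrite -zexpg_succE (_ : - k.+1%:Z + 1 = - k%:Z) ?IH//; lia.
Qed.

Lemma zexpg_homo p : p <= f p -> {homo (fun n => zexpg f n p) : n m / n <= m}.
Proof.
move=> fp n m; rewrite -subr_ge0 -{2}(subrK n m); case: (m - n) => // k _.
elim: k => [|k IH]; first by rewrite add0r.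
by rewrite intS -addrA addrC zexpg_succEr (le_trans IH)// autQ_le_mono.
Qed.

Lemma same_orbital_zexp n p : same_orbital f p (zexpg f n p).
Proof. by exists n, n; rewrite lexx. Qed.

Lemma same_orbital_step p : same_orbital f p (f p).
Proof. exact: (same_orbital_zexp 1). Qed.

Lemma same_orbital_equiv : convex_equiv (same_orbital f).
Proof.
split=> [p|p q [i [j /andP[iq qj]]]|q p r|p q r [i [j /andP[_ rj]]] /andP[pq qr]].
- exact: (same_orbital_zexp 0).
- exists (- j), (- i); apply/andP; split.
    by rewrite -(autQ_le_mono (zexpg f j)) -zexpg_addE subrr.
  by rewrite -(autQ_le_mono (zexpg f i)) -zexpg_addE subrr.
- move=> [i [j /andP[iq qj]]] [k [l /andP[kr rl]]]; exists (k + i), (l + j).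
  rewrite !zexpg_addE (le_trans _ kr) ?autQ_le_mono//=.
  by rewrite (le_trans rl) ?autQ_le_mono.
- by exists 0, j; rewrite /= pq (le_trans qr).
Qed.

Lemma same_orbital_min (E : rat -> rat -> Prop) p q : convex_equiv E ->
  (forall x, E x (f x)) -> same_orbital f p q -> E p q.
Proof.
move=> E_equiv E_step [i [j /andP[iq qj]]].
have E_zexp n : E p (zexpg f n p).
  elim: n => [|k IH|k IH]; first exact: equiv_refl E_equiv p.
    by rewrite intS addrC zexpg_succE; exact: equiv_trans E_equiv _ _ _ IH (E_step _).
  apply: (equiv_trans E_equiv IH); apply: (equiv_sym E_equiv).
  by rewrite (_ : - k%:Z = - k.+1%:Z + 1) ?zexpg_succE//; lia.
apply: (equiv_trans E_equiv (E_zexp i)); apply: (equiv_convex E_equiv (z := zexpg f j p)).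
  exact: equiv_trans E_equiv _ _ _ (equiv_sym E_equiv (E_zexp i)) (E_zexp j).
by rewrite iq.
Qed.

Lemma same_orbital_fix p q : f p = p -> same_orbital f p q -> q = p.
Proof. by move=> fp [i [j]]; rewrite !zexpg_fix// => /le_anti. Qed.

(* If [f q <= q] then the orbit of [q] is bounded by [q] from the right, whereas
   the orbit of [p] moves up and is cofinal with it. *)
Lemma same_orbital_gt p q : p < f p -> same_orbital f p q -> q < f q.
Proof.
move=> fp [i [j /andP[iq qj]]]; rewrite ltNge; apply/negP => fq.
have orbit_le (k : nat) : zexpg f k%:Z q <= q.
  elim: k => [//|k IH]; rewrite intS addrC zexpg_succEr.
  by apply: le_trans IH; rewrite autQ_le_mono.
have : zexpg f (j + 1) p <= q.
  apply: le_trans (orbit_le (`|j - i| + 1)%N).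
  apply: (@le_trans _ _ (zexpg f ((`|j - i| + 1)%N%:Z + i) p)).
    by apply: zexpg_homo; [exact: ltW|lia].
  by rewrite zexpg_addE autQ_le_mono.
rewrite zexpg_succEr leNgt => /negP; apply.
by apply: le_lt_trans qj _; rewrite autQ_lt_mono.
Qed.

End Orbitals.

Lemma same_orbital_refl f p : same_orbital f p p.
Proof. exact: equiv_refl (same_orbital_equiv f) p. Qed.

Lemma same_orbital_sym f p q : same_orbital f p q -> same_orbital f q p.
Proof. exact: (equiv_sym (same_orbital_equiv f)). Qed.

Lemma same_orbital_trans f q p r :
  same_orbital f p q -> same_orbital f q r -> same_orbital f p r.
Proof. exact: (equiv_trans (same_orbital_equiv f)). Qed.

Lemma same_orbital_convex f p q r :
  same_orbital f p r -> p <= q <= r -> same_orbital f p q.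
Proof. exact: (equiv_convex (same_orbital_equiv f)). Qed.

Lemma same_orbitalV f : same_orbital (f^-1)%g = same_orbital f.
Proof.
apply/funext => p; apply/seteqP; split=> q [i [j ij]]; exists (- i), (- j).
  by rewrite -!zexpgV.
by rewrite !zexpgV !opprK.
Qed.

Lemma same_orbital_sg f p q : same_orbital f p q -> sg_at f p = sg_at f q.
Proof.
move=> pq; case: (sg_atP f p) => fp; apply/esym/eqP.
- by rewrite sg_at_eq1; exact: same_orbital_gt pq.
- rewrite sg_at_eqN1 -autQ_gtV; apply: (same_orbital_gt (p := p)).
    by rewrite autQ_gtV.
  by rewrite same_orbitalV.
- by rewrite (same_orbital_fix fp pq) sg_at_eq0 fp.
Qed.

(** * Conjugacy *)

Section FundamentalDomain.
Variables (f : autQ) (p : rat) (fp : p < f p).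
Implicit Types q r s : rat.

Lemma fundamental_domain q : same_orbital f p q ->
  exists n r, p <= r < f p /\ q = zexpg f n r.
Proof.
move=> [i [j /andP[iq qj]]].
have {qj}: q < zexpg f (i + (`|j - i| + 1)%N%:Z) p.
  apply: le_lt_trans qj _.
  have : zexpg f (j + 1) p <= zexpg f (i + (`|j - i| + 1)%N%:Z) p.
    by apply: zexpg_homo; [exact: ltW|lia].
  by apply: lt_le_trans; rewrite zexpg_succEr autQ_lt_mono.
elim: (_ + 1)%N => [|d IH]; first by rewrite addr0 ltNge iq.
have [h _|h] := ltP q (zexpg f (i + d%:Z) p); first exact: IH.
rewrite intS (addrC 1) addrA zexpg_succEr => h'.
exists (i + d%:Z), (zexpg f (- (i + d%:Z)) q).
rewrite -zexpg_addE addrN; split=> //; apply/andP; split.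
  by rewrite -(autQ_le_mono (zexpg f (i + d%:Z))) -zexpg_addE addrN.
by rewrite -(autQ_lt_mono (zexpg f (i + d%:Z))) -zexpg_addE addrN.
Qed.

Lemma fundamental_domain_ltE n m r s : p <= r < f p -> p <= s < f p ->
  (zexpg f n r < zexpg f m s) = ((n < m) || (n == m) && (r < s)).
Proof.
have lt_nm k l x y : k < l -> x < f p -> p <= y -> zexpg f k x < zexpg f l y.
  move=> kl xf py; have : zexpg f k x < zexpg f (k + 1) p.
    by rewrite zexpg_succEr autQ_lt_mono.
  move=> /lt_le_trans; apply; apply: (@le_trans _ _ (zexpg f l p)).
    by apply: zexpg_homo; [exact: ltW|lia].
  by rewrite autQ_le_mono.
move=> /andP[pr rf] /andP[ps sf]; case: (ltgtP n m) => [nm|mn|->] /=.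
- by rewrite lt_nm.
- by apply/negbTE; rewrite -leNgt ltW// lt_nm.
- by rewrite autQ_lt_mono.
Qed.

End FundamentalDomain.

Section Affine.
Variables (F : realFieldType) (a b a' b' : F).
Hypotheses (ab : a < b) (a'b' : a' < b').

Definition affine (a b a' b' r : F) : F := a' + (r - a) / (b - a) * (b' - a').

Lemma affine_lt_mono : {mono affine a b a' b' : r s / r < s}.
Proof.
move=> r s; rewrite /affine ltrD2l ltr_pM2r ?subr_gt0//.
by rewrite ltr_pM2r ?invr_gt0 ?subr_gt0// ltrD2r.
Qed.

Lemma affine_left : affine a b a' b' a = a'.
Proof. by rewrite /affine subrr !mul0r addr0. Qed.

Lemma affine_right : affine a b a' b' b = b'.
Proof. by rewrite /affine divff ?subr_eq0 ?gt_eqF// mul1r addrC subrK. Qed.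

Lemma affine_itv r : (a' <= affine a b a' b' r < b') = (a <= r < b).
Proof.
congr (_ && _); last by rewrite -[X in _ < X]affine_right affine_lt_mono.
by rewrite -[X in X <= _]affine_left !leNgt affine_lt_mono.
Qed.

Lemma affineK : cancel (affine a' b' a b) (affine a b a' b').
Proof. by move=> r; rewrite /affine; field; rewrite !subr_eq0 !gt_eqF. Qed.

End Affine.

Definition equivariant (f f' : autQ) (H : rat -> rat -> Prop) : Prop :=
  forall q y, H q y <-> H (f q) (f' y).

(* The fundamental domains [p, f p[ and [x, f' x[ are matched by an affine map,
   which is then extended equivariantly. *)
Lemma orbital_iso_gt (f f' : autQ) p x : p < f p -> x < f' x ->
  exists2 H, increasing_graph (same_orbital f p) (same_orbital f' x) H &
    equivariant f f' H.
Proof.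
move=> fp fx; pose A := affine p (f p) x (f' x).
have A_itv r : p <= r < f p -> x <= A r < f' x by rewrite affine_itv.
exists (fun q y => exists n r, [/\ p <= r < f p, q = zexpg f n r & y = zexpg f' n (A r)]).
  split=> [q|y|q y|q y q' y'].
  - move=> /(fundamental_domain fp)[n [r [r_itv ->]]].
    by exists (zexpg f' n (A r)), n, r.
  - move=> /(fundamental_domain fx)[n [r [r_itv ->]]].
    exists (zexpg f n (affine x (f' x) p (f p) r)), n, (affine x (f' x) p (f p) r).
    by rewrite affine_itv// /A affineK.
  - move=> [n [r [r_itv -> ->]]]; have /andP[xAr Arx] := A_itv _ r_itv.
    move: r_itv => /andP[pr rp]; split; apply: same_orbital_trans (same_orbital_zexp _ n _);
      apply: same_orbital_convex (same_orbital_step _ _) _.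
      by rewrite pr ltW.
    by rewrite xAr ltW.
  - move=> [n [r [r_itv -> ->]]] [m [s [s_itv -> ->]]].
    rewrite (fundamental_domain_ltE fp)// (fundamental_domain_ltE fx) ?A_itv//.
    by rewrite affine_lt_mono.
move=> q y; split=> [[n [r [r_itv -> ->]]]|[n [r [r_itv fq fy]]]].
  by exists (n + 1), r; rewrite !zexpg_succE.
exists (n - 1), r; split=> //.
  by apply: (@autQ_inj f); rewrite -zexpg_succE subrK.
by apply: (@autQ_inj f'); rewrite -zexpg_succE subrK.
Qed.

Lemma orbital_iso (f f' : autQ) p x : sg_at f p = sg_at f' x ->
  exists2 H, increasing_graph (same_orbital f p) (same_orbital f' x) H &
    equivariant f f' H.
Proof.
case: (sg_atP f p) => fp; case: (sg_atP f' x) => fx// _; first exact: orbital_iso_gt.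
  have [||H gH eH] := @orbital_iso_gt (f^-1)%g (f'^-1)%g p x; rewrite ?autQ_gtV//.
  rewrite !same_orbitalV in gH; exists H => // q y.
  by rewrite (eH (f q)) !autQK.
exists (fun q y => q = p /\ y = x); first split.
- by move=> q /(same_orbital_fix fp) ->; exists x.
- by move=> y /(same_orbital_fix fx) ->; exists p.
- by move=> q y [-> ->]; split; exact: same_orbital_refl.
- by move=> q y q' y' [-> ->] [-> ->]; rewrite !ltxx.
move=> q y; split=> [[-> ->]//|[fq fy]].
by split; [apply: (@autQ_inj f); rewrite fq|apply: (@autQ_inj f'); rewrite fy].
Qed.

Definition sign_alternating (f : autQ) : Prop := forall p q, p < q ->
  ~ same_orbital f p q -> sg_at f p = sg_at f q -> sg_at f p != 0 ->
  exists r, [/\ p < r, r < q & sg_at f r != sg_at f p].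

(* [rho x p] assigns the orbital of [p] under [f] to the orbital of [x] under
   [f'], for [x] and [p] in [C]. *)
Record orbital_matching (C : set rat) (f f' : autQ) (rho : rat -> rat -> Prop) : Prop := {
  matching_sub : forall x p, rho x p -> C x /\ C p;
  matching_dom : forall x, C x -> exists p, rho x p;
  matching_img : forall p, C p -> exists x, rho x p;
  matching_sg : forall x p, rho x p -> sg_at f' x = sg_at f p;
  matching_le : forall x p y q, rho x p -> rho y q -> x <= y ->
    p < q \/ same_orbital f p q;
  matching_same : forall x p y q, rho x p -> rho y q -> x < y ->
    same_orbital f p q -> same_orbital f' x y }.

Lemma matching_lt C f f' rho x p y q : orbital_matching C f f' rho ->
  rho x p -> rho y q -> ~ same_orbital f p q -> p < q -> x < y.
Proof.
move=> mrho xp yq npq pq; rewrite ltNge; apply/negP => /(matching_le mrho yq xp)[qp|].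
  by move: (lt_trans pq qp); rewrite ltxx.
by move=> /same_orbital_sym.
Qed.

(* Orbitals of [f] with the same sign are separated by a point [r] with another
   sign, and a point matched with [r] separates the orbitals of [f']. *)
Lemma matching_separates f f' rho x p y q : sign_alternating f ->
  orbital_matching setT f f' rho -> rho x p -> rho y q ->
  ~ same_orbital f p q -> p < q -> ~ same_orbital f' x y.
Proof.
move=> f_alt mrho xp yq npq pq xy; have sg_rho := matching_sg mrho.
have sg_pq : sg_at f p = sg_at f q.
  by rewrite -(sg_rho _ _ xp) -(sg_rho _ _ yq); exact: same_orbital_sg.
have x_lt_y := matching_lt mrho xp yq npq pq.
have [sg_p0|sg_p0] := eqVneq (sg_at f p) 0.
  have fx : f' x = x by apply/eqP; rewrite -sg_at_eq0 (sg_rho _ _ xp) sg_p0.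
  by move: x_lt_y; rewrite (same_orbital_fix fx xy) ltxx.
have [r [pr rq sg_rp]] := f_alt _ _ pq npq sg_pq sg_p0.
have [z zr] := matching_img mrho (I : setT r).
have xz : x < z.
  by apply: (matching_lt mrho xp zr _ pr) => /same_orbital_sg e; rewrite e eqxx in sg_rp.
have zy : z < y.
  by apply: (matching_lt mrho zr yq _ rq) => /same_orbital_sg e; rewrite e sg_pq eqxx in sg_rp.
have /same_orbital_sg : same_orbital f' x z.
  by apply: (same_orbital_convex xy); rewrite !ltW.
by rewrite (sg_rho _ _ xp) (sg_rho _ _ zr) => e; rewrite e eqxx in sg_rp.
Qed.

Lemma matching_same_orbitalE f f' rho x p y q : sign_alternating f ->
  orbital_matching setT f f' rho -> rho x p -> rho y q ->
  same_orbital f' x y <-> same_orbital f p q.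
Proof.
move=> f_alt mrho xp yq; split=> [xy|pq].
  apply: contrapT => npq; case: (ltgtP p q) => [p_lt_q|q_lt_p|e].
  - exact: matching_separates mrho xp yq npq p_lt_q xy.
  - apply: (matching_separates f_alt mrho yq xp _ q_lt_p (same_orbital_sym xy)).
    by move=> /same_orbital_sym.
  - by apply: npq; rewrite e; exact: same_orbital_refl.
case: (ltgtP x y) => [xy|yx|->].
- exact: (matching_same mrho) pq.
- exact/same_orbital_sym/(matching_same mrho yq xp)/same_orbital_sym.
- exact: same_orbital_refl.
Qed.

Lemma conjugacy_criterion f f' rho : sign_alternating f ->
  orbital_matching setT f f' rho -> conjugacy_class f f'.
Proof.
move=> f_alt mrho; have [tau tauP] := choice (fun p => matching_img mrho (I : setT p)).
have [H gH eH] : exists2 H : rat -> rat -> rat -> Prop,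
    forall p, increasing_graph (same_orbital f p) (same_orbital f' (tau p)) (H p) &
    forall p, equivariant f f' (H p).
  have : forall p, exists Hp, increasing_graph (same_orbital f p)
      (same_orbital f' (tau p)) Hp /\ equivariant f f' Hp.
    by move=> p; have [Hp ? ?] := orbital_iso (esym (matching_sg mrho (tauP p))); exists Hp.
  by move=> /choice[H HP]; exists H => p; have [] := HP p.
have [|||h hP] := glue_graphs (same_orbital_equiv f) (same_orbital_equiv f') _ _ _ gH.
- by move=> p q; exact: matching_same_orbitalE f_alt mrho (tauP p) (tauP q).
- by move=> p q; exact: matching_lt mrho (tauP p) (tauP q).
- move=> y; have [p yp] := matching_dom mrho (I : setT y).
  by exists p; apply/(matching_same_orbitalE f_alt mrho (tauP p) yp); exact: same_orbital_refl.
have hf : (f' * h = h * f)%g.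
  apply: autQ_ext => q; rewrite !autQM; apply/esym/hP.
  rewrite -(repr_eq (same_orbital_equiv f) (same_orbital_step f q)).
  by apply/(eH _ q (h q))/hP.
by exists (h^-1)%g => //; rewrite /conjg invgK mulgA -hf mulgK.
Qed.

(** * Chains of nodes *)

Section Chains.
Variable T : eqType.
Implicit Types (A : set T) (step : T -> T -> Prop) (e d : T) (l : seq T).

Inductive chain A step : T -> seq T -> T -> Prop :=
| chain_nil e : A e -> chain A step e [::] e
| chain_cons e d l e' : A e -> step e d -> chain A step d l e' ->
    chain A step e (d :: l) e'.

Lemma chain1 A step e e' : A e -> A e' -> step e e' -> chain A step e [:: e'] e'.
Proof. by move=> Ae Ae' ee'; apply: chain_cons ee' _ => //; exact: chain_nil. Qed.

Lemma chain2 A step e d e' : A e -> A d -> A e' -> step e d -> step d e' ->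
  chain A step e [:: d; e'] e'.
Proof. by move=> Ae Ad Ae' ed de'; apply: chain_cons ed _ => //; exact: chain1. Qed.

Lemma chain_cat A step e l d l' e' : chain A step e l d -> chain A step d l' e' ->
  chain A step e (l ++ l') e'.
Proof. by elim=> // {}e c m {}d Ae ec _ IH /IH; exact: chain_cons. Qed.

Lemma chain_mem A step e l e' d : chain A step e l e' -> d \in e :: l -> A d.
Proof.
elim=> {e l e'} [e Ae|e c l e' Ae _ _ IH]; rewrite inE; first by move=> /eqP ->.
by move=> /predU1P[->|/IH].
Qed.

Lemma chain_last A step e l e' : chain A step e l e' -> e' \in e :: l.
Proof. by elim=> [{}e _|{}e d {}l {}e' _ _ _ IH]; rewrite inE ?eqxx ?IH ?orbT. Qed.

Lemma sub_cons_cat e l l' : {subset e :: l <= e :: l ++ l'}.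
Proof. by move=> c; rewrite -cat_cons mem_cat => ->. Qed.

Lemma chain_sub_cat A step e l d l' : chain A step e l d -> {subset d :: l' <= e :: l ++ l'}.
Proof.
move=> ch c; rewrite inE => /predU1P[->|cl']; first exact/sub_cons_cat/(chain_last ch).
by rewrite inE mem_cat cl' !orbT.
Qed.

Lemma chain_trichotomy A step (R : T -> T -> Prop) e l e' :
  (forall c a b, R a c -> R c b -> R a b) -> chain A step e l e' ->
  (forall d d', d \in e :: l -> d' \in e :: l -> step d d' -> R d d') ->
  forall d d', d \in e :: l -> d' \in e :: l -> [\/ d = d', R d d' | R d' d].
Proof.
move=> R_trans ch stepR; suff [] : (forall d, d \in l -> R e d) /\
    forall d d', d \in e :: l -> d' \in e :: l -> [\/ d = d', R d d' | R d' d] by [].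
elim: ch stepR => {e l e'} [e _ _|e d l e' _ ed _ IH stepR].
  by split=> // c c' /[!inE] /eqP -> /eqP ->; constructor 1.
have [|d_min tri] := IH.
  by move=> c c' cl c'l; apply: stepR; rewrite inE ?cl ?c'l orbT.
have e_min c : c \in d :: l -> R e c.
  have Red : R e d by apply: stepR; rewrite // !inE eqxx ?orbT.
  by rewrite inE => /predU1P[->//|/d_min]; exact: R_trans.
split=> // c c'; rewrite ![_ \in e :: _]inE.
move=> /predU1P[->|cl] /predU1P[->|c'l]; first by constructor 1.
- by constructor 2; exact: e_min.
- by constructor 3; exact: e_min.
- exact: tri.
Qed.

Definition reaches (I : Type) (g : I -> T -> rat) (t : rat) (hit : I -> T -> Prop) e l e' :=
  forall i, g i e < t -> t <= g i e' -> exists2 c, c \in e :: l & hit i c.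

Lemma refine_chain A step1 step2 (I : Type) (g : I -> T -> rat) t (hit : I -> T -> Prop) :
  (forall d d', A d -> A d' -> step1 d d' ->
     exists2 l, chain A step2 d l d' & reaches g t hit d l d') ->
  forall e l e', chain A step1 e l e' -> exists l',
    [/\ chain A step2 e l' e', {subset e :: l <= e :: l'} & reaches g t hit e l' e'].
Proof.
move=> refine_step e l e'; elim=> {e l e'} [e Ae|e d l e' Ae ed ch [l2 [ch2 sub2 meet2]]].
  exists [::]; split=> //; first exact: chain_nil.
  by move=> i ge /(lt_le_trans ge); rewrite ltxx.
have Ad : A d by apply: chain_mem ch _; rewrite inE eqxx.
have [l1 ch1 meet1] := refine_step _ _ Ae Ad ed.
have sub21 := chain_sub_cat ch1 (l' := l2).
exists (l1 ++ l2); split; first exact: chain_cat ch1 ch2.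
  by move=> c; rewrite inE => /predU1P[->|/sub2/sub21 //]; rewrite inE eqxx.
move=> i ge ge'; have [td|dt] := leP t (g i d).
  by have [c /sub_cons_cat cl ?] := meet1 i ge td; exists c.
by have [c /sub21 cl ?] := meet2 i dt ge'; exists c.
Qed.

End Chains.

Lemma chain_map (T T' : eqType) (A : set T) (A' : set T') step step' (h : T -> T') e l e' :
  (forall d, A d -> A' (h d)) ->
  (forall d d', step d d' -> step' (h d) (h d')) ->
  chain A step e l e' -> chain A' step' (h e) (map h l) (h e').
Proof.
move=> hA h_step; elim=> {e l e'} [e /hA|e d l e' /hA Ae /h_step ed _ IH].
  exact: chain_nil.
exact: chain_cons ed IH.
Qed.

(** * Nodes and sign patterns *)

Record open_interval (X : set rat) : Prop := {
  itv_nonempty : X !=set0;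
  itv_convex : forall x y z, X x -> X z -> x <= y <= z -> X y;
  itv_no_min : forall x, X x -> exists2 y, X y & y < x;
  itv_no_max : forall x, X x -> exists2 y, X y & x < y }.

Lemma itv_between X x y z : open_interval X -> X x -> X z -> x < y < z -> X y.
Proof. by move=> iX Xx Xz /andP[xy yz]; apply: (itv_convex iX Xx Xz); rewrite !ltW. Qed.

Definition finite_valued (K : set autQ) := forall q, exists vs : seq rat,
  forall k, K k -> k q \in vs /\ (k^-1)%g q \in vs.

(* An automorphism [phi] is sought such that the maps [k] of the pattern lie
   above and below [phi] as prescribed: every [k] matches the orbitals of
   [phi^-1 * k] in [base] with the classes of [eqv], those with [pos] being the
   ones where [k] is above [phi]. *)
Record sign_pattern := SignPattern {
  base : set rat;
  pos : rat -> bool;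
  eqv : rat -> rat -> Prop;
  maps : set autQ }.

Record well_posed (F : sign_pattern) : Prop := {
  base_itv : open_interval (base F);
  maps_finite : finite_valued (maps F);
  maps_stable : forall k, maps F k -> forall x, base F (k x) <-> base F x;
  eqv_equiv : convex_equiv (eqv F);
  eqv_pos : forall p q, eqv F p q -> pos F p = pos F q;
  pos_alternating : forall p q, base F p -> base F q -> p < q -> ~ eqv F p q ->
    pos F p = pos F q -> exists2 r, p < r < q & pos F r = ~~ pos F p }.

(* A node is a point of the graph of [phi]; the class of [label k] is the one
   matched with the orbital of [node_x] under [phi^-1 * k]. *)
Record node := Node { node_x : rat; node_y : rat; label : autQ -> rat }.
HB.instance Definition _ := gen_eqMixin node.

Definition on_side (b : bool) (k : autQ) (x y : rat) : bool :=
  if b then y < k x else k x < y.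

Definition admissible (F : sign_pattern) (e : node) : Prop :=
  [/\ base F (node_x e), base F (node_y e) & forall k, maps F k ->
    base F (label e k) /\ on_side (pos F (label e k)) k (node_x e) (node_y e)].

(* [k] stays on one side of every monotone graph from [e] to [e']. *)
Definition clears (F : sign_pattern) (k : autQ) (e e' : node) : Prop :=
  label e k = label e' k /\
  if pos F (label e k) then node_y e' < k (node_x e) else k (node_x e') < node_y e.

(* [k] starts above [phi] at [e] and is below it at [e']. *)
Definition falls (F : sign_pattern) (p q : rat) (k : autQ) (e e' : node) : Prop :=
  [/\ label e k = p, label e' k = q, p < q, pos F p & ~~ pos F q].

Definition clear_step F e e' : Prop :=
  [/\ node_x e < node_x e', node_y e < node_y e' & forall k, maps F k -> clears F k e e'].

Definition falling_step F p q e e' : Prop :=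
  [/\ node_x e < node_x e', node_y e < node_y e' &
    forall k, maps F k -> clears F k e e' \/ falls F p q k e e'].

Lemma clear_falling_step F p q e e' : clear_step F e e' -> falling_step F p q e e'.
Proof. by move=> [xx' yy' clear]; split=> // k /clear; left. Qed.

Variant falling_step_spec F p q k e e' : Prop :=
  | StepClears of label e k = label e' k & clears F k e e'
  | StepFalls of label e k = p & label e' k = q & p < q & pos F p & ~~ pos F q.

Lemma falling_stepP F p q e e' k : falling_step F p q e e' -> maps F k ->
  falling_step_spec F p q k e e'.
Proof. by move=> [_ _ via] /via[[kk' cl]|[]]; [left|right]. Qed.

Lemma falling_step_clears F p q e e' k : falling_step F p q e e' -> maps F k ->
  label e k = label e' k -> clears F k e e'.
Proof. by move=> ee' /(falling_stepP ee')[//|-> -> + _ _ pq]; rewrite pq ltxx. Qed.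

Lemma clears_sub F k e e' d d' : clears F k e e' ->
  label d k = label e k -> label d' k = label e k ->
  node_x e <= node_x d -> node_x d' <= node_x e' ->
  node_y e <= node_y d -> node_y d' <= node_y e' -> clears F k d d'.
Proof.
move=> [_ cl] ld ld' xd xd' yd yd'; split; first by rewrite ld ld'.
rewrite ld; case: ifP cl => _ cl.
  by rewrite (le_lt_trans yd')// (lt_le_trans cl)// autQ_le_mono.
by rewrite (lt_le_trans _ yd)// (le_lt_trans _ cl)// autQ_le_mono.
Qed.

Lemma clears_on_side F k e e' d : clears F k e e' -> label d k = label e k ->
  node_x e <= node_x d <= node_x e' -> node_y e <= node_y d <= node_y e' ->
  on_side (pos F (label d k)) k (node_x d) (node_y d).
Proof.
move=> cl ld /andP[xd xd'] /andP[yd yd'].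
by have [_] := clears_sub cl ld ld xd xd' yd yd'.
Qed.

(* Exchanging the two coordinates and reversing the order of the rationals are
   symmetries of the problem, which reduce every step to a falling one. *)
Definition node_tr (e : node) := Node (node_y e) (node_x e) (fun k => label e (k^-1)%g).

Definition pattern_tr (F : sign_pattern) :=
  SignPattern (base F) (fun p => ~~ pos F p) (eqv F) [set k | maps F (k^-1)%g].

Lemma node_trK : involutive node_tr.
Proof.
by case=> x y l; rewrite /node_tr /=; congr Node; apply/funext => k; rewrite invgK.
Qed.

Lemma pattern_trK : involutive pattern_tr.
Proof.
case=> C s E K; rewrite /pattern_tr /=; congr SignPattern.
  by apply/funext => p; rewrite negbK.
by apply/funext => k; rewrite /= invgK.
Qed.

Lemma well_posed_tr F : well_posed F -> well_posed (pattern_tr F).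
Proof.
move=> [iB fin stable eE eqv_pos alt]; split=> //.
- by move=> q; have [vs vsP] := fin q; exists vs => k /vsP; rewrite invgK => -[].
- by move=> k /stable kB x; rewrite -kB autQK.
- by move=> p q /= /eqv_pos ->.
- move=> p q Bp Bq pq npq /= /negb_inj spq; have [r prq sr] := alt _ _ Bp Bq pq npq spq.
  by exists r; rewrite //= sr.
Qed.

Lemma admissible_tr F e : admissible F e -> admissible (pattern_tr F) (node_tr e).
Proof.
move=> [Bx By side]; split=> // k /side[Bl]; split=> //=; move: b; rewrite /on_side /=.
by case: (pos F _) => /=; rewrite ?autQ_gtV ?autQ_ltV.
Qed.

Lemma clears_tr F k e e' : clears F (k^-1)%g e e' ->
  clears (pattern_tr F) k (node_tr e) (node_tr e').
Proof.
move=> [ll' cl]; split=> //=; move: cl.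
by case: (pos F _) => /=; rewrite ?autQ_gtV ?autQ_ltV.
Qed.

(* [step (pattern_tr F)] consists of the steps on which the maps rise above
   [phi]. *)
Definition step F e e' : Prop := (exists p q, falling_step F p q e e') \/
  exists p q, falling_step (pattern_tr F) p q (node_tr e) (node_tr e').

Definition node_chain F := chain (admissible F) (step F).

Lemma clear_stepW F e e' : clear_step F e e' -> step F e e'.
Proof. by move=> /clear_falling_step ee'; left; exists 0, 0. Qed.

Lemma stepP F e e' k : step F e e' -> maps F k -> clears F k e e' \/
  label e k < label e' k /\ pos F (label e' k) = ~~ pos F (label e k).
Proof.
case=> [[p [q [_ _ via]]] /via[|[-> -> pq pp nq]]|[p [q [_ _ via]]] Kk]; first by left.
  by right; split; rewrite // pp (negbTE nq).
have [|/clears_tr|] := via (k^-1)%g; first by rewrite /= invgK.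
  by rewrite pattern_trK !node_trK; left.
rewrite /falls /= invgK => -[-> -> pq np /negPn qq].
by right; rewrite qq np.
Qed.

Lemma step_lt F e e' : step F e e' -> node_x e < node_x e' /\ node_y e < node_y e'.
Proof. by case=> -[p [q []]]. Qed.

Lemma step_tr F e e' : step F e e' -> step (pattern_tr F) (node_tr e) (node_tr e').
Proof. by case=> ee'; [right|left]; rewrite ?pattern_trK ?node_trK. Qed.

Lemma chain_tr F e l e' : node_chain F e l e' ->
  node_chain (pattern_tr F) (node_tr e) (map node_tr l) (node_tr e').
Proof. by apply: chain_map => [d /admissible_tr|d d' /step_tr]. Qed.

Lemma chain_untr F e l e' : node_chain (pattern_tr F) (node_tr e) l (node_tr e') ->
  node_chain F e (map node_tr l) e'.
Proof. by move=> /chain_tr; rewrite pattern_trK !node_trK. Qed.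

Lemma opp_autQ_homo (k : autQ) : {homo (fun x => - k (- x)) : x y / x < y}.
Proof. by move=> x y xy; rewrite ltrN2 autQ_lt_mono ltrN2. Qed.

Lemma opp_autQ_bij (k : autQ) : bijective (fun x => - k (- x)).
Proof. by exists (fun x => - (k^-1)%g (- x)) => x; rewrite opprK ?autQK ?autQVK opprK. Qed.

Definition opp_autQ (k : autQ) : autQ := AutQ (@opp_autQ_homo k) (opp_autQ_bij k).

Lemma opp_autQK : involutive opp_autQ.
Proof. by move=> k; apply: autQ_ext => x /=; rewrite !opprK. Qed.

Lemma opp_autQV k : (opp_autQ k)^-1%g = opp_autQ (k^-1)%g.
Proof. by apply: autQ_ext => x; apply/autQ_eqV; rewrite /= opprK autQVK opprK. Qed.

Definition node_rv (e : node) :=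
  Node (- node_x e) (- node_y e) (fun k => - label e (opp_autQ k)).

Definition pattern_rv (F : sign_pattern) :=
  SignPattern [set x | base F (- x)] (fun p => ~~ pos F (- p))
    (fun p q => eqv F (- p) (- q)) [set k | maps F (opp_autQ k)].

Lemma node_rvK : involutive node_rv.
Proof.
case=> x y l; rewrite /node_rv /= !opprK; congr Node.
by apply/funext => k; rewrite opprK opp_autQK.
Qed.

Lemma pattern_rvK : involutive pattern_rv.
Proof.
case=> C s E K; rewrite /pattern_rv /=; congr SignPattern.
- by apply/funext => p; rewrite /= opprK.
- by apply/funext => p; rewrite negbK opprK.
- by apply/funext => p; apply/funext => q; rewrite !opprK.
- by apply/funext => k; rewrite /= opp_autQK.
Qed.

Lemma well_posed_rv F : well_posed F -> well_posed (pattern_rv F).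
Proof.
move=> [[[x0 Bx0] conv no_min no_max] fin stable eE eqv_pos alt].
split=> [||k||p q|p q].
- split=> [|x y z Bx Bz /andP[xy yz]|x /no_max[y By xy]|x /no_min[y By yx]].
  + by exists (- x0); rewrite /= opprK.
  + by apply: conv Bz Bx _; rewrite !lerN2 yz.
  + by exists (- y); rewrite /= ?opprK// ltrNl.
  + by exists (- y); rewrite /= ?opprK// ltrNr.
- move=> q; have [vs vsP] := fin (- q); exists (map -%R vs) => k /vsP[kq kVq].
  by split; [move/(map_f -%R): kq|move/(map_f -%R): kVq]; rewrite ?opp_autQV /= !opprK.
- by move=> /stable kB x; have := kB (- x); rewrite /= opprK.
- split=> [p|p q|q p r|p q r].
  + exact: (equiv_refl eE).
  + exact: (equiv_sym eE).
  + exact: (equiv_trans eE).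
  + move=> pr /andP[pq qr]; apply: (equiv_trans eE pr); apply: (equiv_convex eE (equiv_sym eE pr)).
    by rewrite !lerN2 qr.
- by move=> /eqv_pos /= ->.
- move=> Bp Bq pq npq /negb_inj spq.
  have [|||r /andP[qr rp] sr] := alt (- q) (- p) Bq Bp; rewrite ?ltrN2//.
    by move=> /(equiv_sym eE).
  by exists (- r); rewrite /= ?opprK ?sr -?spq// ltrNr rp ltrNl qr.
Qed.

Lemma admissible_rv F e : admissible F e -> admissible (pattern_rv F) (node_rv e).
Proof.
move=> [Bx By side]; split=> /= [||k /side[Bl]]; rewrite ?opprK//; split=> //.
move: b; rewrite /on_side /=.
by case: (pos F _) => /=; [rewrite ltrNr|rewrite ltrNl].
Qed.

Lemma clears_rv F k e e' : clears F (opp_autQ k) e e' ->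
  clears (pattern_rv F) k (node_rv e') (node_rv e).
Proof.
move=> [ll' cl]; split; rewrite /= ?ll'// opprK -ll'; move: cl.
by case: (pos F _) => /=; [rewrite ltrNr|rewrite ltrNl].
Qed.

Lemma clear_step_rv F e e' : clear_step F e e' ->
  clear_step (pattern_rv F) (node_rv e') (node_rv e).
Proof.
move=> [xx' yy' clear]; split=> [||k /clear/clears_rv//].
- by rewrite /= ltrN2.
- by rewrite /= ltrN2.
Qed.

Lemma falling_step_rv F p q e e' : falling_step F p q e e' ->
  falling_step (pattern_rv F) (- q) (- p) (node_rv e') (node_rv e).
Proof.
move=> [xx' yy' via]; split=> [||k /via[/clears_rv|[ep e'q pq pp nq]]].
- by rewrite /= ltrN2.
- by rewrite /= ltrN2.
- by left.
- by right; split; rewrite /= ?ep ?e'q ?ltrN2// opprK// pp.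
Qed.

Lemma pattern_tr_rv F : pattern_tr (pattern_rv F) = pattern_rv (pattern_tr F).
Proof.
by congr SignPattern; apply/funext => k; rewrite /= opp_autQV.
Qed.

Lemma node_tr_rv e : node_tr (node_rv e) = node_rv (node_tr e).
Proof. by congr Node; apply/funext => k; rewrite /= opp_autQV. Qed.

Lemma step_rv F e e' : step F e e' -> step (pattern_rv F) (node_rv e') (node_rv e).
Proof.
case=> -[p [q /falling_step_rv ee']]; [left|right]; exists (- q), (- p) => //.
by rewrite pattern_tr_rv !node_tr_rv.
Qed.

Lemma chain_rv F e l e' : node_chain F e l e' ->
  exists l', node_chain (pattern_rv F) (node_rv e') l' (node_rv e).
Proof.
elim=> {e l e'} [e /admissible_rv|e d l e' /admissible_rv Ae /step_rv ed _ [l' ch]].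
  by exists [::]; exact: chain_nil.
exists (l' ++ [:: node_rv e]); apply: (chain_cat ch); apply: chain1 => //.
exact: (chain_mem ch (chain_last ch)).
Qed.

(** * Inserting nodes *)

Section Between.
Variables (F : sign_pattern) (p q : rat) (e e' : node).
Hypotheses (wF : well_posed F) (Ae : admissible F e) (Ae' : admissible F e').
Hypothesis ee' : falling_step F p q e e'.

(* The maps that clear the step from [e] to [e'] impose no condition on the
   nodes inserted between [e] and [e'], provided that they keep their label. *)
Lemma admissible_between d :
  node_x e < node_x d < node_x e' -> node_y e < node_y d < node_y e' ->
  (forall k, label e k = label e' k -> label d k = label e k) ->
  (forall k, maps F k -> label e k <> label e' k ->
    base F (label d k) /\ on_side (pos F (label d k)) k (node_x d) (node_y d)) ->
  admissible F d.
Proof.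
move=> xd yd keep fall; have [[Bx By side] [Bx' By' _]] := (Ae, Ae').
split=> [||k Kk].
- exact: itv_between (base_itv wF) Bx Bx' xd.
- exact: itv_between (base_itv wF) By By' yd.
have [ll'|nll'] := pselect (label e k = label e' k); last exact: fall.
split; first by rewrite keep//; have [] := side _ Kk.
move: xd yd => /andP[ex xe'] /andP[ey ye'].
by apply: (clears_on_side (falling_step_clears ee' Kk ll')); rewrite ?keep// !ltW.
Qed.

Lemma falling_step_between p' q' d d' :
  node_x e <= node_x d < node_x d' -> node_x d' <= node_x e' ->
  node_y e <= node_y d < node_y d' -> node_y d' <= node_y e' ->
  (forall k, label e k = label e' k -> label d k = label e k) ->
  (forall k, label e k = label e' k -> label d' k = label e k) ->
  (forall k, maps F k -> label e k <> label e' k ->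
    clears F k d d' \/ falls F p' q' k d d') ->
  falling_step F p' q' d d'.
Proof.
move=> /andP[ex xx'] x'e' /andP[ey yy'] y'e' keep keep' fall; split=> // k Kk.
have [ll'|nll'] := pselect (label e k = label e' k); last exact: fall.
by left; apply: (clears_sub (falling_step_clears ee' Kk ll')); rewrite ?keep ?keep'.
Qed.

Lemma falling_labels k : maps F k -> label e k <> label e' k ->
  [/\ label e k = p, label e' k = q, p < q, pos F p & ~~ pos F q].
Proof. by move=> /(falling_stepP ee')[]. Qed.

Lemma falling_side k : maps F k -> label e k <> label e' k ->
  node_y e < k (node_x e) /\ k (node_x e') < node_y e'.
Proof.
move=> Kk fall; have [ep e'q _ pp nq] := falling_labels Kk fall.
have [[_ _ /(_ _ Kk)[_ +]] [_ _ /(_ _ Kk)[_ +]]] := (Ae, Ae').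
by rewrite /on_side ep e'q pp (negbTE nq) => -> ->.
Qed.

Lemma falling_base k : maps F k -> label e k <> label e' k -> base F p /\ base F q.
Proof.
move=> Kk fall; have [<- <- _ _ _] := falling_labels Kk fall.
by have [[_ _ /(_ _ Kk)[Bp _]] [_ _ /(_ _ Kk)[Bq _]]] := (Ae, Ae').
Qed.

Lemma shrink_left x y : node_x e < x < node_x e' -> node_y e < y <= node_y e' ->
  exists d, [/\ admissible F d, clear_step F e d, falling_step F p q d e',
    label d = label e & node_x d = x /\ node_y d < y].
Proof.
move=> /andP[ex xe'] /andP[ey ye'].
have [vs vsP] := maps_finite wF (node_x e).
have [v [ev vy v_low]] := right_gap vs ey.
have ve' := lt_le_trans vy ye'; pose d := Node x v (label e).
have v_lt_ke k : maps F k -> label e k <> label e' k -> v < k (node_x e).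
  move=> Kk fall; apply: v_low; first by have [] := vsP _ Kk.
  by have [] := falling_side Kk fall.
exists d; split=> //.
- apply: admissible_between => //=; [by rewrite ex|by rewrite ev|move=> k Kk fall].
  have [Bp _] := falling_base Kk fall; have [-> _ _ pp _] := falling_labels Kk fall.
  by rewrite /on_side pp (lt_trans (v_lt_ke _ Kk fall))// autQ_lt_mono.
- split=> // k Kk; have [ll'|fall] := pselect (label e k = label e' k).
    by apply: (clears_sub (falling_step_clears ee' Kk ll')) => //=; exact: ltW.
  by have [ep _ _ pp _] := falling_labels Kk fall; split; rewrite //= ep pp v_lt_ke.
- apply: falling_step_between => //=; [by rewrite ltW|by rewrite ltW|move=> k Kk fall].
  by right; have [] := falling_labels Kk fall.
Qed.

Lemma split_step x y : node_x e < x < node_x e' -> node_y e < y < node_y e' ->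
  (forall k, maps F k -> label e k <> label e' k -> y < k (node_x e) \/ k (node_x e') < y) ->
  let d := Node x y (fun k => if y < k (node_x e) then label e k else label e' k) in
  [/\ admissible F d, falling_step F p q e d & falling_step F p q d e'].
Proof.
move=> x_itv y_itv far d; have /andP[ex xe'] := x_itv; have /andP[ey ye'] := y_itv.
have keep k : label e k = label e' k -> label d k = label e k.
  by move=> ll'; rewrite /d /= -ll' if_same.
have fall_far k : maps F k -> label e k <> label e' k ->
    y < k (node_x e) /\ label d k = p \/ k (node_x e') < y /\ label d k = q.
  move=> Kk fall; have [ep e'q _ _ _] := falling_labels Kk fall; rewrite /d /= ep e'q.
  have [->|k_e'y] := far _ Kk fall; [by left|right].
  by rewrite ifN// -leNgt ltW// (lt_trans _ k_e'y)// autQ_lt_mono (lt_trans ex).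
split.
- apply: admissible_between => // k Kk fall; have [Bp Bq] := falling_base Kk fall.
  have [_ _ _ pp nq] := falling_labels Kk fall; rewrite /on_side.
  have [[y_ke ->]|[ke'_y ->]] := fall_far _ Kk fall; rewrite ?pp ?(negbTE nq); split=> //.
    by rewrite (lt_trans y_ke)// autQ_lt_mono.
  by rewrite (lt_trans _ ke'_y)// autQ_lt_mono.
- apply: falling_step_between; rewrite ?lexx ?ltW// => k Kk fall.
  have [ep _ pq pp nq] := falling_labels Kk fall.
  have [[y_ke dp]|[_ dq]] := fall_far _ Kk fall; [left|right; split=> //].
  by split; rewrite ep ?dp ?pp.
- apply: falling_step_between; rewrite ?lexx ?ltW// => k Kk fall.
  have [_ e'q pq pp nq] := falling_labels Kk fall.
  have [[_ dp]|[ke'_y dq]] := fall_far _ Kk fall; [right; split=> //|left].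
  by split; rewrite dq ?e'q ?(negbTE nq).
Qed.

End Between.

Lemma shrink_right F p q e e' x y : well_posed F -> admissible F e -> admissible F e' ->
  falling_step F p q e e' -> node_x e < x < node_x e' -> node_y e <= y < node_y e' ->
  exists d, [/\ admissible F d, falling_step F p q e d, clear_step F d e',
    label d = label e' & node_x d = x /\ y < node_y d].
Proof.
move=> wF Ae Ae' ee' /andP[ex xe'] /andP[ey ye'].
have [||d [Ad ed de' ld [dx dy]]] := shrink_left (x := - x) (y := - y)
  (well_posed_rv wF) (admissible_rv Ae') (admissible_rv Ae) (falling_step_rv ee').
- by rewrite !ltrN2 xe'.
- by rewrite ltrN2 lerN2 ye'.
exists (node_rv d); split.
- by rewrite -(pattern_rvK F); exact: admissible_rv.
- by rewrite -(pattern_rvK F) -(node_rvK e) -(opprK p) -(opprK q); exact: falling_step_rv.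
- by rewrite -(pattern_rvK F) -(node_rvK e'); exact: clear_step_rv.
- by apply/funext => k; rewrite /= ld /= opprK opp_autQK.
- by rewrite /= dx opprK ltrNr.
Qed.

Lemma falling_insert_x F p q e e' x : well_posed F -> admissible F e -> admissible F e' ->
  falling_step F p q e e' -> node_x e < x < node_x e' ->
  exists2 l, node_chain F e l e' & exists2 d, d \in l & node_x d = x.
Proof.
move=> wF Ae Ae' ee' x_itv; have [_ yy' _] := ee'.
have [|d [Ad ed de' _ [dx _]]] := shrink_left (y := node_y e') wF Ae Ae' ee' x_itv.
  by rewrite yy' lexx.
exists [:: d; e']; last by exists d; rewrite // inE eqxx.
by apply: chain2 => //; [exact: clear_stepW|left; exists p, q].
Qed.

Lemma falling_insert_y F p q e e' y : well_posed F -> admissible F e -> admissible F e' ->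
  falling_step F p q e e' -> node_y e < y < node_y e' ->
  exists2 l, node_chain F e l e' & exists2 d, d \in l & node_y d = y.
Proof.
move=> wF Ae Ae' ee' /andP[ey ye']; have [xx' _ _] := ee'.
have [ws wsP] := maps_finite wF y.
have [x3 [ex3 x3e' x3_low]] := right_gap ws xx'.
have [x2 [ex2 x23 _]] := right_gap [::] ex3; have [x1 [ex1 x12 _]] := right_gap [::] ex2.
have [||d1 [Ad1 ed1 d1e' _ [d1x d1y]]] := shrink_left (x := x1) (y := y) wF Ae Ae' ee'.
- by rewrite ex1; lra.
- by rewrite ey ltW.
have [||d3 [Ad3 d13 d3e' _ [d3x d3y]]] := shrink_right (x := x3) (y := y) wF Ad1 Ae' d1e'.
- by rewrite d1x x3e' (lt_trans x12).
- by rewrite ye' ltW.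
have [|||Ad2 d12 d23] := split_step (x := x2) (y := y) wF Ad1 Ad3 d13.
- by rewrite d1x d3x x12.
- by rewrite d1y.
- move=> k Kk _; rewrite d1x d3x; have [key|yke] := ltP (k (node_x e)) y.
    right; rewrite -autQ_gtV; apply: x3_low; last by rewrite autQ_gtV.
    by have [] := wsP _ Kk.
  by left; rewrite (le_lt_trans yke)// autQ_lt_mono.
set d2 := Node x2 y _ in Ad2 d12 d23.
exists [:: d1; d2; d3; e']; last by exists d2; rewrite // !inE eqxx orbT.
apply: (chain_cons Ae (clear_stepW ed1)); apply: chain_cons Ad1 _ _; first by left; exists p, q.
by apply: chain2 => //; [left; exists p, q|exact: clear_stepW].
Qed.

Lemma insert_x F e e' x : well_posed F -> admissible F e -> admissible F e' ->
  step F e e' -> node_x e < x < node_x e' ->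
  exists2 l, node_chain F e l e' & exists2 d, d \in l & node_x d = x.
Proof.
move=> wF Ae Ae' [[p [q ee']]|[p [q ee']]]; first exact: falling_insert_x ee'.
move=> x_itv; have [l /chain_untr ch [d dl dx]] := falling_insert_y (well_posed_tr wF)
  (admissible_tr Ae) (admissible_tr Ae') ee' x_itv.
by exists (map node_tr l); rewrite // -dx; exists (node_tr d); rewrite ?map_f.
Qed.

(* The maps falling from [e] to [e'] pass below [(x, y)] and above [(x', y')],
   so that [phi] can be led through these points. *)
Definition gapped F e e' : Prop := exists x y x' y',
  [/\ node_x e < x < x' /\ x' < node_x e', node_y e < y < y' /\ y' < node_y e' &
    forall k, maps F k -> label e k <> label e' k -> k x < y /\ y' < k x'].

Definition gapped_step F p q e e' : Prop := falling_step F p q e e' /\ gapped F e e'.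

Lemma clear_gapped_step F p q e e' : clear_step F e e' -> gapped_step F p q e e'.
Proof.
move=> ee'; split; first exact: clear_falling_step.
have [xx' yy' clear] := ee'.
have [x' [ex' xe' _]] := right_gap [::] xx'; have [x [ex xx'' _]] := right_gap [::] ex'.
have [y' [ey' ye' _]] := right_gap [::] yy'; have [y [ey yy'' _]] := right_gap [::] ey'.
exists x, y, x', y'; rewrite ex ey; split=> // k /clear[ll' _]; by case.
Qed.

(* The maps with value [v] at [x] take finitely many values at each point, hence
   they stay uniformly close to [v] immediately to the right of [x]. *)
Lemma common_value_gap F (x v w T W : rat) : well_posed F -> x < T -> w < v < W ->
  exists t x1 y1 x2 y2, [/\ x < t < x1, x1 < x2 < T, w < y1 < y2, y2 < W &
    forall k, maps F k -> k x = v -> k x1 < y1 /\ y2 < k x2].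
Proof.
move=> wF xT /andP[wv vW].
have [x2 [xx2 x2T _]] := right_gap [::] xT.
have [us usP] := maps_finite wF x2.
have [y2 [vy2 y2W y2_low]] := right_gap us vW.
have [y1 [vy1 y12 _]] := right_gap [::] vy2.
have [ws wsP] := maps_finite wF y1.
have [x1 [xx1 x12 x1_low]] := right_gap ws xx2.
have [t [xt tx1 _]] := right_gap [::] xx1.
exists t, x1, y1, x2, y2; rewrite xt x12 (lt_trans wv vy1); split=> // k Kk kx.
split; last by apply: y2_low; [have [] := usP _ Kk|rewrite -kx autQ_lt_mono].
rewrite -autQ_gtV; apply: x1_low; first by have [] := wsP _ Kk.
by rewrite autQ_gtV kx.
Qed.

(* The maps with the largest value at [node_x e] fall between the two new nodes,
   all the others fall before the first one. *)
Lemma largest_value_gapped F p q v vs e e' : well_posed F ->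
  (forall w, w \in vs -> w < v) -> node_y e < v < node_y e' ->
  admissible F e -> admissible F e' -> falling_step F p q e e' ->
  (forall k, maps F k -> label e k <> label e' k -> k (node_x e) \in v :: vs) ->
  exists d d', [/\ admissible F d /\ admissible F d', falling_step F p q e d,
    gapped_step F p q d d', gapped_step F p q d' e' &
    forall k, maps F k -> label e k <> label d k -> k (node_x e) \in vs].
Proof.
move=> wF vs_lt_v /andP[ev ve'] Ae Ae' ee' values; have [xx' yy' _] := ee'.
have [w [ew wv vs_lt_w]] := left_gap vs ev.
have [ws wsP] := maps_finite wF w.
have [T [eT Te' T_low]] := right_gap ws xx'.
have [||d' [Ad' ed' d'e' ld' [d'x d'y]]] := shrink_right (x := T) (y := v) wF Ae Ae' ee'.
- by rewrite eT.
- by rewrite ltW.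
have value_cases k : maps F k -> label e k <> label e' k ->
    k (node_x e) = v \/ k (node_x e) \in vs /\ k T < w.
  move=> Kk fall; have := values _ Kk fall; rewrite inE => /predU1P[|kvs]; first by left.
  right; split=> //; rewrite -autQ_gtV; apply: T_low; first by have [] := wsP _ Kk.
  by rewrite autQ_gtV; apply: vs_lt_w => //; exact: vs_lt_v.
have [|t [x1 [y1 [x2 [y2 [/andP[et tx1] /andP[x12 x2T] /andP[wy1 y12] y2W gap]]]]]] :=
  common_value_gap (w := w) (v := v) (W := node_y d') wF eT; first by rewrite wv.
have [|||Ad ed dd'] := split_step (x := t) (y := w) wF Ae Ad' ed'.
- by rewrite et d'x (lt_trans tx1) ?(lt_trans x12).
- by rewrite ew (lt_trans wv).
- rewrite ld' d'x => k Kk fall.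
  by have [->|[_ ?]] := value_cases _ Kk fall; [left|right].
set d := Node t w _ in Ad ed dd'.
exists d, d'; split=> //; [|exact: clear_gapped_step|].
  split=> //; exists x1, y1, x2, y2; rewrite d'x tx1 x12 x2T wy1 y12; split=> // k Kk.
  rewrite /d /= ld'; case: ifP => // w_ke fall; apply: gap => //.
  have [//|[_ kTw]] := value_cases _ Kk fall.
  have : k (node_x e) < k T by rewrite autQ_lt_mono.
  by move=> /lt_trans /(_ kTw) /(lt_trans w_ke); rewrite ltxx.
move=> k Kk; rewrite /d /= ld'; case: ifP => // w_ke fall.
have [kv|[]//] := value_cases _ Kk fall.
by rewrite kv wv in w_ke.
Qed.

Lemma gapped_refinement F p q : well_posed F -> forall (vs : seq rat), sorted >%R vs ->
  forall e e', admissible F e -> admissible F e' -> falling_step F p q e e' ->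
  (forall k, maps F k -> label e k <> label e' k -> k (node_x e) \in vs) ->
  exists l, chain (admissible F) (gapped_step F p q) e l e'.
Proof.
move=> wF; elim=> [|v vs IH] vs_sorted e e' Ae Ae' ee' values.
  have clear : clear_step F e e'.
    have [xx' yy' _] := ee'; split=> // k Kk; apply: (falling_step_clears ee' Kk).
    by apply: contrapT => /(values _ Kk).
  by exists [:: e']; apply: chain1 => //; exact: clear_gapped_step.
have [[k [Kk fall kv]]|no_v] := pselect (exists k,
    [/\ maps F k, label e k <> label e' k & k (node_x e) = v]); last first.
  apply: IH => //; first exact: path_sorted vs_sorted.
  move=> k Kk fall; have := values _ Kk fall; rewrite inE => /predU1P[kv|//].
  by case: no_v; exists k.
have vs_lt_v w : w \in vs -> w < v.
  have gt_trans : transitive (>%R : rel rat) by move=> a b c /= ba ca; exact: lt_trans ca ba.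
  by move: w; apply/allP; exact: order_path_min gt_trans vs_sorted.
have v_itv : node_y e < v < node_y e'.
  have [yk ky'] := falling_side Ae Ae' ee' Kk fall; have [xx' _ _] := ee'.
  by rewrite -kv yk (lt_trans _ ky')// autQ_lt_mono.
have [d [d' [[Ad Ad'] ed dd' d'e' fall_d]]] :=
  largest_value_gapped wF vs_lt_v v_itv Ae Ae' ee' values.
have [l ch] := IH (path_sorted vs_sorted) _ _ Ae Ad ed fall_d.
by exists (l ++ [:: d'; e']); apply: (chain_cat ch); exact: chain2.
Qed.

Lemma falling_zigzag F p q r1 r2 : well_posed F ->
  p < r1 < r2 -> r2 < q -> base F r1 -> base F r2 -> ~~ pos F r1 -> pos F r2 ->
  forall e e', admissible F e -> admissible F e' -> gapped_step F p q e e' ->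
  exists2 l, node_chain F e l e' & forall k, maps F k -> label e k <> label e' k ->
    (exists2 d, d \in l & label d k = r1) /\ exists2 d, d \in l & label d k = r2.
Proof.
move=> wF /andP[pr1 r12] r2q Br1 Br2 nr1 pr2 e e' Ae Ae'.
move=> [ee' [x [y [x' [y' [[/andP[ex xx'] x'e'] [/andP[ey yy'] y'e'] gap]]]]]].
pose zigzag r k := if label e k == label e' k then label e k else r.
have keep r k : label e k = label e' k -> zigzag r k = label e k.
  by rewrite /zigzag => ->; rewrite eqxx.
have turn r k : label e k <> label e' k -> zigzag r k = r by rewrite /zigzag => /eqP/negbTE ->.
pose d := Node x y (zigzag r1); pose d' := Node x' y' (zigzag r2).
have Ad : admissible F d.
  apply: (admissible_between wF Ae Ae' ee') => [||k|k Kk fall] /=; [lra|lra|exact: keep|].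
  by rewrite turn// /on_side (negbTE nr1); have [] := gap _ Kk fall.
have Ad' : admissible F d'.
  apply: (admissible_between wF Ae Ae' ee') => [||k|k Kk fall] /=; [lra|lra|exact: keep|].
  by rewrite turn// /on_side pr2; have [] := gap _ Kk fall.
exists [:: d; d'; e'].
  apply: (chain_cons Ae _ (chain2 Ad Ad' Ae' _ _)).
  - left; exists p, r1; apply: (falling_step_between ee') => [||||k|k|k Kk fall] //=;
      [lra|lra|lra|lra|exact: keep|right].
    by have [ep _ _ pp _] := falling_labels ee' Kk fall; split; rewrite //= turn.
  - right; exists r1, r2; split=> // k Kk.
    have [ll'|fall] := pselect (label e (k^-1)%g = label e' (k^-1)%g).
      left; apply/clears_tr/(clears_sub (falling_step_clears ee' Kk ll'));
        by rewrite /= ?keep// ltW.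
    by right; split; rewrite /= ?turn ?negbK.
  - left; exists r2, q; apply: (falling_step_between ee') => [||||k|k|k Kk fall] //=;
      [lra|lra|exact: keep|right].
    by have [_ e'q _ _ nq] := falling_labels ee' Kk fall; split; rewrite //= turn.
move=> k Kk fall; split; [exists d|exists d']; rewrite ?inE ?eqxx ?orbT//; exact: turn.
Qed.

Definition reaches_label F r := reaches (fun k : {k | maps F k} => label ^~ (sval k)) r
  (fun k d => eqv F (label d (sval k)) r).

Lemma alternation_around F p q r : well_posed F -> base F p -> base F q ->
  p < r < q -> pos F p -> ~~ pos F q -> ~ eqv F p r -> ~ eqv F r q ->
  exists r1 r2, [/\ p < r1 < r2, r2 < q, ~~ pos F r1 /\ pos F r2,
    base F r1 /\ base F r2 & r = r1 \/ r = r2].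
Proof.
move=> wF Bp Bq r_itv pp nq npr nrq; have /andP[pr rq] := r_itv.
have base_between := itv_between (base_itv wF); have Br := base_between _ _ _ Bp Bq r_itv.
have [sr|sr] := boolP (pos F r).
  have [|r1 r1_itv sr1] := pos_alternating wF Bp Br pr npr; first by rewrite pp sr.
  have Br1 := base_between _ _ _ Bp Br r1_itv.
  by exists r1, r; rewrite r1_itv rq sr1 pp; split=> //; right.
have [|r2 r2_itv sr2] := pos_alternating wF Br Bq rq nrq.
  by rewrite (negbTE sr) (negbTE nq).
have Br2 := base_between _ _ _ Br Bq r2_itv; move: r2_itv => /andP[rr2 r2q].
by exists r, r2; rewrite pr rr2 r2q sr2 sr; split=> //; left.
Qed.

Lemma falling_reaches_label F p q r1 r2 r e e' : well_posed F ->
  admissible F e -> admissible F e' -> falling_step F p q e e' ->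
  p < r1 < r2 -> r2 < q -> ~~ pos F r1 /\ pos F r2 -> base F r1 /\ base F r2 ->
  r = r1 \/ r = r2 -> exists2 l, node_chain F e l e' & reaches_label F r e l e'.
Proof.
move=> wF Ae Ae' ee' r12 r2q [nr1 pr2] [Br1 Br2] r_r12.
have [vs vsP] := maps_finite wF (node_x e).
have [||l ch] := gapped_refinement wF (vs := rev (sort <=%R (undup vs))) _ Ae Ae' ee'.
- by rewrite rev_sorted; apply: (@sub_sorted _ <%R) => //; rewrite sort_lt_sorted undup_uniq.
- by move=> k Kk _; rewrite mem_rev mem_sort mem_undup; have [] := vsP _ Kk.
have [d d' Ad Ad' dd'|l' [ch' _ meet]] := refine_chain (step2 := step F) (t := r)
    (g := fun k : {k | maps F k} => label ^~ (sval k))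
    (hit := fun k d => eqv F (label d (sval k)) r) _ ch; last by exists l'.
have [m chm zigzag] := falling_zigzag wF r12 r2q Br1 Br2 nr1 pr2 Ad Ad' dd'.
exists m => // -[k Kk] /= dr rd'.
have [|[c1 c1m c1r] [c2 c2m c2r]] := zigzag _ Kk.
  by move=> ll'; move: (lt_le_trans dr rd'); rewrite ll' ltxx.
case: r_r12 => r_eq; [exists c1|exists c2]; rewrite ?inE ?c1m ?c2m ?orbT// ?c1r ?c2r -r_eq;
  exact: equiv_refl (eqv_equiv wF) r.
Qed.

(* If [r] is equivalent to an end label, the end node is met already. *)
Lemma falling_insert_label F p q r e e' : well_posed F ->
  admissible F e -> admissible F e' -> falling_step F p q e e' ->
  exists2 l, node_chain F e l e' & reaches_label F r e l e'.
Proof.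
move=> wF Ae Ae' ee'; have E_equiv := eqv_equiv wF.
have stay : (forall k, maps F k -> label e k < r <= label e' k ->
    eqv F (label e k) r \/ eqv F (label e' k) r) ->
    exists2 l, node_chain F e l e' & reaches_label F r e l e'.
  move=> near; exists [:: e']; first by apply: chain1 => //; left; exists p, q.
  move=> [k Kk] /= er re'; have [|E_er|E_e'r] := near k Kk; first by rewrite er.
    by exists e; rewrite ?inE ?eqxx.
  by exists e'; rewrite ?inE ?eqxx ?orbT.
have falling_over k : maps F k -> label e k < r <= label e' k -> label e k <> label e' k.
  by move=> _ /andP[er re'] ll'; move: (lt_le_trans er re'); rewrite ll' ltxx.
have [[k [Kk over]]|none] := pselect (exists k, maps F k /\ label e k < r <= label e' k);
    last by apply: stay => k Kk over; case: none; exists k.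
have fall := falling_over _ Kk over; have [Bp Bq] := falling_base Ae Ae' ee' Kk fall.
have [ep e'q _ pp nq] := falling_labels ee' Kk fall; rewrite ep e'q in over.
have [Epr|nEpr] := pselect (eqv F p r).
  apply: stay => k' Kk' over'; left.
  by have [-> _ _ _ _] := falling_labels ee' Kk' (falling_over _ Kk' over').
have [Erq|nErq] := pselect (eqv F r q).
  apply: stay => k' Kk' over'; right; apply: (equiv_sym E_equiv).
  by have [_ -> _ _ _] := falling_labels ee' Kk' (falling_over _ Kk' over').
have r_itv : p < r < q.
  move: over => /andP[-> /=]; rewrite le_eqVlt => /predU1P[rq|//].
  by case: nErq; rewrite -rq; exact: equiv_refl E_equiv r.
have [r1 [r2 [r12 r2q sr Br r_eq]]] := alternation_around wF Bp Bq r_itv pp nq nEpr nErq.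
exact: falling_reaches_label ee' r12 r2q sr Br r_eq.
Qed.

Lemma insert_label F r e e' : well_posed F ->
  admissible F e -> admissible F e' -> step F e e' ->
  exists2 l, node_chain F e l e' & reaches_label F r e l e'.
Proof.
move=> wF Ae Ae' [[p [q ee']]|[p [q ee']]]; first exact: falling_insert_label ee'.
have [l /chain_untr ch meet] := falling_insert_label r (well_posed_tr wF)
  (admissible_tr Ae) (admissible_tr Ae') ee'.
exists (map node_tr l) => // -[k Kk] /= er re'.
have KVk : maps (pattern_tr F) (k^-1)%g by rewrite /= invgK.
have [||d dl dr] := meet (exist _ _ KVk); rewrite /= ?invgK//.
exists (node_tr d) => //; rewrite -(node_trK e) -map_cons.
exact: map_f.
Qed.

Lemma refine_x F x e l e' : well_posed F -> node_chain F e l e' ->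
  node_x e < x <= node_x e' -> exists l', [/\ node_chain F e l' e',
    {subset e :: l <= e :: l'} & exists2 d, d \in e :: l' & node_x d = x].
Proof.
move=> wF ch /andP[ex xe'].
have [d d' Ad Ad' dd'|l' [ch' sub meet]] := refine_chain (step2 := step F) (t := x)
    (g := fun=> node_x) (hit := fun (_ : unit) d => node_x d = x) _ ch; last first.
  by exists l'; split=> //; exact: meet tt ex xe'.
have [x_itv|not_between] := boolP (node_x d < x < node_x d').
  have [m chm [c cm cx]] := insert_x wF Ad Ad' dd' x_itv.
  by exists m => // _ _ _; exists c; rewrite // inE cm orbT.
exists [:: d']; first exact: chain1.
move=> _ dx; rewrite le_eqVlt => /predU1P[xd'|xd']; last by rewrite dx xd' in not_between.
by exists d'; rewrite ?inE ?eqxx ?orbT.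
Qed.

Lemma refine_y F y e l e' : well_posed F -> node_chain F e l e' ->
  node_y e < y <= node_y e' -> exists l', [/\ node_chain F e l' e',
    {subset e :: l <= e :: l'} & exists2 d, d \in e :: l' & node_y d = y].
Proof.
move=> wF /chain_tr ch y_itv; have [l' [/chain_untr ch' sub [d dl' dy]]] :=
  refine_x (well_posed_tr wF) ch y_itv.
have tr_mem c m : (c \in e :: map node_tr m) = (node_tr c \in node_tr e :: m).
  by rewrite -(mem_map (inv_inj node_trK) (node_tr e :: m)) /= !node_trK.
exists (map node_tr l'); split=> //.
  by move=> c; rewrite tr_mem => cl; apply: sub; rewrite -map_cons map_f.
by exists (node_tr d); rewrite // tr_mem node_trK.
Qed.

Lemma refine_label F r e l e' : well_posed F -> node_chain F e l e' ->
  exists l', [/\ node_chain F e l' e', {subset e :: l <= e :: l'} & reaches_label F r e l' e'].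
Proof. by move=> wF; apply: refine_chain => d d' Ad Ad'; exact: insert_label. Qed.

(** * Extending a chain beyond its ends *)

Definition uniform (F : sign_pattern) (e : node) (p : rat) : Prop :=
  base F p /\ forall k, maps F k -> label e k = p.

Lemma uniform_tr F e p : uniform F e p -> uniform (pattern_tr F) (node_tr e) p.
Proof. by move=> [Bp ep]; split=> // k Kk; exact: ep. Qed.

Lemma uniform_rv F e p : uniform F e p -> uniform (pattern_rv F) (node_rv e) (- p).
Proof. by move=> [Bp ep]; split=> [|k Kk]; rewrite /= ?opprK// ep. Qed.

Definition uniform_node (x y p : rat) := Node x y (fun=> p).

Lemma admissible_uniform F x y p : base F x -> base F y -> base F p ->
  (forall k, maps F k -> on_side (pos F p) k x y) -> admissible F (uniform_node x y p).
Proof. by move=> Bx By Bp side; split=> // k Kk; split=> //; exact: side. Qed.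

Lemma uniform_step F e e' p q : node_x e < node_x e' -> node_y e < node_y e' ->
  uniform F e p -> uniform F e' q -> p < q -> pos F q = ~~ pos F p -> step F e e'.
Proof.
move=> xx' yy' [_ ep] [_ e'q] pq sq; have [pp|np] := boolP (pos F p); [left|right];
  exists p, q; split=> // k Kk; right; split; rewrite /= ?ep ?e'q ?sq ?pp//.
by rewrite (negbTE np).
Qed.

Lemma far_point F (b : bool) x0 y0 : well_posed F -> base F x0 -> base F y0 ->
  exists x y, [/\ base F x, base F y, x0 < x, y0 < y &
    forall k, maps F k -> on_side b k x y].
Proof.
move=> wF Bx0 By0; have [_ _ _ no_max] := base_itv wF; have nonempty := itv_nonempty (base_itv wF).
case: b.
  have [y By y0y] := no_max _ By0; have [ws wsP] := maps_finite wF y.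
  have [x Bx x_far] := no_max_finite_ub (x0 :: ws) nonempty no_max.
  exists x, y; split=> // [|k Kk]; first by apply: x_far; rewrite // inE eqxx.
  rewrite /on_side -autQ_ltV; apply: x_far; last by apply/(maps_stable wF Kk); rewrite autQVK.
  by rewrite inE; have [_ ->] := wsP _ Kk; rewrite orbT.
have [x Bx x0x] := no_max _ Bx0; have [vs vsP] := maps_finite wF x.
have [y By y_far] := no_max_finite_ub (y0 :: vs) nonempty no_max.
exists x, y; split=> // [|k Kk]; first by apply: y_far; rewrite // inE eqxx.
apply: y_far; last exact/(maps_stable wF Kk).
by rewrite inE; have [->] := vsP _ Kk; rewrite orbT.
Qed.

Lemma right_change F e p q : well_posed F -> admissible F e -> uniform F e p ->
  base F q -> p < q -> pos F q = ~~ pos F p ->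
  exists e', [/\ admissible F e', step F e e' & uniform F e' q].
Proof.
move=> wF [Bx By _] ep Bq pq sq; have [x [y [Bx' By' ex ey side]]] := far_point (pos F q) wF Bx By.
have e'q : uniform F (uniform_node x y q) q by split.
exists (uniform_node x y q); split=> //; first exact: admissible_uniform.
exact: (uniform_step (e' := uniform_node x y q) ex ey ep e'q pq sq).
Qed.

Lemma right_extend_pos F e p x y : well_posed F -> admissible F e -> uniform F e p ->
  pos F p -> base F x -> base F y -> exists l e',
  [/\ node_chain F e l e', uniform F e' p, x < node_x e' & y < node_y e'].
Proof.
move=> wF Ae ep pp Bx0 By0; have [Bex Bey side] := Ae; have [Bp ep_eq] := ep.
have Bmax u v : base F u -> base F v -> base F (Num.max u v) by rewrite maxEle; case: ifP.
have [x1 [y2 [Bx1 By2]]] := far_point true wF (Bmax _ _ Bx0 Bex) (Bmax _ _ By0 Bey).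
rewrite !gt_max => /andP[x01 ex1] /andP[y02 ey2] y2_lt.
have [x2 Bx2 x12] := itv_no_max (base_itv wF) Bx1.
have [vs vsP] := maps_finite wF (node_x e).
have [y1 [ey1 y12 y1_low]] := right_gap vs ey2.
have y1_lt k : maps F k -> y1 < k (node_x e).
  move=> Kk; apply: y1_low; first by have [] := vsP _ Kk.
  by have [_] := side _ Kk; rewrite ep_eq// pp.
have By1 : base F y1 by apply: (itv_between (base_itv wF) Bey By2); rewrite ey1.
exists [:: uniform_node x1 y1 p; uniform_node x2 y2 p], (uniform_node x2 y2 p).
split=> //; last exact: lt_trans x12.
apply: chain2 => //.
- apply: admissible_uniform => // k Kk; rewrite pp /=.
  by rewrite (lt_trans (y1_lt _ Kk))// autQ_lt_mono.
- apply: admissible_uniform => // k Kk; rewrite pp /=.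
  by rewrite (lt_trans (y2_lt _ Kk))// autQ_lt_mono.
- by apply: clear_stepW; split=> // k Kk; split; rewrite ep_eq// pp y1_lt.
- by apply: clear_stepW; split=> // k Kk; split; rewrite //= pp; exact: y2_lt.
Qed.

Lemma right_extend F e p x y : well_posed F -> admissible F e -> uniform F e p ->
  base F x -> base F y -> exists l e',
  [/\ node_chain F e l e', uniform F e' p, x < node_x e' & y < node_y e'].
Proof.
move=> wF Ae ep Bx By; have [pp|np] := boolP (pos F p); first exact: right_extend_pos.
have [l [e' [ch e'p ye' xe']]] := right_extend_pos (well_posed_tr wF)
  (admissible_tr Ae) (uniform_tr ep) np By Bx.
exists (map node_tr l), (node_tr e'); split=> //.
  by apply: chain_untr; rewrite node_trK.
by have := uniform_tr e'p; rewrite pattern_trK.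
Qed.

Lemma right_reach F e p r : well_posed F -> admissible F e -> uniform F e p -> base F r ->
  exists l e' p', [/\ node_chain F e l e', uniform F e' p' & r <= p' \/ eqv F p' r].
Proof.
move=> wF Ae ep Br; have [Bp _] := ep.
have [rp|pr] := leP r p; first by exists [::], e, p; split; [exact: chain_nil| |left].
have [Epr|nEpr] := pselect (eqv F p r).
  by exists [::], e, p; split; [exact: chain_nil| |right].
have [sr|/negPn/eqP sr] := boolP (pos F r != pos F p).
  have [|e1 [Ae1 ee1 e1r]] := right_change wF Ae ep Br pr.
    by move: sr; case: (pos F r); case: (pos F p).
  by exists [:: e1], e1, r; split; [exact: chain1| |left].
have [r' /andP[pr' r'r] sr'] := pos_alternating wF Bp Br pr nEpr (esym sr).
have Br' : base F r' by apply: (itv_between (base_itv wF) Bp Br); rewrite pr'.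
have [e1 [Ae1 ee1 e1r]] := right_change wF Ae ep Br' pr' sr'.
have [|e2 [Ae2 e12 e2r]] := right_change wF Ae1 e1r Br r'r; first by rewrite sr' negbK.
by exists [:: e1; e2], e2, r; split; [exact: chain2| |left].
Qed.

Lemma right_end F e p x y r : well_posed F -> admissible F e -> uniform F e p ->
  base F x -> base F y -> base F r -> exists l e' p',
  [/\ node_chain F e l e', uniform F e' p', r <= p' \/ eqv F p' r,
      x < node_x e' & y < node_y e'].
Proof.
move=> wF Ae ep Bx By Br; have [l1 [e1 [p1 [ch1 e1p r_p1]]]] := right_reach wF Ae ep Br.
have [l2 [e2 [ch2 e2p xe2 ye2]]] :=
  right_extend wF (chain_mem ch1 (chain_last ch1)) e1p Bx By.
by exists (l1 ++ l2), e2, p1; split=> //; exact: chain_cat ch1 ch2.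
Qed.

Lemma left_end F e p x y r : well_posed F -> admissible F e -> uniform F e p ->
  base F x -> base F y -> base F r -> exists l e' p',
  [/\ node_chain F e' l e, uniform F e' p', p' <= r \/ eqv F p' r,
      node_x e' < x & node_y e' < y].
Proof.
move=> wF Ae ep Bx By Br.
have [|||l [e' [p' [/chain_rv[l' ch] /uniform_rv e'p r_p' xe' ye']]]] :=
  right_end (x := - x) (y := - y) (r := - r) (well_posed_rv wF) (admissible_rv Ae) (uniform_rv ep);
  rewrite /= ?opprK//.
rewrite pattern_rvK node_rvK in ch e'p.
exists l', (node_rv e'), (- p'); split=> //.
- by case: r_p'; [left; rewrite lerNl|right; rewrite -(opprK r)].
- by rewrite /= ltrNl.
- by rewrite /= ltrNl.
Qed.

Definition full_chain F (s : seq node) : Prop := exists e l e',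
  [/\ s = e :: l, node_chain F e l e', exists p, uniform F e p & exists p, uniform F e' p].

Definition covers F (t : rat) (s : seq node) : Prop :=
  [/\ exists2 d, d \in s & node_x d = t, exists2 d, d \in s & node_y d = t &
    forall k, maps F k -> exists2 d, d \in s & eqv F (label d k) t].

Lemma full_chain_init F : well_posed F -> exists s, full_chain F s.
Proof.
move=> wF; have [p Bp] := itv_nonempty (base_itv wF).
have [x [y [Bx By _ _ side]]] := far_point (pos F p) wF Bp Bp.
exists [:: uniform_node x y p], (uniform_node x y p), [::], (uniform_node x y p).
by split=> //; [apply: chain_nil; exact: admissible_uniform|exists p|exists p].
Qed.

Lemma full_chain_cover F t s : well_posed F -> full_chain F s -> base F t ->
  exists s', [/\ full_chain F s', {subset s <= s'} & covers F t s'].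
Proof.
move=> wF [e [l [e' [-> ch [p ep] [p' e'p]]]]] Bt.
have Ae : admissible F e by apply: chain_mem ch _; rewrite inE eqxx.
have Ae' : admissible F e' := chain_mem ch (chain_last ch).
have [l0 [e0 [p0 [ch0 e0p t_p0 x0 y0]]]] := left_end wF Ae ep Bt Bt Bt.
have [l1 [e1 [p1 [ch1 e1p t_p1 x1 y1]]]] := right_end wF Ae' e'p Bt Bt Bt.
have ch01 := chain_cat ch0 (chain_cat ch ch1).
have [|lx [chx subx [dx dxl dxt]]] := refine_x wF ch01 (x := t); first by rewrite x0 ltW.
have [|ly [chy suby [dy dyl dyt]]] := refine_y wF chx (y := t); first by rewrite y0 ltW.
have [lt [cht subt labels]] := refine_label t wF chy.
exists (e0 :: lt); split.
- by exists e0, lt, e1; split=> //; [exists p0|exists p1].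
- by move=> d dl; apply/subt/suby/subx/(chain_sub_cat ch0)/sub_cons_cat.
split; first by exists dx; first exact/subt/suby.
  by exists dy; first exact/subt.
move=> k Kk; have [[_ e0E] [_ e1E]] := (e0p, e1p).
have E_refl := equiv_refl (eqv_equiv wF).
have near_e0 : eqv F p0 t -> exists2 d, d \in e0 :: lt & eqv F (label d k) t.
  by exists e0; rewrite ?inE ?eqxx// e0E.
case: t_p0 => [|/near_e0//]; rewrite le_eqVlt => /predU1P[p0t|p0t].
  by apply: near_e0; rewrite p0t; exact: E_refl.
case: t_p1 => [t_p1|E_p1]; last by exists e1; rewrite ?e1E// (chain_last cht).
by have [||d ?] := labels (exist _ k Kk); rewrite /= ?e0E ?e1E//; exists d.
Qed.

(** * Catching on an interval *)

Lemma exhaustion (T : countType) (t0 : T) (S : Type) (good : S -> Prop) (R : S -> S -> Prop)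
    (done : T -> S -> Prop) s0 : good s0 ->
  (forall t s, good s -> exists s', [/\ good s', R s s' & done t s']) ->
  exists s_ : nat -> S, [/\ forall n, good (s_ n), forall n, R (s_ n) (s_ n.+1) &
    forall t, exists n, done t (s_ n)].
Proof.
move=> good0 next.
have /choice[F FP] : forall ts : T * S, exists s', good ts.2 ->
    [/\ good s', R ts.2 s' & done ts.1 s'].
  move=> [t s]; have [gs|ngs] := pselect (good s); last by exists s.
  by have [s'] := next t s gs; exists s'.
pose s_ := fix s_ n := if n is m.+1 then F (odflt t0 (unpickle m), s_ m) else s0.
have good_s n : good (s_ n).
  by elim: n => //= n IH; have [] := FP (odflt t0 (unpickle n), s_ n) IH.
exists s_; split=> // [n|t]; first by have [] := FP (odflt t0 (unpickle n), s_ n) (good_s n).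
exists (pickle t).+1; rewrite /= pickleK.
by have [] := FP (t, s_ (pickle t)) (good_s _).
Qed.

Record complete_nodes F (D : set node) : Prop := {
  complete_chain : forall d d', D d -> D d' ->
    exists e l e', [/\ node_chain F e l e', [set` e :: l] `<=` D, d \in e :: l & d' \in e :: l];
  complete_x : forall x, base F x -> exists2 d, D d & node_x d = x;
  complete_y : forall y, base F y -> exists2 d, D d & node_y d = y;
  complete_label : forall p k, base F p -> maps F k ->
    exists2 d, D d & eqv F (label d k) p }.

Lemma complete_nodes_exist F : well_posed F -> exists D, complete_nodes F D.
Proof.
move=> wF; have [s0 full0] := full_chain_init wF; have [b Bb] := itv_nonempty (base_itv wF).
have [|s_ [full sub cover]] := @exhaustion rat 0 (seq node) (full_chain F)
  (fun s s' => {subset s <= s'}) (fun t s => base F t -> covers F t s) s0 full0.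
  move=> t s fs; have [Bt|nBt] := pselect (base F t); last by exists s; split.
  by have [s' [? ? ?]] := full_chain_cover wF fs Bt; exists s'.
have sub_le n m : (n <= m)%N -> {subset s_ n <= s_ m}.
  by move=> /subnK <-; elim: (m - n)%N => [//|i IH] d /IH; exact: sub.
exists [set d | exists n, d \in s_ n]; split=> [d d' [n dn] [m dm]|x Bx|y By|p k Bp Kk].
- have [e [l [e' [sE ch _ _]]]] := full (maxn n m).
  exists e, l, e'; rewrite -sE; split=> //; first by move=> c cs; exists (maxn n m).
    exact: sub_le (leq_maxl _ _) _ dn.
  exact: sub_le (leq_maxr _ _) _ dm.
- by have [n /(_ Bx)[[d dn ?] _ _]] := cover x; exists d; first exists n.
- by have [n /(_ By)[_ [d dn ?] _]] := cover y; exists d; first exists n.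
- by have [n /(_ Bp)[_ _ /(_ _ Kk)[d dn ?]]] := cover p; exists d; first exists n.
Qed.

Section CompleteNodes.
Variables (F : sign_pattern) (D : set node).
Hypotheses (wF : well_posed F) (DF : complete_nodes F D).

Let E_equiv := eqv_equiv wF.

Lemma complete_admissible d : D d -> admissible F d.
Proof.
by move=> Dd; have [e [l [e' [ch _ dl _]]]] := complete_chain DF Dd Dd; exact: chain_mem ch dl.
Qed.

(* [R k] is a transitive relation that holds along the steps cleared by [k]. *)
Definition precedes (R : autQ -> rat -> rat -> Prop) d d' : Prop :=
  [/\ node_x d < node_x d', node_y d < node_y d' & forall k, maps F k ->
    label d k <= label d' k /\
    (eqv F (label d k) (label d' k) -> R k (node_x d) (node_x d'))].

Lemma complete_trichotomy (R : autQ -> rat -> rat -> Prop) :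
  (forall k x y z, R k x y -> R k y z -> R k x z) ->
  (forall k d d', D d -> D d' -> maps F k -> node_x d < node_x d' ->
    clears F k d d' -> R k (node_x d) (node_x d')) ->
  forall d d', D d -> D d' -> [\/ d = d', precedes R d d' | precedes R d' d].
Proof.
move=> R_trans R_clear d d' Dd Dd'.
have [e [l [e' [ch lD dl d'l]]]] := complete_chain DF Dd Dd'.
apply: (chain_trichotomy _ ch) dl d'l => {d d' Dd Dd'}.
  move=> c a b [ac_x ac_y ac] [cb_x cb_y cb].
  split=> [||k Kk]; [exact: lt_trans cb_x|exact: lt_trans cb_y|].
  have [l_ac R_ac] := ac _ Kk; have [l_cb R_cb] := cb _ Kk.
  split=> [|Eab]; first exact: le_trans l_cb.
  have Eac : eqv F (label a k) (label c k).
    by apply: (equiv_convex E_equiv Eab); rewrite l_ac.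
  apply: R_trans (R_ac Eac) (R_cb _).
  exact: equiv_trans E_equiv _ _ _ (equiv_sym E_equiv Eac) Eab.
move=> d d' /lD Dd /lD Dd' dd'; have [xx' yy'] := step_lt dd'.
split=> // k Kk; have [cl|[ll' sl]] := stepP dd' Kk.
  by split=> [|_]; [have [->] := cl|exact: R_clear].
split=> [|/(eqv_pos wF) sl']; first exact: ltW.
by move: sl; rewrite sl'; case: (pos F _).
Qed.

Definition node_graph x y := exists2 d, D d & node_x d = x /\ node_y d = y.

Lemma complete_increasing : increasing_graph (base F) (base F) node_graph.
Proof.
split=> [x Bx|y By|_ _ [d /complete_admissible[Bx By _] [<- <-]]|]; last first.
- move=> _ _ _ _ [d Dd [<- <-]] [d' Dd' [<- <-]].
  have [||->|[xx' yy' _]|[x'x y'y _]] :=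
    complete_trichotomy (R := fun _ _ _ => True) _ _ Dd Dd' => //.
  + by rewrite !ltxx.
  + by rewrite xx' yy'.
  + by rewrite !ltNge !ltW.
- by [].
- by have [d Dd dy] := complete_y DF By; exists (node_x d), d.
- by have [d Dd dx] := complete_x DF Bx; exists (node_y d), d.
Qed.

Variables (f phi : autQ).
Hypothesis phiD : forall x y, node_graph x y -> phi x = y.
Hypothesis eqv_f : eqv F = same_orbital f.
Hypothesis sg_f : forall p, base F p -> sg_at f p = if pos F p then 1 else -1.

Lemma clears_same_orbital k d d' : D d -> D d' -> node_x d < node_x d' ->
  clears F k d d' -> same_orbital (phi^-1 * k)%g (node_x d) (node_x d').
Proof.
move=> Dd Dd' xx' [_ cl].
have phi_d : phi (node_x d) = node_y d by apply: phiD; exists d.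
have phi_d' : phi (node_x d') = node_y d' by apply: phiD; exists d'.
case: ifP cl => _ cl.
  apply: same_orbital_convex (same_orbital_step _ _) _.
  by rewrite !ltW// autQM autQ_gtV phi_d'.
apply: same_orbital_sym; apply: (same_orbital_trans (same_orbital_step _ _)).
apply: same_orbital_convex (same_orbital_sym (same_orbital_step _ _)) _.
by rewrite !ltW// autQM autQ_ltV phi_d.
Qed.

Definition label_matching (k : autQ) (x p : rat) : Prop :=
  base F p /\ exists2 d, D d & node_x d = x /\ same_orbital f (label d k) p.

Lemma complete_matching k : maps F k ->
  orbital_matching (base F) f (phi^-1 * k)%g (label_matching k).
Proof.
move=> Kk; have DA d := @complete_admissible d.
have tri d d' : D d -> D d' -> [\/ d = d',
    precedes (fun h => same_orbital (phi^-1 * h)%g) d d' |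
    precedes (fun h => same_orbital (phi^-1 * h)%g) d' d].
  apply: complete_trichotomy => [h x y z|h c c' Dc Dc' _]; first exact: same_orbital_trans.
  exact: clears_same_orbital.
split=> [x p [Bp [d /DA[Bx _ _] [<- _]]]|x Bx|p Bp|x p [Bp [d Dd [<- dp]]]|x p y q|x p y q].
- by [].
- have [d Dd dx] := complete_x DF Bx; have [_ _ /(_ _ Kk)[Bl _]] := DA _ Dd.
  by exists (label d k); split=> //; exists d => //; split=> //; exact: same_orbital_refl.
- have [d Dd dE] := complete_label DF Bp Kk.
  by exists (node_x d); split=> //; exists d; rewrite // -eqv_f.
- have phi_d : phi (node_x d) = node_y d by apply: phiD; exists d.
  have [_ _ /(_ _ Kk)[_ side]] := DA _ Dd; rewrite sg_f//.
  rewrite -eqv_f in dp; rewrite (eqv_pos wF dp) /on_side in side.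
  apply/eqP; case: ifP side => _ side; rewrite ?sg_at_eq1 ?sg_at_eqN1 autQM.
    by rewrite autQ_gtV phi_d.
  by rewrite autQ_ltV phi_d.
- move=> [Bp [d Dd [<- dp]]] [Bq [d' Dd' [<- d'q]]] xx'.
  have [Epq|nEpq] := pselect (same_orbital f p q); [by right|left].
  have nE : ~ same_orbital f (label d k) (label d' k).
    move=> ll'; apply: nEpq; apply: same_orbital_trans (same_orbital_sym dp) _.
    exact: same_orbital_trans ll' d'q.
  apply: (convex_equiv_lt (same_orbital_equiv f) dp d'q nE).
  rewrite lt_neqAle; apply/andP; split.
    by apply/eqP => ll'; apply: nE; rewrite ll'; exact: same_orbital_refl.
  case: (tri _ _ Dd Dd') => [->//|[_ _ /(_ _ Kk)[]//]|[x'x _ _]].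
  by move: xx'; rewrite leNgt x'x.
- move=> [Bp [d Dd [<- dp]]] [Bq [d' Dd' [<- d'q]]] xx' pq.
  case: (tri _ _ Dd Dd') => [dd'|[_ _ /(_ _ Kk)[_ same]]|[x'x _ _]].
  + by rewrite dd' ltxx in xx'.
  + apply: same; rewrite eqv_f; apply: (same_orbital_trans dp).
    exact: same_orbital_trans pq (same_orbital_sym d'q).
  + by move: (lt_trans xx' x'x); rewrite ltxx.
Qed.

End CompleteNodes.

(** * Gluing over the components of the complement of the fixed points *)

Definition component (f : autQ) (x y : rat) : Prop :=
  forall z, f z = z -> (z <= x) = (z <= y) /\ (x <= z) = (y <= z).

Section Components.
Variable f : autQ.

Lemma component_equiv : convex_equiv (component f).
Proof.
split=> [x z //|x y xy z /xy[-> ->]//|y x z xy yz w fw|x y z xz /andP[xy yz] w fw].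
  by have [-> ->] := xy _ fw; exact: yz.
have [wxz xzw] := xz _ fw; split; apply/idP/idP.
- by move=> wx; exact: le_trans wx xy.
- by move=> wy; rewrite wxz (le_trans wy).
- by move=> xw; rewrite (le_trans yz)// -xzw.
- exact: le_trans.
Qed.

Lemma component_stable (g : autQ) x : (forall z, f z = z -> g z = z) -> component f x (g x).
Proof. by move=> g_fix z /g_fix gz; rewrite -{2 4}gz !autQ_le_mono. Qed.

Lemma component_fix x y : f x = x -> component f x y -> y = x.
Proof.
by move=> fx /(_ _ fx)[xy yx]; apply/le_anti; rewrite -xy -yx lexx.
Qed.

Lemma component_nfix x y : f x <> x -> component f x y -> f y <> y.
Proof.
move=> nfx xy fy; apply: nfx.
by rewrite (component_fix fy (equiv_sym component_equiv xy)).
Qed.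

Lemma same_orbital_component p q : same_orbital f p q -> component f p q.
Proof. by apply: same_orbital_min => [|x]; [exact: component_equiv|exact: component_stable]. Qed.

Lemma component_open x : f x <> x -> open_interval (component f x).
Proof.
move=> nfx; have comp_trans := equiv_trans component_equiv.
have step y : component f x y -> [/\ component f x (f y), component f x ((f^-1)%g y) & f y <> y].
  move=> xy; split; last exact: component_nfix xy.
    by apply: comp_trans xy _; exact: component_stable.
  by apply: comp_trans xy _; apply: component_stable => z fz; apply/autQ_eqV.
split=> [|y a z xy xz yaz|y /step[fy fVy nfy]|y /step[fy fVy nfy]].
- by exists x; exact: equiv_refl component_equiv x.
- apply: (comp_trans _ _ _ xy); apply: (equiv_convex component_equiv _ yaz).
  exact: comp_trans (equiv_sym component_equiv xy) xz.
- by case: (ltgtP (f y) y) => // lt_y; [exists (f y)|exists ((f^-1)%g y); rewrite ?autQ_ltV].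
- by case: (ltgtP (f y) y) => // lt_y; [exists ((f^-1)%g y); rewrite ?autQ_gtV|exists (f y)].
Qed.

Lemma sg_at_nfix p : f p <> p -> sg_at f p = if p < f p then 1 else -1.
Proof. by case: (sg_atP f p) => // [-> //|lt_p _]; rewrite ltNge ltW. Qed.

Definition component_pattern (K : set autQ) (x : rat) : sign_pattern :=
  SignPattern (component f x) (fun p => p < f p) (same_orbital f) K.

Lemma component_well_posed (K : set autQ) x : sign_alternating f -> finite_valued K ->
  (forall k, K k -> forall p, f p = p -> k p = p) -> f x <> x ->
  well_posed (component_pattern K x).
Proof.
move=> f_alt K_fin K_fix nfx; have comp_trans := equiv_trans component_equiv.
split=> //=.
- exact: component_open.
- move=> k Kk y; have yky := component_stable y (K_fix k Kk).
  split=> xy; apply: (comp_trans _ _ _ xy) => //.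
  exact: equiv_sym component_equiv _ _ yky.
- exact: same_orbital_equiv.
- by move=> p q /same_orbital_sg; rewrite -!sg_at_eq1 => ->.
- move=> p q xp xq pq npq spq.
  have [nfp nfq] := (component_nfix nfx xp, component_nfix nfx xq).
  have [||r [pr rq srp]] := f_alt p q pq npq; rewrite ?sg_at_nfix ?spq//; first by case: ifP.
  exists r; rewrite ?pr//; have xr : component f x r.
    by apply: (itv_between (component_open nfx) xp xq); rewrite pr.
  move: srp; rewrite !sg_at_nfix//; last exact: component_nfix xr.
  by rewrite spq; case: (q < f q); case: (r < f r).
Qed.

Lemma catch_component (K : set autQ) x : sign_alternating f -> finite_valued K ->
  (forall k, K k -> forall p, f p = p -> k p = p) ->
  exists (H : rat -> rat -> Prop) (rho : autQ -> rat -> rat -> Prop),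
    increasing_graph (component f x) (component f x) H /\
    forall phi : autQ, (forall y u, H y u -> phi y = u) ->
      forall k, K k -> orbital_matching (component f x) f (phi^-1 * k)%g (rho k).
Proof.
move=> f_alt K_fin K_fix; have [fx|nfx] := pselect (f x = x); last first.
  have wF := component_well_posed f_alt K_fin K_fix nfx.
  have [D DF] := complete_nodes_exist wF.
  exists (node_graph D), (label_matching (component_pattern K x) D f).
  split; first exact: complete_increasing wF DF.
  move=> phi phiD k Kk; apply: (complete_matching wF DF) => // p xp.
  by apply: sg_at_nfix; exact: component_nfix xp.
have compE y : component f x y <-> y = x.
  by split=> [/component_fix -> //|->]; exact: equiv_refl component_equiv x.
pose single y u := y = x /\ u = x; have xx := (compE x).2 erefl.
exists single, (fun=> single); split.
  split=> [y /compE ->|u /compE ->|y u [-> ->]|y u y' u' [-> ->] [-> ->]]; rewrite ?ltxx//;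
    by exists x.
move=> phi phi_single k Kk; have f'x : (phi^-1 * k)%g x = x.
  by rewrite autQM (K_fix k)//; apply/autQ_eqV; exact: phi_single.
split=> [y p [-> ->]|y /compE ->|p /compE ->|y p [-> ->]|y p z q [-> ->] [-> ->]|
  y p z q [-> ->] [-> ->]]; rewrite ?ltxx//.
- by exists x.
- by exists x.
- by apply: sg_at_inj; rewrite f'x fx.
- by right; exact: same_orbital_refl.
Qed.

End Components.

Lemma glue_matching E f f' rho : convex_equiv E ->
  (forall p q, same_orbital f p q -> E p q) ->
  (forall x, orbital_matching (E x) f f' (rho (repr E x))) ->
  orbital_matching setT f f' (fun x p => rho (repr E x) x p).
Proof.
move=> E_equiv orbE mrho; have reprE := repr_eq E_equiv.
split=> [//|x _|p _|x p|x p y q xp yq xy|x p y q xp yq xy pq].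
- exact: matching_dom (mrho x) _ (equiv_refl E_equiv x).
- have [x xp] := matching_img (mrho p) (equiv_refl E_equiv p).
  by have [px _] := matching_sub (mrho p) xp; exists x; rewrite -(reprE _ _ px).
- exact: matching_sg (mrho x) _ _.
- have [Exy|nExy] := pselect (E x y).
    by rewrite -(reprE _ _ Exy) in yq; exact: matching_le (mrho x) _ _ _ _ xp yq xy.
  left; have [_ Exp] := matching_sub (mrho x) xp; have [_ Eyq] := matching_sub (mrho y) yq.
  apply: (convex_equiv_lt E_equiv Exp Eyq nExy).
  rewrite lt_neqAle xy andbT; apply/eqP => e.
  by apply: nExy; rewrite e; exact: equiv_refl E_equiv y.
- have Exy : E x y.
    have [_ Exp] := matching_sub (mrho x) xp; have [_ Eyq] := matching_sub (mrho y) yq.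
    apply: (equiv_trans E_equiv Exp); apply: (equiv_trans E_equiv (orbE _ _ pq)).
    exact: equiv_sym E_equiv _ _ Eyq.
  by rewrite -(reprE _ _ Exy) in yq; exact: matching_same (mrho x) _ _ _ _ xp yq xy pq.
Qed.

Lemma catch_fixing f (K : set autQ) : sign_alternating f -> finite_valued K ->
  (forall k, K k -> forall p, f p = p -> k p = p) ->
  exists g : autQ, forall k, K k -> conjugacy_class f (g * k)%g.
Proof.
move=> f_alt K_fin K_fix; have E_equiv := component_equiv f.
have /choice[H /choice[rho Hrho]] := fun x => catch_component x f_alt K_fin K_fix.
have gH x := (Hrho x).1.
have [|||phi phiP] := glue_graphs (tau := id) E_equiv E_equiv _ _ _ gH => //.
  by move=> y; exists y; exact: equiv_refl E_equiv y.
exists (phi^-1)%g => k Kk; apply: (conjugacy_criterion f_alt).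
apply: (glue_matching (rho := fun x => rho x k) E_equiv (same_orbital_component (f := f))) => x.
rewrite (equiv_class_eq E_equiv (equiv_repr E_equiv x)).
apply: (Hrho (repr _ x)).2 => // y u yu; apply/phiP.
have [xy _] := graph_sub (gH _) yu.
by rewrite -(repr_eq E_equiv xy) repr_id.
Qed.

Lemma finite_valued_mul (g : autQ) (K : set autQ) : finite_valued K ->
  finite_valued [set k | K (g * k)%g].
Proof.
move=> K_fin q; have [vs vsP] := K_fin q; have [ws wsP] := K_fin (g q).
exists (map (g^-1)%g vs ++ ws) => k Kgk; rewrite !mem_cat; split; apply/orP; [left|right].
  by rewrite -{1}(autQK g (k q)); apply: map_f; have [] := vsP _ Kgk.
by have [_] := wsP _ Kgk; rewrite invgM autQM autQK.
Qed.

Lemma catch f (K : set autQ) (k0 : autQ) : sign_alternating f -> finite_valued K ->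
  (forall k, K k -> forall p, f p = p -> k p = k0 p) ->
  exists g : autQ, forall k, K k -> conjugacy_class f (g * k)%g.
Proof.
move=> f_alt K_fin K_agree.
have [|g gP] := catch_fixing f_alt (finite_valued_mul k0 K_fin).
  move=> k Kk p fp; apply: (@autQ_inj k0); rewrite -autQM; exact: K_agree.
exists (g * k0^-1)%g => k Kk; rewrite -mulgA; apply: gP.
by rewrite /= mulVKg.
Qed.

(** * The orbitals of the statement *)

Lemma convex_hull_orbit (f : autQ) r :
  convex_hull [set zexpg f n r | n in [set: int]] = same_orbital f r.
Proof.
apply/seteqP; split=> [|q [i [j ijq]] A [A_itv orbit_A]]; last first.
  by apply: A_itv ijq; apply: orbit_A; [exists i|exists j].
apply: smallest_sub => [x y rx ry z xzy|_ [n _ <-]]; last exact: same_orbital_zexp.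
apply: (same_orbital_trans rx); apply: (same_orbital_convex _ xzy).
exact: same_orbital_trans (same_orbital_sym rx) ry.
Qed.

Lemma orbitalsE (f : autQ) O : orbitals f O <-> exists r, O = same_orbital f r.
Proof.
split=> [[r _ <-]|[r ->]]; first by exists r; rewrite convex_hull_orbit.
by exists r => //; rewrite convex_hull_orbit.
Qed.

Lemma parity_orbital (f : autQ) r : parity f (same_orbital f r) = sg_at f r.
Proof.
have rr := same_orbital_refl f r.
have not_fixed : f r <> r -> ~ exists p, same_orbital f r = [set p] /\ f p = p.
  by move=> nfr [p [Op fp]]; rewrite Op in rr; rewrite rr in nfr.
rewrite /parity; case: (sg_atP f r) => fr.
- rewrite asboolF; last by apply: not_fixed => e; rewrite e ltxx in fr.
  by rewrite asboolT// => p; exact: same_orbital_gt.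
- rewrite asboolF; last by apply: not_fixed => e; rewrite e ltxx in fr.
  by rewrite asboolF// => /(_ r rr) /(lt_trans fr); rewrite ltxx.
- rewrite asboolT//; exists r; split=> //; apply/seteqP.
  by split=> [q /(same_orbital_fix fr)|q ->].
Qed.

Lemma orbital_ltE (f : autQ) p q : orbital_lt (same_orbital f p) (same_orbital f q) <->
  p < q /\ ~ same_orbital f p q.
Proof.
have orb_equiv := same_orbital_equiv f.
split=> [[ne [p' [q' [pp' qq' p'q']]]]|[pq npq]].
  have npq : ~ same_orbital f p q by move=> pq; exact: ne (equiv_class_eq orb_equiv pq).
  split=> //; apply: (convex_equiv_lt orb_equiv _ _ _ p'q').
  - exact: same_orbital_sym.
  - exact: same_orbital_sym.
  - move=> p'q'_orb; apply: npq; apply: same_orbital_trans pp' _.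
    exact: same_orbital_trans p'q'_orb (same_orbital_sym qq').
split; first by move=> pq_eq; apply: npq; rewrite pq_eq; exact: same_orbital_refl.
by exists p, q; split=> //; exact: same_orbital_refl.
Qed.

Lemma sign_alternating_orbitals (f : autQ) : sign_alternating f <->
  forall O1 O2 : set rat, orbitals f O1 -> orbitals f O2 -> orbital_lt O1 O2 ->
    (parity f O1 = 1 /\ parity f O2 = 1) \/ (parity f O1 = -1 /\ parity f O2 = -1) ->
    exists O3 : set rat, [/\ orbitals f O3, orbital_lt O1 O3, orbital_lt O3 O2 &
      parity f O3 <> parity f O1].
Proof.
split=> [f_alt O1 O2 /orbitalsE[p ->] /orbitalsE[q ->]|orb_alt p q pq npq spq sp0].
  move=> /orbital_ltE[pq npq]; rewrite !parity_orbital => sg_pq.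
  have spq : sg_at f p = sg_at f q by case: sg_pq => -[-> ->].
  have [|r [pr rq srp]] := f_alt _ _ pq npq spq; first by case: sg_pq => -[-> _].
  exists (same_orbital f r); split.
  - by apply/orbitalsE; exists r.
  - by apply/orbital_ltE; split=> // /same_orbital_sg e; rewrite e eqxx in srp.
  - by apply/orbital_ltE; split=> // /same_orbital_sg e; rewrite e spq eqxx in srp.
  - by rewrite !parity_orbital; apply/eqP.
have [||||O3 [/orbitalsE[r ->]]] := orb_alt (same_orbital f p) (same_orbital f q).
- by apply/orbitalsE; exists p.
- by apply/orbitalsE; exists q.
- exact/orbital_ltE.
- by rewrite !parity_orbital -spq; move: sp0; case: (sg_atP f p) => // _ _; [left|right].
rewrite !parity_orbital => /orbital_ltE[pr _] /orbital_ltE[rq _] /eqP srp.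
by exists r.
Qed.

(** * Biters and catchers *)

Lemma near_agree (k : autQ) (ps : seq rat) :
  nbhs k [set g : autQ | forall p, p \in ps -> g p = k p].
Proof.
elim: ps => [|p ps IH]; first by apply: filterS filterT => g _ q.
apply: filterS (filterI (autQ_near k p) IH) => g [gp gps] q.
by rewrite inE => /predU1P[->|/gps].
Qed.

Lemma open_agree (k : autQ) (ps : seq rat) :
  open [set g : autQ | forall p, p \in ps -> g p = k p].
Proof.
rewrite openE => g gk; apply: filterS (near_agree g ps) => h hg p pps.
by rewrite hg// gk.
Qed.

Lemma open_eval (q : rat) (A : set rat) : open [set g : autQ | A (g q)].
Proof. by rewrite openE => g Ag; apply: filterS (autQ_near g q) => h /= ->. Qed.

Lemma open_evalV (q : rat) (A : set rat) : open [set g : autQ | A ((g^-1)%g q)].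
Proof.
have := open_eval q A; apply: (@open_comp _ _ (fun g : autQ => (g^-1)%g)) => g _.
exact: autQ_inv_continuous.
Qed.

Lemma compact_finite_valued (K : set autQ) : compact K -> finite_valued K.
Proof.
rewrite compact_cover => K_cover q.
have [||D1 _ D1P] := K_cover rat setT (fun v => [set g : autQ | g q = v]).
- by move=> v _; exact: (open_eval q [set v]).
- by move=> k _; exists (k q).
have [||D2 _ D2P] := K_cover rat setT (fun v => [set g : autQ | (g^-1)%g q = v]).
- by move=> v _; exact: (open_evalV q [set v]).
- by move=> k _; exists ((k^-1)%g q).
exists (finmap.enum_fset D1 ++ finmap.enum_fset D2) => k Kk; rewrite !mem_cat.
have [v vD /= ->] := D1P _ Kk; have [w wD /= ->] := D2P _ Kk.
by rewrite vD wD orbT.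
Qed.

Lemma finite_valuedS (K K' : set autQ) : K' `<=` K -> finite_valued K -> finite_valued K'.
Proof. by move=> sub K_fin q; have [vs vsP] := K_fin q; exists vs => k /sub/vsP. Qed.

Lemma catch_translate f (K : set autQ) (k0 : autQ) ps : sign_alternating f ->
  fixed_points f = [set` (ps : seq rat)] -> finite_valued K ->
  (forall k, K k -> forall p, p \in ps -> k p = k0 p) ->
  exists g : autQ, translate g 1%g K `<=` conjugacy_class f.
Proof.
move=> f_alt fixE K_fin K_agree; have [|g gP] := catch f_alt K_fin (k0 := k0).
  by move=> k Kk p fp; apply: K_agree => //; have : fixed_points f p := fp; rewrite fixE.
by exists g => _ [k Kk <-]; rewrite mulg1; exact: gP.
Qed.

Lemma compact_biter_class f : finite_set (fixed_points f) -> sign_alternating f ->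
  compact_biter (conjugacy_class f).
Proof.
move=> /finite_seqP[ps fixE] f_alt K [k0 Kk0] K_compact.
pose U := [set g : autQ | forall p, p \in ps -> g p = k0 p].
have [||g gP] := catch_translate (K := U `&` K) (k0 := k0) f_alt fixE.
- by apply: finite_valuedS (compact_finite_valued K_compact); exact: subIsetr.
- by move=> k [].
by exists U, g, 1%g; split=> //; [exact: open_agree|exists k0].
Qed.

Lemma compact_catcher_class f : fixed_points f = set0 -> sign_alternating f ->
  compact_catcher (conjugacy_class f).
Proof.
move=> fix0 f_alt K /compact_finite_valued K_fin.
have fixE : fixed_points f = [set` ([::] : seq rat)] by rewrite fix0 set_nil.
have [//|g gP] := catch_translate (k0 := 1%g) f_alt fixE K_fin.
by exists g, 1%g.
Qed.

(** * Classes that are not Haar null *)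

Lemma translateE (G : topGroupType) (g h : G) B :
  translate g h B = [set x | B (g^-1 * x * h^-1)%g].
Proof.
apply/seteqP; split=> [_ [x Bx <-]|x Bx] /=.
  by rewrite !mulgA mulVg mul1g mulgK.
by exists (g^-1 * x * h^-1)%g => //; rewrite !mulgA mulgV mul1g mulgVK.
Qed.

Lemma borel_preimage (G H : topGroupType) (phi : G -> H) : continuous phi ->
  forall B, borel B -> borel (phi @^-1` B).
Proof.
move=> phi_cont; apply: smallest_sub; last first.
  move=> U oU; apply: sub_sigma_algebra; apply: open_comp => // x _; exact: phi_cont.
split.
- by rewrite preimage_set0; exact: sigma_algebra0.
- by move=> A bA; rewrite setTD preimage_setC -setTD; exact: sigma_algebraCD.
- by move=> F bF; rewrite preimage_bigcup; exact: sigma_algebra_bigcup.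
Qed.

Lemma cvg_mulg (G : topGroupType) (T : Type) (F : set_system T) (u v : T -> G) a b :
  Filter F -> u x @[x --> F] --> a -> v x @[x --> F] --> b ->
  (u x * v x)%g @[x --> F] --> (a * b)%g.
Proof.
move=> FF ua vb; apply: (@cvg_comp _ _ _ (fun x => (u x, v x)) (fun p => (p.1 * p.2)%g)).
  exact: cvg_pair ua vb.
exact: (@mulg_continuous G (a, b)).
Qed.

Lemma borel_translate (G : topGroupType) (g h : G) B : borel B -> borel (translate g h B).
Proof.
rewrite translateE; apply: (borel_preimage (phi := fun x => (g^-1 * x * h^-1)%g)) => x.
by apply: cvg_mulg; [apply: cvg_mulg; [exact: cvg_cst|exact: cvg_id]|exact: cvg_cst].
Qed.

Section Tightness.
Variable R : realType.
Local Notation T := (g_sigma_algebraType (@open autQ)).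
Variable mu : probability T R.

Lemma open_measurable_autQ (U : set autQ) : open U -> measurable (U : set T).
Proof. exact: sub_sigma_algebra. Qed.

Lemma measurable_eval (q : rat) (A : set rat) : measurable ([set k : autQ | A (k q)] : set T).
Proof. exact: open_measurable_autQ (open_eval q A). Qed.

Lemma measurable_evalV (q : rat) (A : set rat) :
  measurable ([set k : autQ | A ((k^-1)%g q)] : set T).
Proof. exact: open_measurable_autQ (open_evalV q A). Qed.

Lemma tight_at (q : rat) (e : R) : 0 < e -> exists vs : seq rat,
  (mu [set k : T | ~ (k q \in vs /\ (k^-1)%g q \in vs)] <= e%:E)%E.
Proof.
move=> e0; pose G n : set T := [set k : autQ | (n <= pickle (k q))%N] `|`
  [set k : autQ | (n <= pickle ((k^-1)%g q))%N].
have mG n : measurable (G n).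
  apply: measurableU; first exact: (measurable_eval q [set v | (n <= pickle v)%N]).
  exact: (measurable_evalV q [set v | (n <= pickle v)%N]).
have G0 : \bigcap_n G n = set0.
  apply/seteqP; split=> // k Gk.
  have /= := Gk (maxn (pickle (k q)) (pickle ((k^-1)%g q))).+1 I.
  by case; rewrite /= ltnNge ?leq_maxl ?leq_maxr.
have cvgG : mu \o G @ \oo --> 0%E.
  rewrite -[0%E](measure0 mu) -G0; apply: nonincreasing_cvg_mu => //.
  - by apply: (le_lt_trans (probability_le1 _ _)) => //; rewrite ltry.
  - by rewrite G0.
  - by move=> n m nm; apply/subsetPset => k [k_m|k_m]; [left|right]; exact: leq_trans k_m.
have [n nP] : exists n, (mu (G n) <= e%:E)%E.
  apply: contrapT => large; have : (e%:E <= lim (mu \o G @ \oo))%E.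
    apply: lime_ge; first by apply/cvg_ex; exists 0%E.
    apply: nearW => n; rewrite leNgt; apply/negP => /ltW small; apply: large.
    by exists n.
  by rewrite (cvg_lim _ cvgG)// lee_fin leNgt e0.
pose vs : seq rat := pmap unpickle (iota 0 n); exists vs.
have mem_vs v : (pickle v < n)%N -> v \in vs.
  by move=> vn; rewrite mem_pmap -(pickleK v) map_f// mem_iota.
apply: le_trans nP; apply: le_measure; rewrite ?inE//.
  apply: measurableC; apply: measurableI; first exact: (measurable_eval q [set` vs]).
  exact: (measurable_evalV q [set` vs]).
move=> k not_in; apply: contrapT => /not_orP[kq kVq]; apply: not_in.
by split; apply: mem_vs; rewrite ltnNge; apply/negP.
Qed.

Lemma finite_valued_positive : exists K : set autQ,
  [/\ measurable (K : set T), finite_valued K & (0 < mu K)%E].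
Proof.
pose e n : R := (1 / 2) / (2 ^ n.+1)%:R.
have e0 n : 0 < e n by rewrite /e divr_gt0// ltr0n expn_gt0.
pose q_ (n : nat) : rat := odflt 0 (unpickle n).
have [vs vsP] := choice (fun n => tight_at (q_ n) (e0 n)).
pose A n : set T := [set k : autQ | ~ (k (q_ n) \in vs n /\ (k^-1)%g (q_ n) \in vs n)].
have mA n : measurable (A n).
  apply: measurableC; apply: measurableI; first exact: (measurable_eval _ [set` vs n]).
  exact: (measurable_evalV _ [set` vs n]).
have mU : measurable (\bigcup_n A n) by exact: bigcup_measurable.
have muU : (mu (\bigcup_n A n) <= (1 / 2)%:E)%E.
  apply: (le_trans (measure_sigma_subadditive mu mA mU (fun _ => id))).
  have half0 : 0 <= (1 / 2 : R) by rewrite divr_ge0.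
  apply: (le_trans _ (epsilon_trick0 xpredT half0)).
  by apply: lee_nneseries => // n _; exact: vsP.
exists (~` \bigcup_n A n); split; first exact: measurableC.
  move=> q; exists (vs (pickle q)) => k nk; apply: contrapT => not_in; apply: nk.
  by exists (pickle q) => //; rewrite /A /= /q_ pickleK.
rewrite probability_setC// sube_gt0; apply: le_lt_trans muU _.
by rewrite lte_fin ltr_pdivrMr// mul1r ltr1n.
Qed.

Lemma constant_on_positive (K : set autQ) (ps : seq rat) : measurable (K : set T) ->
  (0 < mu K)%E -> exists K' : set autQ, [/\ K' `<=` K, measurable (K' : set T),
    (0 < mu K')%E & forall k k', K' k -> K' k' -> forall p, p \in ps -> k p = k' p].
Proof.
move=> mK K0; elim: ps => [|p ps [K' [sK mK' K'0 agree]]]; first by exists K; split.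
pose F n : set T := K' `&` [set k : autQ | k p = odflt 0 (unpickle n)].
have mF n : measurable (F n).
  by apply: measurableI => //; exact: (measurable_eval p [set odflt 0 (unpickle n)]).
have [n Fn] : exists n, (0 < mu (F n))%E.
  apply: contrapT => null; move: K'0; apply/negP; rewrite -leNgt.
  have sub : K' `<=` \bigcup_n F n.
    by move=> k Kk; exists (pickle (k p)); rewrite // /F pickleK.
  apply: (le_trans (measure_sigma_subadditive mu mF mK' sub)).
  rewrite eseries0// => n _ _; apply/eqP; rewrite eq_le measure_ge0 andbT leNgt.
  by apply/negP => pos_n; apply: null; exists n.
exists (F n); split=> //; first by move=> k [/sK].
move=> k k' [Kk kp] [Kk' k'p] r; rewrite inE => /predU1P[->|]; first by rewrite kp k'p.
exact: agree.
Qed.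

End Tightness.

Lemma class_not_haar_null (R : realType) f : finite_set (fixed_points f) ->
  sign_alternating f -> ~ haar_null R (conjugacy_class f).
Proof.
move=> /finite_seqP[ps fixE] f_alt [B [[bB [mu muB]] class_B]].
have [K [mK K_fin K0]] := finite_valued_positive mu.
have [K' [sK mK' K'0 agree]] := constant_on_positive ps mK K0.
have [k0 Kk0] : K' !=set0.
  by apply/set0P/eqP => K'_eq0; move: K'0; rewrite K'_eq0 measure0 ltxx.
have [||g gP] := catch_translate (K := K') (k0 := k0) f_alt fixE.
- exact: finite_valuedS K_fin.
- by move=> k Kk; exact: agree.
have : (mu K' <= mu (translate (g^-1)%g 1%g B))%E.
  apply: le_measure; rewrite ?inE//; first exact: borel_translate.
  move=> k Kk; rewrite translateE /= invgK; apply/class_B/gP.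
  by exists k => //; rewrite invg1.
by rewrite muB leNgt K'0.
Qed.

(** * Marked points *)

Lemma seq_argmax (T : eqType) d (V : orderType d) (f : T -> V) (P : T -> Prop) (s : seq T) :
  (exists2 e, e \in s & P e) ->
  exists a, [/\ a \in s, P a & forall e, e \in s -> P e -> (f e <= f a)%O].
Proof.
elim: s => [[]//|c s IH] [e es Pe].
have [[a as_ Pa]|none] := pselect (exists2 a, a \in s & P a); last first.
  have Pc : P c.
    by move: es; rewrite inE => /predU1P[<-//|es]; case: none; exists e.
  exists c; rewrite inE eqxx; split=> // e'; rewrite inE => /predU1P[->//|e's Pe'].
  by case: none; exists e'.
have [{}a [{}as_ {}Pa amax]] := IH (ex_intro2 _ _ a as_ Pa).
have [[Pc ac]|not_c] := pselect (P c /\ (f a < f c)%O).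
  exists c; rewrite inE eqxx; split=> // e'; rewrite inE => /predU1P[->//|e's Pe'].
  by rewrite (le_trans (amax _ e's Pe'))// ltW.
exists a; rewrite inE as_ orbT; split=> // e'; rewrite inE => /predU1P[->|]; last exact: amax.
by move=> Pc; rewrite leNgt; apply/negP => ac; apply: not_c.
Qed.

(* A point of the graph of the random automorphism, together with the point that
   follows it on the descending staircase from which it was drawn. *)
Definition marked_point := ((rat * rat) * (rat * rat))%type.

Definition pt_x (e : marked_point) : rat := e.1.1.
Definition pt_y (e : marked_point) : rat := e.1.2.
Definition alt_x (e : marked_point) : rat := e.2.1.
Definition alt_y (e : marked_point) : rat := e.2.2.

Definition wide (e : marked_point) : bool := pt_x e < alt_x e.
Definition tall (e : marked_point) : bool := alt_y e < pt_y e.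

Definition descends (e : marked_point) : bool :=
  [&& pt_x e <= alt_x e, alt_y e <= pt_y e & wide e || tall e].

Definition below (e e' : marked_point) : bool := (pt_x e < pt_x e') && (pt_y e < pt_y e').

Definition increasing (s : seq marked_point) : Prop := forall e e', e \in s -> e' \in s ->
  [\/ e = e', below e e' | below e' e].

Definition interlocked (e e' : marked_point) : bool :=
  (alt_y e' < pt_y e) || (pt_x e' < alt_x e).

Definition rightmost (s : seq marked_point) (P : marked_point -> Prop) a : Prop :=
  [/\ a \in s, P a & forall e, e \in s -> P e -> e = a \/ below e a].

Definition leftmost (s : seq marked_point) (P : marked_point -> Prop) b : Prop :=
  [/\ b \in s, P b & forall e, e \in s -> P e -> e = b \/ below b e].

Lemma rightmost_exists s P : increasing s -> (exists2 e, e \in s & P e) ->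
  exists a, rightmost s P a.
Proof.
move=> inc /(@seq_argmax _ _ _ pt_x)[a [as_ Pa amax]].
exists a; split=> // e es Pe; have [->|ea|/andP[ae _]] := inc _ _ es as_; [by left|by right|].
by move: (amax _ es Pe); rewrite leNgt ae.
Qed.

Lemma leftmost_exists s P : increasing s -> (exists2 e, e \in s & P e) ->
  exists b, leftmost s P b.
Proof.
move=> inc /(@seq_argmax _ _ rat^d pt_x)[b [bs Pb bmin]].
exists b; split=> // e es Pe; have [->|/andP[eb _]|be] := inc _ _ es bs; [by left| |by right].
by move: (bmin _ es Pe : pt_x b <= pt_x e); rewrite leNgt eb.
Qed.

Lemma sub_rightmost s (P Q : marked_point -> Prop) a :
  (forall e, e \in s -> P e <-> Q e) -> rightmost s P a -> rightmost s Q a.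
Proof. by move=> PQ [as_ /(PQ _ as_) Qa amax]; split=> // e es /(PQ _ es); exact: amax. Qed.

Lemma sub_leftmost s (P Q : marked_point -> Prop) b :
  (forall e, e \in s -> P e <-> Q e) -> leftmost s P b -> leftmost s Q b.
Proof. by move=> PQ [bs /(PQ _ bs) Qb bmin]; split=> // e es /(PQ _ es); exact: bmin. Qed.

Lemma below_trans e' e e'' : below e e' -> below e' e'' -> below e e''.
Proof.
by move=> /andP[x y] /andP[x' y']; rewrite /below (lt_trans x) ?(lt_trans y).
Qed.

(** * Clusters *)

(* Interlocked points cannot lie on different sides of an invariant cut near
   which the random automorphism stays above a fixed one, unless the latter
   separates a point from its alternative. Hence the points of a cluster lie on
   the same side of such a cut. *)
Record cluster (s : seq marked_point) (z' t z : marked_point) : Prop := {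
  cluster_below : below z' t /\ below t z;
  cluster_gap : forall e, e \in s -> below e z' \/ below z e;
  cluster_locked : interlocked z' t /\ interlocked t z;
  cluster_left : forall a, rightmost s (fun e => below e z') a -> wide a -> interlocked a z';
  cluster_right : forall b, leftmost s (fun e => below z e) b -> tall b -> interlocked z b;
  cluster_wide : wide z;
  cluster_tall : tall z' }.

Lemma increasing_cons c s : increasing s ->
  (forall e, e \in s -> below c e \/ below e c) -> increasing (c :: s).
Proof.
move=> inc cP e e'; rewrite !inE => /predU1P[->|es] /predU1P[->|e's]; first by constructor 1.
- by have [|] := cP _ e's; [constructor 2|constructor 3].
- by have [|] := cP _ es; [constructor 3|constructor 2].
- exact: inc.
Qed.

Lemma cluster_increasing s s' z' t z : increasing s -> cluster s z' t z ->
  s' =i [:: z', t, z & s] -> increasing s'.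
Proof.
move=> inc cl s'E; suff new_inc : increasing [:: z', t, z & s].
  by move=> e e'; rewrite !s'E; exact: new_inc.
have [z't tz] := cluster_below cl; have gap := cluster_gap cl.
apply: increasing_cons; [apply: increasing_cons; [apply: increasing_cons => //|]|].
- move=> e /gap[ez'|]; [right|by left].
  exact: below_trans ez' (below_trans z't tz).
- move=> e; rewrite inE => /predU1P[->|/gap[ez'|ze]]; first by left.
    by right; exact: below_trans ez' z't.
  by left; exact: below_trans tz ze.
- move=> e; rewrite !inE => /or3P[/eqP ->|/eqP ->|/gap[ez'|ze]]; [by left| |by right|].
    by left; exact: below_trans z't tz.
  by left; exact: below_trans z't (below_trans tz ze).
Qed.

Definition mirror (e : marked_point) : marked_point :=
  ((- pt_y e, - pt_x e), (- alt_y e, - alt_x e)).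

Lemma mirrorK : involutive mirror.
Proof. by case=> -[x y] [x' y']; rewrite /mirror /pt_x /pt_y /alt_x /alt_y /= !opprK. Qed.

Lemma wide_mirror e : wide (mirror e) = tall e.
Proof. by rewrite /wide /pt_x /alt_x /= ltrN2. Qed.

Lemma tall_mirror e : tall (mirror e) = wide e.
Proof. by rewrite /tall /pt_y /alt_y /= ltrN2. Qed.

Lemma below_mirror e e' : below (mirror e) (mirror e') = below e' e.
Proof. by rewrite /below {1 2}/pt_x {3 4}/pt_y /= !ltrN2 andbC. Qed.

Lemma interlocked_mirror e e' : interlocked (mirror e) (mirror e') = interlocked e' e.
Proof. by rewrite /interlocked {1}/pt_y {1}/alt_y {2}/pt_x {2}/alt_x /= !ltrN2 orbC. Qed.

Lemma descends_mirror e : descends (mirror e) = descends e.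
Proof.
rewrite /descends wide_mirror tall_mirror orbC.
by rewrite {1}/pt_x {1}/alt_x {2}/pt_y {2}/alt_y /= !lerN2 andbCA.
Qed.

Lemma mem_map_mirror s e : (e \in map mirror s) = (mirror e \in s).
Proof. by rewrite -{1}(mirrorK e) mem_map//; exact: inv_inj mirrorK. Qed.

Lemma increasing_mirror s : increasing s -> increasing (map mirror s).
Proof.
move=> inc e e'; rewrite !mem_map_mirror => es e's.
case: (inc _ _ es e's) => [/(inv_inj mirrorK)|ee'|e'e]; first by constructor 1.
- by constructor 3; rewrite -below_mirror.
- by constructor 2; rewrite -below_mirror.
Qed.

Lemma rightmost_mirror s P a : rightmost (map mirror s) P a -> leftmost s (P \o mirror) (mirror a).
Proof.
move=> [as_ Pa amax]; split; rewrite /= ?mirrorK -?mem_map_mirror//.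
move=> e es Pe; have [||<-|ea] := amax (mirror e); rewrite ?mem_map_mirror ?mirrorK//.
  by left.
by right; rewrite -below_mirror mirrorK.
Qed.

Lemma leftmost_mirror s P b : leftmost (map mirror s) P b -> rightmost s (P \o mirror) (mirror b).
Proof.
move=> [bs Pb bmin]; split; rewrite /= ?mirrorK -?mem_map_mirror//.
move=> e es Pe; have [||<-|be] := bmin (mirror e); rewrite ?mem_map_mirror ?mirrorK//.
  by left.
by right; rewrite -below_mirror mirrorK.
Qed.

Lemma cluster_mirror s z' t z : cluster s z' t z ->
  cluster (map mirror s) (mirror z) (mirror t) (mirror z').
Proof.
move=> [[z't tz] gap [lock' lock] left right wz tz'].
split; rewrite ?below_mirror ?interlocked_mirror ?wide_mirror ?tall_mirror//.
- by move=> e; rewrite mem_map_mirror => /gap[ez'|ze]; [right|left]; rewrite -below_mirror mirrorK.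
- move=> a /rightmost_mirror amin wa; rewrite -interlocked_mirror mirrorK.
  apply: right; last by rewrite tall_mirror.
  by apply: sub_leftmost amin => e _ /=; rewrite below_mirror.
- move=> b /leftmost_mirror bmax tb; rewrite -interlocked_mirror mirrorK.
  apply: left; last by rewrite wide_mirror.
  by apply: sub_rightmost bmax => e _ /=; rewrite below_mirror.
Qed.

Definition down_closed (L : set rat) : Prop := forall r r', r' <= r -> L r -> L r'.

Definition at_cut (L : set rat) (s : seq marked_point) a b : Prop :=
  rightmost s (fun e => L (pt_x e)) a /\ leftmost s (fun e => ~ L (pt_x e)) b.

Definition unlocked (L : set rat) (s : seq marked_point) a b : Prop :=
  forall e e', e \in s -> e' \in s -> L (pt_x e) -> ~ L (pt_x e') ->
    pt_x a <= pt_x e -> pt_x e' <= pt_x b -> ~~ interlocked e e'.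

(* If one of the two neighbours of the cut changes, the other one can never
   change afterwards. *)
Definition progress a b a' b' : Prop := [\/ a' = a /\ b' = b,
  [/\ a' = a, ~~ wide a & tall b'] | [/\ b' = b, ~~ tall b & wide a']].

Lemma progress_refl a b : progress a b a b.
Proof. by constructor 1. Qed.

Lemma progress_trans a1 b1 a b a2 b2 :
  progress a b a1 b1 -> progress a1 b1 a2 b2 -> progress a b a2 b2.
Proof.
move=> [[-> ->]//|[-> na tb1]|[-> nb wa1]].
- case=> [[-> ->]|[-> _ tb2]|[_ nb1 _]]; [by constructor 2|by constructor 2|].
  by rewrite tb1 in nb1.
- case=> [[-> ->]|[_ na1 _]|[-> _ wa2]]; [by constructor 3| |by constructor 3].
  by rewrite wa1 in na1.
Qed.

Lemma down_closed_lt L x y : down_closed L -> L x -> ~ L y -> x < y.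
Proof. by move=> down Lx nLy; rewrite ltNge; apply/negP => /down /(_ Lx). Qed.

Section ClusterAtCut.
Variables (L : set rat) (s s' : seq marked_point) (z' t z a b : marked_point).
Hypotheses (L_down : down_closed L) (cl : cluster s z' t z).
Hypotheses (s'E : s' =i [:: z', t, z & s]) (ab : at_cut L s a b).

Let below_down e e' : below e e' -> L (pt_x e') -> L (pt_x e).
Proof. by move=> /andP[/ltW ee' _]; exact: L_down. Qed.

Let up e : e \in s -> e \in s'.
Proof. by rewrite s'E !inE => ->; rewrite !orbT. Qed.

Let newP (P : marked_point -> Prop) : P z' -> P t -> P z ->
  (forall e, e \in s -> P e) -> forall e, e \in s' -> P e.
Proof. by move=> ? ? ? ? e; rewrite s'E !inE => /or4P[/eqP->|/eqP->|/eqP->|]; auto. Qed.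

Lemma cluster_left_of_cut : below z a -> at_cut L s' a b.
Proof.
have [[as_ La amax] [bs nLb bmin]] := ab; have [z't tz] := cluster_below cl.
move=> za; have ta := below_trans tz za; have z'a := below_trans z't ta.
split; split; rewrite ?up//; apply: newP; do ?[by right|exact: amax|exact: bmin];
  by case; apply: below_down La.
Qed.

Lemma cluster_right_of_cut : below b z' -> at_cut L s' a b.
Proof.
have [[as_ La amax] [bs nLb bmin]] := ab; have [z't tz] := cluster_below cl.
move=> bz'; have bt := below_trans bz' z't; have bz := below_trans bt tz.
split; split; rewrite ?up//; apply: newP; do ?[by right|exact: amax|exact: bmin];
  by move=> Lc; case: nLb; exact: (below_down _ Lc).
Qed.

Lemma cluster_across_cut : below a z' -> below z b -> unlocked L s' a b ->
  exists a' b', [/\ at_cut L s' a' b', pt_x a <= pt_x a', pt_x b' <= pt_x b &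
    progress a b a' b'].
Proof.
move=> az' zb free; have [[as_ La amax] [bs nLb bmin]] := ab.
have [z't tz] := cluster_below cl; have [lock_z't lock_tz] := cluster_locked cl.
have [z's ts zs] : [/\ z' \in s', t \in s' & z \in s'] by rewrite !s'E !inE !eqxx !orbT.
have /andP[xaz' _] := az'; have /andP[xz't _] := z't.
have /andP[xtz _] := tz; have /andP[xzb _] := zb.
have a_last : rightmost s (fun e => below e z') a.
  split=> // e es ez'; apply: amax => //; apply: contrapT => nLe.
  have /andP[xez' _] := ez'.
  by have [e_b|/andP[xbe _]] := bmin _ es nLe; [rewrite e_b in xez'|]; lra.
have b_first : leftmost s (fun e => below z e) b.
  split=> // e es ze; apply: bmin => // Le.
  have /andP[xze _] := ze.
  by have [e_a|/andP[xea _]] := amax _ es Le; [rewrite e_a in xze|]; lra.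
have [Lz|nLz] := pselect (L (pt_x z)).
  have Lt := below_down tz Lz; have Lz' := below_down z't Lt.
  exists z, b; split; [split; split=> //; do ?exact: up|lra|exact: lexx|].
  - apply: (newP (P := fun e => L (pt_x e) -> e = z \/ below e z));
      [by right; exact: below_trans tz|by right|by left|].
    move=> e es /(amax _ es)[->|ea]; right; last apply: (below_trans ea);
      exact: below_trans az' (below_trans z't tz).
  - by apply: (newP (P := fun e => ~ L (pt_x e) -> e = b \/ below b e)) => //; exact: bmin.
  constructor 3; split=> //; last exact: cluster_wide cl.
  apply/negP => /(cluster_right cl b_first); apply/negP.
  by apply: free => //; [exact: up|lra].
have nLt : ~ L (pt_x t).
  by move=> Lt; apply: (negP (free _ _ ts zs Lt nLz _ _)) lock_tz; lra.
have nLz' : ~ L (pt_x z').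
  by move=> Lz'; apply: (negP (free _ _ z's ts Lz' nLt _ _)) lock_z't; lra.
exists a, z'; split; [split; split=> //; do ?exact: up|exact: lexx|lra|].
- by apply: (newP (P := fun e => L (pt_x e) -> e = a \/ below e a)).
- apply: (newP (P := fun e => ~ L (pt_x e) -> e = z' \/ below z' e));
    [by left|by right|right; exact: below_trans tz|].
  move=> e es /(bmin _ es)[->|be]; right; [|apply: below_trans be];
    exact: below_trans z't (below_trans tz zb).
constructor 2; split=> //; last exact: cluster_tall cl.
apply/negP => /(cluster_left cl a_last); apply/negP.
by apply: free => //; [exact: up|lra].
Qed.

Lemma cluster_progress : unlocked L s' a b ->
  exists a' b', [/\ at_cut L s' a' b', pt_x a <= pt_x a', pt_x b' <= pt_x b &
    progress a b a' b'].
Proof.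
move=> free; have [[as_ _ _] [bs _ _]] := ab.
have stay : at_cut L s' a b -> exists a' b', [/\ at_cut L s' a' b', pt_x a <= pt_x a',
    pt_x b' <= pt_x b & progress a b a' b'].
  by exists a, b; split=> //; exact: progress_refl.
have [az'|/cluster_left_of_cut/stay//] := cluster_gap cl as_.
have [/cluster_right_of_cut/stay//|zb] := cluster_gap cl bs.
exact: cluster_across_cut.
Qed.

End ClusterAtCut.

(** * Drawing clusters from staircases *)

Lemma separating_interval (A B : set rat) : finite_set A -> finite_set B ->
  (forall a b, A a -> B b -> a < b) ->
  exists c d, [/\ c < d, forall a, A a -> a < c & forall b, B b -> d < b].
Proof.
move=> /finite_seqP[lo ->] /finite_seqP[hi ->] lo_hi.
have [c [lo_c c_hi]] := finite_separation lo_hi.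
have [|d [cd d_hi]] := @finite_separation [:: c] hi.
  by move=> _ b /[1!inE] /eqP ->; exact: c_hi.
by exists c, d; split=> //; apply: cd; rewrite inE.
Qed.

Lemma increasing_between (A B : set rat) : finite_set A -> finite_set B ->
  (forall a b, A a -> B b -> a < b) ->
  exists xi : nat -> rat, forall l, [/\ xi l < xi l.+1,
    forall a, A a -> a < xi l & forall b, B b -> xi l < b].
Proof.
move=> finA finB AB; have [c [d [cd Ac dB]]] := separating_interval finA finB AB.
have small l : 0 < (d - c) / l.+1%:R <= d - c.
  by rewrite divr_gt0 ?subr_gt0//= ler_piMr ?invf_le1 ?ler1n// subr_ge0 ltW.
exists (fun l => d - (d - c) / l.+1%:R) => l /=; have /andP[pos le] := small l; split.
- by rewrite ltrD2l ltrN2 ltr_pM2l ?subr_gt0// ltf_pV2 ?posrE ?ltr0n// ltr_nat.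
- by move=> a /Ac ac; rewrite (lt_le_trans ac)// lerBrDr -lerBrDl.
- by move=> b /dB db; rewrite (lt_trans _ db)// ltrBlDr ltrDl.
Qed.

Lemma decreasing_between (A B : set rat) : finite_set A -> finite_set B ->
  (forall a b, A a -> B b -> a < b) ->
  exists eta : nat -> rat, forall l, [/\ eta l.+1 < eta l,
    forall a, A a -> a < eta l & forall b, B b -> eta l < b].
Proof.
move=> finA finB AB.
have [||_ _ [b Bb <-] [a Aa <-]|xi xiP] := @increasing_between (-%R @` B) (-%R @` A).
- exact: finite_image.
- exact: finite_image.
- by rewrite ltrN2; exact: AB.
exists (fun l => - xi l) => l; have [xi_incr xi_lo xi_hi] := xiP l; split.
- by rewrite ltrN2.
- by move=> a Aa; rewrite ltrNr; apply: xi_hi; exists a.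
- by move=> b Bb; rewrite ltrNl; apply: xi_lo; exists b.
Qed.

Lemma finite_values (T : choiceType) (s : seq T) (P : set T) (f : T -> rat) :
  finite_set (f @` ([set` s] `&` P)).
Proof. exact/finite_image/finite_setIl/finite_seq. Qed.

Definition staircase := nat -> rat * rat.

Definition marked (g : staircase) (l : nat) : marked_point := (g l, g l.+1).

Definition descending (g : staircase) : Prop := forall l, descends (marked g l).

Record upper_point (s : seq marked_point) v (z : marked_point) : Prop := {
  upper_right : v < pt_x z;
  upper_wide : wide z;
  upper_tall : tall z;
  upper_above : forall e, e \in s -> pt_x e < v -> pt_y e < alt_y z;
  upper_below : forall e, e \in s -> v < pt_x e -> below z e;
  upper_locked : forall b, leftmost s (fun e => v < pt_x e) b -> tall b -> alt_y b < pt_y z }.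

Record middle_point (s : seq marked_point) v (z t : marked_point) : Prop := {
  middle_x : pt_x t = v;
  middle_alt_x : alt_x t = v;
  middle_tall : tall t;
  middle_locked : alt_y z < pt_y t;
  middle_below : pt_y t < pt_y z;
  middle_above : forall e, e \in s -> pt_x e < v -> pt_y e < alt_y t }.

Record lower_point (s : seq marked_point) v (t z' : marked_point) : Prop := {
  lower_left : pt_x z' < v;
  lower_wide : wide z';
  lower_tall : tall z';
  lower_locked : alt_y t < pt_y z';
  lower_below : pt_y z' < pt_y t;
  lower_above : forall e, e \in s -> pt_x e < v -> below e z';
  lower_left_locked : forall a, rightmost s (fun e => pt_x e < v) a -> wide a ->
    pt_x z' < alt_x a }.

Lemma wide_tall_descends e : wide e -> tall e -> descends e.
Proof. by move=> we te; rewrite /descends we !ltW. Qed.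

Lemma upper_point_descends s v z : upper_point s v z -> descends z.
Proof. by case=> *; exact: wide_tall_descends. Qed.

Lemma middle_point_descends s v z t : middle_point s v z t -> descends t.
Proof. by case=> xt ax tt *; rewrite /descends xt ax lexx tt orbT ltW. Qed.

Lemma lower_point_descends s v t z' : lower_point s v t z' -> descends z'.
Proof. by case=> *; exact: wide_tall_descends. Qed.

Lemma upper_point_exists s v : increasing s ->
  exists g, forall l, upper_point s v (marked g l).
Proof.
move=> inc; pose after := [set e | v < pt_x e]; pose before := [set e | pt_x e < v].
pose first := [set b | leftmost s (fun e => v < pt_x e) b /\ tall b].
have [|||xi xiP] := @increasing_between [set v] (pt_x @` ([set` s] `&` after)).
- exact: finite_set1.
- exact: finite_values.
- by move=> _ _ -> [e [_ ve] <-].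
have [|||eta etaP] := @decreasing_between
  (pt_y @` ([set` s] `&` before) `|` alt_y @` ([set` s] `&` first))
  (pt_y @` ([set` s] `&` after)).
- by rewrite finite_setU; split; exact: finite_values.
- exact: finite_values.
- move=> _ _ [[e [es ev] <-]|[b [_ [[_ _ bmin] tb]] <-]] [e' [e's ve'] <-].
    by have [ee'|/andP[]//|/andP[e'e _]] := inc _ _ es e's;
      [rewrite ee' in ev|]; move: ev ve'; rewrite /before /after /=; lra.
  by apply: (lt_le_trans tb); have [->|/andP[_ /ltW]] := bmin _ e's ve'.
exists (fun l => (xi l, eta l)) => l.
have [xi_incr xi_v xi_after] := xiP l; have [eta_decr eta_lo eta_after] := etaP l.
have [_ eta_lo' _] := etaP l.+1.
split=> //; first exact: xi_v.
- by move=> e es ev; apply: eta_lo'; left; exists e.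
- by move=> e es ve; apply/andP; split; [apply: xi_after|apply: eta_after]; exists e.
- by move=> b bmin tb; apply: eta_lo; right; exists b => //; split=> //; case: bmin.
Qed.

Lemma middle_point_exists s v z : upper_point s v z ->
  exists g, forall l, middle_point s v z (marked g l).
Proof.
move=> zP; pose before := [set e | pt_x e < v].
have [|||eta etaP] := @decreasing_between
  (alt_y z |` pt_y @` ([set` s] `&` before)) [set pt_y z].
- by rewrite finite_setU; split; [exact: finite_set1|exact: finite_values].
- exact: finite_set1.
- move=> _ _ [->|[e [es ev] <-]] ->; first exact: upper_tall zP.
  exact: lt_trans (upper_above zP es ev) (upper_tall zP).
exists (fun l => (v, eta l)) => l.
have [eta_decr eta_lo eta_hi] := etaP l; have [_ eta_lo' _] := etaP l.+1.
split=> //; [by apply: eta_lo; left|exact: eta_hi|].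
by move=> e es ev; apply: eta_lo'; right; exists e.
Qed.

Lemma lower_point_exists s v z t : increasing s -> middle_point s v z t ->
  exists g, forall l, lower_point s v t (marked g l).
Proof.
move=> inc tP; pose before := [set e | pt_x e < v].
pose last := [set a | rightmost s (fun e => pt_x e < v) a /\ wide a].
have [|||xi xiP] := @increasing_between
  (pt_x @` ([set` s] `&` before)) (v |` alt_x @` ([set` s] `&` last)).
- exact: finite_values.
- by rewrite finite_setU; split; [exact: finite_set1|exact: finite_values].
- move=> _ _ [e [es ev] <-] [->//|[a [_ [[_ _ amax] wa]] <-]].
  by apply: le_lt_trans wa; have [->|/andP[/ltW]] := amax _ es ev.
have [|||eta etaP] := @decreasing_between
  (alt_y t |` pt_y @` ([set` s] `&` before)) [set pt_y t].
- by rewrite finite_setU; split; [exact: finite_set1|exact: finite_values].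
- exact: finite_set1.
- move=> _ _ [->|[e [es ev] <-]] ->; first exact: middle_tall tP.
  exact: lt_trans (middle_above tP es ev) (middle_tall tP).
exists (fun l => (xi l, eta l)) => l.
have [xi_incr xi_before xi_hi] := xiP l; have [eta_decr eta_lo eta_hi] := etaP l.
split=> //; [by apply: xi_hi; left|by apply: eta_lo; left|exact: eta_hi| |].
- by move=> e es ev; apply/andP; split; [apply: xi_before|apply: eta_lo; right]; exists e.
- by move=> a amax wa; apply: xi_hi; right; exists a => //; split=> //; case: amax.
Qed.

Lemma points_cluster s v z t z' : v \notin map pt_x s ->
  upper_point s v z -> middle_point s v z t -> lower_point s v t z' -> cluster s z' t z.
Proof.
move=> fresh zP tP z'P.
have side e : e \in s -> pt_x e < v \/ v < pt_x e.
  move=> es; have [|//|ev] := ltgtP (pt_x e) v; [by left|by right|].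
  by case/mapP: fresh; exists e.
have before e : e \in s -> below e z' <-> pt_x e < v.
  move=> es; split=> [/andP[ez' _]|]; last exact: lower_above z'P _ es.
  exact: lt_trans ez' (lower_left z'P).
have after e : e \in s -> below z e <-> v < pt_x e.
  move=> es; split=> [/andP[ze _]|]; last exact: upper_below zP _ es.
  exact: lt_trans (upper_right zP) ze.
split.
- rewrite /below (middle_x tP) (lower_left z'P) (lower_below z'P).
  by rewrite (upper_right zP) (middle_below tP).
- by move=> e es; have [/(before _ es)|/(after _ es)] := side _ es; [left|right].
- by rewrite /interlocked (lower_locked z'P) (middle_locked tP).
- move=> a /(sub_rightmost before) amax wa.
  by rewrite /interlocked (lower_left_locked z'P amax wa) orbT.
- move=> b /(sub_leftmost after) bmin tb.
  by rewrite /interlocked (upper_locked zP bmin tb).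
- exact: upper_wide zP.
- exact: lower_tall z'P.
Qed.

(** * Runs *)

(* Rounds alternate between putting a rational into the domain and, after the
   reflection [(x, y) -> (- y, - x)], putting one into the range. *)
Definition orient (s : seq marked_point) : marked_point -> marked_point :=
  if odd (size s) then mirror else id.

Definition next_abscissa (s : seq marked_point) (v : rat) : Prop :=
  v \notin map pt_x s /\ forall x, unpickle (size s %/ 6) = Some x -> x \in v :: map pt_x s.

Definition round (s : seq marked_point) v z t z' : Prop :=
  let o := orient s in [/\ next_abscissa (map o s) v, upper_point (map o s) v (o z),
    middle_point (map o s) v (o z) (o t) & lower_point (map o s) v (o t) (o z')].

Inductive rounds : seq marked_point -> Prop :=
| no_round : rounds [::]
| next_round s v z t z' : rounds s -> round s v z t z' -> rounds [:: z', t, z & s].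

Inductive legal : seq marked_point -> Prop :=
| legal_rounds s : rounds s -> legal s
| legal_upper s v z : rounds s -> next_abscissa (map (orient s) s) v ->
    upper_point (map (orient s) s) v (orient s z) -> legal (z :: s)
| legal_middle s v z t : rounds s -> next_abscissa (map (orient s) s) v ->
    upper_point (map (orient s) s) v (orient s z) ->
    middle_point (map (orient s) s) v (orient s z) (orient s t) ->
    legal [:: t, z & s].

Lemma descends_orient s e : descends (orient s e) = descends e.
Proof. by rewrite /orient; case: odd => //; exact: descends_mirror. Qed.

Lemma increasing_orient s : increasing s -> increasing (map (orient s) s).
Proof. by rewrite /orient; case: odd => [/increasing_mirror//|]; rewrite map_id. Qed.

Lemma next_abscissa_exists s : exists v, next_abscissa s v.
Proof.
have [c [cP _]] : exists c, (forall a, a \in map pt_x s -> a < c) /\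
    (forall b, b \in [::] -> c < b) by exact: finite_separation.
have c_new : c \notin map pt_x s by apply/negP => /cP; rewrite ltxx.
rewrite /next_abscissa; case: (unpickle _) => [x|]; last by exists c.
have [xs|xs] := boolP (x \in map pt_x s); last first.
  by exists x; split=> // _ [<-]; rewrite inE eqxx.
by exists c; split=> // _ [<-]; rewrite inE xs orbT.
Qed.

Lemma orient_staircase s (P : marked_point -> Prop) :
  (exists g, forall l, P (marked g l)) -> exists g, forall l, P (orient s (marked g l)).
Proof.
rewrite /orient; case: odd => -[g gP]; last by exists g.
exists (fun l => (- (g l).2, - (g l).1)) => l.
suff -> : mirror (marked (fun l => (- (g l).2, - (g l).1)) l) = marked g l by [].
by rewrite /mirror /marked /pt_x /pt_y /alt_x /alt_y /= !opprK -!surjective_pairing.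
Qed.

(* Reflection reverses the order in which the three points are drawn. *)
Definition cluster_extension (s s' : seq marked_point) : Prop :=
  exists z' t z, cluster s z' t z /\ s' =i [:: z', t, z & s].

Lemma round_cluster s v z t z' : round s v z t z' ->
  cluster_extension s [:: z', t, z & s].
Proof.
move=> [[fresh _] zP tP z'P]; have := points_cluster fresh zP tP z'P.
rewrite /orient; case: odd; last by rewrite map_id; exists z', t, z.
move=> /cluster_mirror; rewrite mapK ?mirrorK => [cl|]; last exact: mirrorK.
exists z, t, z'; split=> // e; rewrite !inE.
by case: (e == z); case: (e == t); case: (e == z').
Qed.

Lemma rounds_increasing s : rounds s -> increasing s.
Proof.
elim=> [//|{}s v z t z' _ inc /round_cluster[c' [c'' [c [cl]]]]].
exact: cluster_increasing inc cl.
Qed.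

Lemma dvdn_size_rounds s : rounds s -> (3 %| size s)%N.
Proof. by elim=> //= {}s *; rewrite -[(size s).+3]addn3 dvdn_addl. Qed.

Lemma legal_dvdn_size_rounds s : legal s -> (3 %| size s)%N -> rounds s.
Proof.
case=> [//|{}s v z /dvdn_size_rounds s3 _ _|{}s v z t /dvdn_size_rounds s3 _ _ _] /=.
- by rewrite -[(size s).+1]addn1 dvdn_addr.
- by rewrite -[(size s).+2]addn2 dvdn_addr.
Qed.

Lemma legal_extend s : legal s -> exists g, forall l, legal (marked g l :: s).
Proof.
case=> {}s.
- move=> rs; have [v new] := next_abscissa_exists (map (orient s) s).
  have /(orient_staircase s)[g gP] :=
    upper_point_exists v (increasing_orient (rounds_increasing rs)).
  by exists g => l; exact: legal_upper rs new (gP l).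
- move=> v z rs new zP; have /(orient_staircase s)[g gP] := middle_point_exists zP.
  by exists g => l; exact: legal_middle rs new zP (gP l).
- move=> v z t rs new zP tP; have /(orient_staircase s)[g gP] :=
    lower_point_exists (increasing_orient (rounds_increasing rs)) tP.
  by exists g => l; exact: legal_rounds (next_round rs (And4 new zP tP (gP l))).
Qed.

Lemma legal_descends e s : legal (e :: s) -> descends e.
Proof.
have desc r c : descends (orient r c) -> descends c by rewrite descends_orient.
move E : (e :: s) => s' s'_legal; case: s'_legal E => [{}s' rs'|r v z _ _ zP|r v z t _ _ _ tP].
- case: rs' => [//|r v z t z' _ [_ _ _ z'P]] [-> _].
  exact/desc/(lower_point_descends z'P).
- by move=> [-> _]; exact/desc/(upper_point_descends zP).
- by move=> [-> _]; exact/desc/(middle_point_descends tP).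
Qed.

Definition pinched (psi : autQ) (e : marked_point) : bool :=
  (psi (pt_x e) <= pt_y e) && (alt_y e < psi (alt_x e)).

Lemma pinched_unique psi g l l' : descending g ->
  pinched psi (marked g l) -> pinched psi (marked g l') -> l = l'.
Proof.
move=> desc; wlog suff : l l' / (l < l')%N -> pinched psi (marked g l) ->
    ~~ pinched psi (marked g l').
  move=> excl p p'; have [/excl/(_ p)|/excl/(_ p')|//] := ltngtP l l'.
    by rewrite p'.
  by rewrite p.
have mono n m : (n <= m)%N -> (g n).1 <= (g m).1 /\ (g m).2 <= (g n).2.
  move=> /subnK <-; elim: (m - n)%N => [|j [x y]]; first by rewrite !lexx.
  have /and3P[xj yj _] := desc (j + n)%N.
  by split; [exact: le_trans xj|exact: le_trans yj _].
move=> ll' /andP[_ pl]; rewrite negb_and -ltNge; apply/orP; left.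
have [x y] := mono _ _ ll'; apply: (le_lt_trans y); apply: (lt_le_trans pl).
by rewrite autQ_le_mono.
Qed.

Record run (S : nat -> seq marked_point) : Prop := {
  run_start : S 0 = [::];
  run_step : forall i, exists e, S i.+1 = e :: S i;
  run_legal : forall i, legal (S i) }.

Section Run.
Variable S : nat -> seq marked_point.
Hypothesis S_run : run S.

Lemma size_run i : size (S i) = i.
Proof.
elim: i => [|i IH]; first by rewrite (run_start S_run).
by have [e ->] := run_step S_run i; rewrite /= IH.
Qed.

Lemma run_sub i j : (i <= j)%N -> {subset S i <= S j}.
Proof.
move=> /subnK <-; elim: (j - i)%N => [|n IH] // e /IH e_in.
by have [d] := run_step S_run (n + i); rewrite addSn => ->; rewrite inE e_in orbT.
Qed.

Lemma run_rounds m : rounds (S (3 * m)).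
Proof. by apply: (legal_dvdn_size_rounds (run_legal S_run _)); rewrite size_run dvdn_mulr. Qed.

Lemma run_round m : exists v z t z', S (3 * m.+1) = [:: z', t, z & S (3 * m)] /\
  round (S (3 * m)) v z t z'.
Proof.
have three : (3 * m.+1 = (3 * m).+3)%N by rewrite mulnS.
have [c Sc] := run_step S_run (3 * m); have [c' Sc'] := run_step S_run (3 * m).+1.
have [c'' Sc''] := run_step S_run (3 * m).+2.
have := run_rounds m.+1; rewrite three Sc'' Sc' Sc; move: (S (3 * m)) => s.
move E : (_ :: _) => s' s'_rounds; case: s'_rounds E => [//|r v z t z' _ rP] [_ _ _ ->].
by exists v, z, t, z'.
Qed.

Lemma run_increasing i : increasing (S i).
Proof.
have sub : {subset S i <= S (3 * i)} by apply: run_sub; rewrite leq_pmull.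
by move=> e e' /sub es /sub e's; exact: (rounds_increasing (run_rounds i)).
Qed.

Lemma run_descends i e : e \in S i -> descends e.
Proof.
elim: i => [|i IH]; first by rewrite (run_start S_run).
have := run_legal S_run i.+1; have [d ->] := run_step S_run i.
by move=> /legal_descends dd; rewrite inE => /predU1P[->|].
Qed.

Lemma run_target m x : unpickle m./2 = Some x ->
  exists2 e, e \in S (3 * m.+1) & pt_x ((if odd m then mirror else id) e) = x.
Proof.
move=> xm; have [v [z [t [z' [-> [[_ +] _ tP _]]]]]] := run_round m.
have -> : orient (S (3 * m)) = if odd m then mirror else id.
  by rewrite /orient size_run oddM.
rewrite size_map size_run (_ : (3 * m %/ 6)%N = m./2); last first.
  by rewrite -divn2 -[RHS](@divnMl 3).
move=> /(_ _ xm); rewrite inE => /predU1P[->|].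
  exists t; first by rewrite !inE eqxx orbT.
  by have := middle_x tP; rewrite /orient size_run oddM.
rewrite -map_comp => /mapP[e es ->]; exists e => //.
by rewrite !inE es !orbT.
Qed.

Lemma run_dom x : exists i, exists2 e, e \in S i & pt_x e = x.
Proof.
have [|e es ex] := @run_target (pickle x).*2 x; first by rewrite doubleK pickleK.
by rewrite odd_double in ex; exists (3 * (pickle x).*2.+1)%N, e.
Qed.

Lemma run_ran y : exists i, exists2 e, e \in S i & pt_y e = y.
Proof.
have [|e es] := @run_target (pickle (- y)).*2.+1 (- y).
  by rewrite -[_./2]/(uphalf _) uphalf_double pickleK.
rewrite oddS odd_double => /oppr_inj ey.
by exists (3 * (pickle (- y)).*2.+2)%N, e.
Qed.

Lemma run_graph : exists k : autQ, forall i e, e \in S i -> k (pt_x e) = pt_y e.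
Proof.
pose H x y := exists i, exists2 e, e \in S i & pt_x e = x /\ pt_y e = y.
suff /graph_autQ[k kP] : increasing_graph setT setT H.
  by exists k => i e es; apply/kP; exists i, e.
split=> //.
- by move=> x _; have [i [e es ex]] := run_dom x; exists (pt_y e), i, e.
- by move=> y _; have [i [e es ey]] := run_ran y; exists (pt_x e), i, e.
- move=> x y x' y' [i [e es [<- <-]]] [j [e' e's [<- <-]]].
  have es' : e \in S (maxn i j) by apply: run_sub es; exact: leq_maxl.
  have e's' : e' \in S (maxn i j) by apply: run_sub e's; exact: leq_maxr.
  have [->|/andP[xx yy]|/andP[xx yy]] := run_increasing es' e's'; rewrite ?ltxx ?xx ?yy//.
  by rewrite !ltNge !ltW.
Qed.

End Run.

(* Equivalently, some orbital on which [g] moves points up is followed by points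
   that are moved up, without a point in between that is not. *)
Definition touching (g : autQ) : Prop := exists p1 p2, [/\ p1 < p2,
  ~ same_orbital g p1 p2 & forall r, p1 <= r <= p2 -> r < g r].

Definition atypical (g : autQ) : Prop := ~ finite_set (fixed_points g) \/ touching g.

Record rising_cut (g : autQ) (L : set rat) (p1 p2 : rat) : Prop := {
  cut_down : down_closed L;
  cut_stable : forall r, L r -> L (g r);
  cut_left : L p1;
  cut_right : ~ L p2;
  cut_rising : forall r, p1 <= r <= p2 -> r < g r }.

Lemma touching_rising_cut g : touching g -> exists L p1 p2, rising_cut g L p1 p2.
Proof.
move=> [p1 [p2 [p12 p12_apart up]]].
exists [set r | exists2 q, same_orbital g p1 q & r < q], p1, p2; split=> //.
- by move=> r r' r'r [q pq rq]; exists q => //; exact: le_lt_trans rq.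
- move=> r [q pq rq]; exists (g q); last by rewrite autQ_lt_mono.
  exact/(same_orbital_trans pq)/same_orbital_step.
- by exists (g p1); [exact: same_orbital_step|apply: up; rewrite lexx ltW].
- move=> [q pq p2q]; apply: p12_apart; apply: (same_orbital_convex pq).
  by rewrite !ltW.
Qed.

Lemma rising_cut_no_max g L p1 p2 r : rising_cut g L p1 p2 -> L r ->
  exists2 r', L r' & r < r'.
Proof.
move=> cut Lr; have Lm : L (Order.max r p1).
  by rewrite maxEle; case: ifP => // _; exact: cut_left cut.
exists (g (Order.max r p1)); first exact: cut_stable cut _ Lm.
apply: (@le_lt_trans _ _ (Order.max r p1)); first by rewrite le_max lexx.
apply: (cut_rising cut); rewrite le_max lexx orbT /=.
exact/ltW/(down_closed_lt (cut_down cut) Lm (cut_right cut)).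
Qed.

Lemma rising_cut_no_min g L p1 p2 r : rising_cut g L p1 p2 -> ~ L r ->
  exists2 r', ~ L r' & r' < r.
Proof.
move=> cut nLr; have nLm : ~ L (Order.min r p2).
  by rewrite minEle; case: ifP => // _; exact: cut_right cut.
exists ((g^-1)%g (Order.min r p2)); first by move=> /(cut_stable cut); rewrite autQVK.
apply: (@lt_le_trans _ _ (Order.min r p2)); last by rewrite ge_min lexx.
rewrite autQ_ltV; apply: (cut_rising cut); rewrite ge_min lexx orbT andbT.
exact/ltW/(down_closed_lt (cut_down cut) (cut_left cut) nLm).
Qed.

Section Unpinched.
Variables (S : nat -> seq marked_point) (k psi : autQ) (N : nat).
Hypothesis S_run : run S.
Hypothesis k_graph : forall i e, e \in S i -> k (pt_x e) = pt_y e.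
Hypothesis unpinched : forall i e, e \in S i -> e \notin S N -> ~~ pinched psi e.

Let g := (psi^-1 * k)%g.

Let unpinched_alt i e : e \in S i -> e \notin S N -> psi (pt_x e) <= pt_y e ->
  psi (alt_x e) <= alt_y e.
Proof. by move=> es eN low; have := unpinched es eN; rewrite /pinched low /= -leNgt. Qed.

Lemma unpinched_fixed_points : finite_set (fixed_points g).
Proof.
suff old : fixed_points g `<=` [set` map pt_x (S N)].
  exact: sub_finite_set old (finite_seq _).
move=> x gx; have /autQ_eqV psi_k : (psi^-1)%g (k x) = x := gx.
have [i [e es ex]] := run_dom S_run x; rewrite -ex /=; apply: map_f.
apply: contrapT => /negP eN; have psi_e : psi (pt_x e) = pt_y e.
  by rewrite ex psi_k -ex (k_graph es).
have /and3P[xx yy /orP strict] := run_descends S_run es.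
have alt_e : psi (alt_x e) <= alt_y e by apply: (unpinched_alt es eN); rewrite psi_e.
case: strict => [wide_e|tall_e].
  have : psi (pt_x e) < psi (alt_x e) by rewrite autQ_lt_mono.
  by rewrite psi_e; lra.
have : psi (pt_x e) <= psi (alt_x e) by rewrite autQ_le_mono.
by move: tall_e; rewrite psi_e /tall; lra.
Qed.

Section RisingCut.
Variables (L : set rat) (p1 p2 : rat).
Hypothesis cut : rising_cut g L p1 p2.

Let L_lt x y : L x -> ~ L y -> x < y.
Proof. exact: down_closed_lt (cut_down cut). Qed.

Lemma rising_cut_not_interlocked i e e' : e \in S i -> e' \in S i ->
  e \notin S N -> e' \notin S N -> p1 < pt_x e -> pt_x e' < p2 ->
  L (pt_x e) -> ~ L (pt_x e') -> ~~ interlocked e e'.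
Proof.
move=> es e's eN e'N p1e e'p2 Le nLe'; have ee' := L_lt Le nLe'.
have low d : d \in S i -> d \notin S N -> p1 < pt_x d < p2 -> psi (alt_x d) <= alt_y d.
  move=> ds dN /andP[p1d dp2]; apply: (unpinched_alt ds dN).
  have : pt_x d < g (pt_x d) by apply: (cut_rising cut); rewrite !ltW.
  by rewrite autQM autQ_gtV (k_graph ds) => /ltW.
have alt_e : psi (alt_x e) <= alt_y e.
  by apply: low => //; rewrite p1e (lt_trans ee').
have alt_e' : psi (alt_x e') <= alt_y e'.
  by apply: low => //; rewrite e'p2 (lt_trans p1e).
have Lge : L (g (pt_x e)) := cut_stable cut Le.
have /and3P[_ ye _] := run_descends S_run es.
have /and3P[xe' _ _] := run_descends S_run e's.
rewrite negb_or -!leNgt; apply/andP; split.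
  have : g (pt_x e) < alt_x e' := lt_le_trans (L_lt Lge nLe') xe'.
  by rewrite autQM autQ_ltV (k_graph es) => /ltW/le_trans; exact.
apply/ltW/(le_lt_trans _ (L_lt Lge nLe')).
by rewrite autQM autQ_geV (k_graph es); exact: le_trans alt_e ye.
Qed.

Lemma rising_cut_neighbours : exists M a b, at_cut L (S (3 * M)) a b /\
  forall i, unlocked L (S i) a b.
Proof.
have [||r1 Lr1 r1P] := @no_max_finite_ub _ _ L (p1 :: map pt_x (S N)).
- by exists p1; exact: cut_left cut.
- by move=> r; exact: rising_cut_no_max cut.
have [||r2 nLr2 r2P] := @no_min_finite_lb _ _ (~` L) (p2 :: map pt_x (S N)).
- by exists p2; exact: cut_right cut.
- by move=> r; exact: rising_cut_no_min cut.
have [i1 [e1 e1s e1r]] := run_dom S_run r1; have [i2 [e2 e2s e2r]] := run_dom S_run r2.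
pose M := maxn i1 i2.
have up i d : (i <= M)%N -> d \in S i -> d \in S (3 * M).
  by move=> iM; apply: (run_sub S_run); rewrite (leq_trans iM)// leq_pmull.
have e1M := up _ _ (leq_maxl _ _) e1s; have e2M := up _ _ (leq_maxr _ _) e2s.
have inc : increasing (S (3 * M)) := @run_increasing S S_run _.
have [|a a_last] := rightmost_exists (P := fun e => L (pt_x e)) inc.
  by exists e1 => //; rewrite e1r.
have [|b b_first] := leftmost_exists (P := fun e => ~ L (pt_x e)) inc.
  by exists e2 => //; rewrite e2r.
exists M, a, b; split=> // i e e' es e's Le nLe' ae e'b.
have r1e : r1 <= pt_x e.
  apply: le_trans ae; have [_ _ amax] := a_last.
  by have [|<-|/andP[/ltW]] := amax _ e1M; rewrite e1r.
have e'r2 : pt_x e' <= r2.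
  apply: (le_trans e'b); have [_ _ bmin] := b_first.
  by have [|<-|/andP[/ltW]] := bmin _ e2M; rewrite e2r.
apply: (rising_cut_not_interlocked es e's) => //.
- apply/negP => /(map_f pt_x) eN; have := r1P _ _ Le.
  by rewrite inE eN orbT => /(_ isT); rewrite ltNge r1e.
- apply/negP => /(map_f pt_x) e'N; have := r2P _ _ nLe'.
  by rewrite inE e'N orbT => /(_ isT); rewrite ltNge e'r2.
- by apply: lt_le_trans r1e; apply: r1P; [rewrite inE eqxx|exact: cut_left cut].
- by apply: (le_lt_trans e'r2); apply: r2P; [rewrite inE eqxx|exact: cut_right cut].
Qed.

Lemma rising_cut_progress M a b m : at_cut L (S (3 * M)) a b ->
  (forall i, unlocked L (S i) a b) ->
  exists a' b', [/\ at_cut L (S (3 * (M + m))) a' b', pt_x a <= pt_x a',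
    pt_x b' <= pt_x b & progress a b a' b'].
Proof.
move=> ab free; elim: m => [|m [a1 [b1 [ab1 aa1 b1b pr1]]]].
  by rewrite addn0; exists a, b; split=> //; exact: progress_refl.
have free1 : unlocked L (S (3 * (M + m).+1)) a1 b1.
  move=> e e' es e's Le nLe' a1e e'b1.
  by apply: (free (3 * (M + m).+1)%N) => //; [exact: le_trans a1e|exact: le_trans b1b].
have [v [z [t [z' [SE /round_cluster[c' [c'' [c [cl clE]]]]]]]]] := run_round S_run (M + m).
rewrite -SE in clE.
have [a2 [b2 [ab2 a12 b21 pr2]]] := cluster_progress (cut_down cut) cl clE ab1 free1.
rewrite addnS; exists a2, b2; split=> //; [exact: le_trans a12|exact: le_trans b1b|].
exact: progress_trans pr1 pr2.
Qed.

(* One of the two neighbours of the cut never changes, although there are points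
   of the run between it and the cut. *)
Lemma no_rising_cut : False.
Proof.
have [M [a [b [ab free]]]] := rising_cut_neighbours.
have [[as_ La _] [bs nLb _]] := ab.
have [r1 Lr1 ar1] := rising_cut_no_max cut La; have [r2 nLr2 r2b] := rising_cut_no_min cut nLb.
have [i1 [e1 e1s e1r]] := run_dom S_run r1; have [i2 [e2 e2s e2r]] := run_dom S_run r2.
have [a' [b' [[[_ _ amax] [_ _ bmin]] _ _ pr]]] := rising_cut_progress (i1 + i2) ab free.
have a'a : a' <> a.
  move=> a'a; have : e1 \in S (3 * (M + (i1 + i2))) by apply: (run_sub S_run) e1s; lia.
  move=> /amax; rewrite e1r a'a => /(_ Lr1)[e1a|/andP[]]; last by rewrite e1r; lra.
  by move: ar1; rewrite -e1a e1r ltxx.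
have b'b : b' <> b.
  move=> b'b; have : e2 \in S (3 * (M + (i1 + i2))) by apply: (run_sub S_run) e2s; lia.
  move=> /bmin; rewrite e2r b'b => /(_ nLr2)[e2b|/andP[]]; last by rewrite e2r; lra.
  by move: r2b; rewrite -e2b e2r ltxx.
by case: pr => [[/a'a]|[/a'a]|[/b'b]].
Qed.

End RisingCut.

Lemma unpinched_not_atypical : ~ atypical g.
Proof.
case=> [|/touching_rising_cut[L [p1 [p2]]]]; last exact: no_rising_cut.
by apply; exact: unpinched_fixed_points.
Qed.

End Unpinched.

(** * The random automorphism *)

Lemma nbhs_agree (k : autQ) (U : set autQ) : nbhs k U ->
  exists ps : seq rat, [set g : autQ | forall p, p \in ps -> g p = k p] `<=` U.
Proof.
pose F : set_system autQ := [set A | exists ps : seq rat,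
  [set g : autQ | forall p, p \in ps -> g p = k p] `<=` A].
have FF : Filter F.
  split=> [|A B [ps psA] [qs qsB]|A B AB [ps psA]].
  - by exists [::].
  - exists (ps ++ qs) => g agree; split.
      by apply: psA => p pps; apply: agree; rewrite mem_cat pps.
    by apply: qsB => q qqs; apply: agree; rewrite mem_cat qqs orbT.
  - by exists ps; exact: subset_trans AB.
suff Fk : F --> k by exact: Fk.
by apply/cvg_autQP => q; exists [:: q] => g /= agree; apply: agree; rewrite inE.
Qed.

Lemma measurable_fun_autQ d (X : measurableType d) (kappa : X -> autQ) :
  (forall p v, measurable [set t | kappa t p = v]) ->
  measurable_fun setT (kappa : X -> g_sigma_algebraType (@open autQ)).
Proof.
move=> m_eval; pose cylinder (w : seq (rat * rat)) :=
  [set g : autQ | forall pv, pv \in w -> g pv.1 = pv.2].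
have m_cylinder w : measurable (kappa @^-1` cylinder w).
  elim: w => [|[p v] w IH].
    by rewrite (_ : _ @^-1` _ = setT)//; apply/seteqP; split.
  rewrite (_ : _ @^-1` _ = [set t | kappa t p = v] `&` kappa @^-1` cylinder w).
    exact: measurableI.
  apply/seteqP; split=> [t tw|t [tp tw] pv].
    split; first by apply: (tw (p, v)); rewrite inE eqxx.
    by move=> pv pvw; apply: tw; rewrite inE pvw orbT.
  by rewrite inE => /predU1P[->//|/tw].
pose T := g_sigma_algebraType (@open autQ).
apply: (@measurability _ _ X T setT kappa (@open autQ)) => // _ [U oU <-]; rewrite setTI.
rewrite (_ : U = \bigcup_(w in [set w | cylinder w `<=` U]) cylinder w).
  rewrite preimage_bigcup bigcup_mkcond.
  by apply: countable_bigcupT_measurable => [|w]; [exact: countableP|case: ifP].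
apply/seteqP; split=> [k Uk|k [w wU wk]]; last exact: wU.
have [ps psU] := nbhs_agree (open_nbhs_nbhs (conj oU Uk)).
exists [seq (p, k p) | p <- ps]; last by move=> _ /mapP[p pps ->].
by move=> g gP; apply: psU => p pps; apply: (gP (p, k p)); apply/mapP; exists p.
Qed.

Section Cells.
Variable R : realType.
Implicit Types t : R.
Local Notation mR := (measurableTypeR R).

(* The number of the interval [[i / n, (i + 1) / n[] that contains [t]; negative
   numbers are assigned to the first interval. *)
Definition cell (n : nat) t : nat := Num.truncn (t * n%:R).

Lemma cell_divn n b t : (0 < b)%N -> (cell (n * b) t %/ b)%N = cell n t.
Proof.
move=> b0; suff same i : (i < cell (n * b) t %/ b)%N = (i < cell n t)%N.
  by apply/eqP; rewrite eqn_leq leqNgt same ltnn leqNgt -same ltnn.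
have ib0 : (0 < i.+1 * b)%N by rewrite muln_gt0.
rewrite leq_divRL// -(prednK ib0) !truncn_gt_nat (prednK ib0) !natrM mulrA.
by rewrite ler_pM2r ?ltr0n.
Qed.

Lemma cell_itv n t : (0 < n)%N -> 0 <= t ->
  t \in `[(cell n t)%:R / n%:R, (cell n t).+1%:R / n%:R[.
Proof.
move=> n0 t0; rewrite in_itv /= ler_pdivrMr ?ltr0n// ltr_pdivlMr ?ltr0n//.
by rewrite truncn_itv// mulr_ge0.
Qed.

Lemma lebesgue_measure_cell n i : (0 < n)%N ->
  lebesgue_measure ([set` `[i%:R / n%:R, i.+1%:R / n%:R[] : set mR) = (n%:R^-1)%:E.
Proof.
move=> n0; rewrite lebesgue_measure_itv /= lte_fin ltr_pM2r ?invr_gt0 ?ltr0n//.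
by rewrite ltr_nat ltnSn -EFinB -mulrBl -natrB// subSnn mul1r.
Qed.

Lemma measurable_cell n (A : set nat) : (0 < n)%N ->
  measurable (cell n @^-1` A : set mR).
Proof.
move=> n0; have gt i : measurable [set t : mR | (i < cell n t)%N].
  rewrite (_ : [set _ | _] = [set` `[i.+1%:R / n%:R, +oo[]); first exact: measurable_itv.
  by apply/seteqP; split=> t /=; rewrite truncn_gt_nat in_itv /= andbT ler_pdivrMr// ltr0n.
have eq i : measurable [set t : mR | cell n t = i].
  rewrite (_ : [set _ | _] = ~` [set t | (i < cell n t)%N] `&`
      (if i is j.+1 then [set t | (j < cell n t)%N] else setT)).
    by apply: measurableI; [exact: measurableC|case: i].
  apply/seteqP; split=> [t /= <-|t /= [/negP]].
    by rewrite ltnn; split=> //; by case E: (cell n t) => [|j] //=; rewrite E.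
  rewrite -leqNgt => le_i gt_i; apply/eqP; rewrite eqn_leq le_i /=.
  by case: i gt_i {le_i}.
rewrite (_ : _ @^-1` _ = \bigcup_(i in A) [set t | cell n t = i]).
  by apply: bigcup_measurable => i _; exact: eq.
by apply/seteqP; split=> [t At|t [i Ai /= ti]]; [exists (cell n t)|rewrite /preimage /= ti].
Qed.

Definition uniform01 : probability mR R := uniform_prob (ltr01 : 0 < 1 :> R).

Lemma uniform01E (A : set mR) : measurable A ->
  uniform01 A = lebesgue_measure (A `&` `[0, 1]).
Proof.
move=> mA; rewrite /uniform01 /= /uniform_prob integral_uniform_pdf.
rewrite (eq_integral (cst 1%:E)); last first.
  move=> x; rewrite inE => -[_ /=]; rewrite in_itv /= /uniform_pdf => ->.
  by rewrite subr0 invr1.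
by rewrite integral_cst ?mul1e//; exact: measurableI.
Qed.

(* Each of the [n] cells that meet [[0, 1[] contributes one of its [b] parts; the
   number [1] lies in one more cell. *)
Lemma uniform01_sparse n b (A : set nat) (d : nat -> nat) : (0 < n)%N -> (0 < b)%N ->
  (forall i, A i -> (i %% b)%N = d (i %/ b)%N) ->
  (uniform01 (cell (n * b) @^-1` A) <= (n.+1%:R / (n * b)%:R)%:E)%E.
Proof.
move=> n0 b0 Ad; have nb0 : (0 < n * b)%N by rewrite muln_gt0 n0.
have mA := measurable_cell A nb0; rewrite uniform01E//.
pose part q := (q * b + d q)%N.
pose I q : set mR := [set` `[(part q)%:R / (n * b)%:R, (part q).+1%:R / (n * b)%:R[].
have cover : cell (n * b) @^-1` A `&` `[0, 1] `<=` \big[setU/set0]_(q < n.+1) I q.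
  move=> t [/= At]; rewrite in_itv /= => /andP[t0 t1].
  rewrite -bigcup_mkord; exists (cell n t).
    rewrite /= ltnS /cell -[leqRHS](@natrK R); apply: le_truncn.
    by rewrite ler_piMl.
  suff -> : I (cell n t) = [set` `[(cell (n * b) t)%:R / (n * b)%:R,
      (cell (n * b) t).+1%:R / (n * b)%:R[] by exact: cell_itv.
  by rewrite /I /part -(cell_divn n t b0) -Ad// -divn_eq.
have mI q : measurable (I q) by exact: measurable_itv.
apply: (le_trans (content_subadditive lebesgue_measure (fun k _ => mI k) _ cover)).
  exact: measurableI.
rewrite (eq_bigr (fun=> ((n * b)%:R^-1)%:E)) => [|q _]; last exact: lebesgue_measure_cell.
by rewrite sumEFin sumr_const card_ord -[_ *+ _]mulr_natl.
Qed.

End Cells.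

Lemma strategy_exists : exists draw : seq marked_point -> staircase,
  forall s l, legal s -> legal (marked (draw s) l :: s).
Proof.
suff /choice[draw drawP] : forall s, exists g, forall l, legal s -> legal (marked g l :: s).
  by exists draw.
move=> s; have [s_legal|s_illegal] := pselect (legal s); last by exists (fun=> (0, 0)).
by have [g gP] := legal_extend s_legal; exists g.
Qed.

Section RandomAutomorphism.
Variables (R : realType) (draw : seq marked_point -> staircase).
Hypothesis draw_legal : forall s l, legal s -> legal (marked (draw s) l :: s).
Implicit Types t : R.

Definition branching (i : nat) : nat := 2 ^ i.+2.

Fixpoint cells (i : nat) : nat := if i is j.+1 then cells j * branching j else 1.

Fixpoint tree (i n : nat) : seq marked_point :=
  if i is j.+1 then let s := tree j (n %/ branching j) in
    marked (draw s) (n %% branching j) :: s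
  else [::].

Definition branch t (i : nat) : seq marked_point := tree i (cell (cells i) t).

Lemma branching_gt0 i : (0 < branching i)%N.
Proof. by rewrite expn_gt0. Qed.

Lemma cells_gt0 i : (0 < cells i)%N.
Proof. by elim: i => //= i IH; rewrite muln_gt0 IH branching_gt0. Qed.

Lemma tree_legal i n : legal (tree i n).
Proof. by elim: i n => [|i IH] n /=; [exact: legal_rounds no_round|exact: draw_legal]. Qed.

Lemma branch_step t i : branch t i.+1 =
  marked (draw (branch t i)) (cell (cells i.+1) t %% branching i) :: branch t i.
Proof. by rewrite /branch /= cell_divn ?branching_gt0. Qed.

Lemma branch_run t : run (branch t).
Proof. by split=> // i; [rewrite branch_step; eexists|exact: tree_legal]. Qed.

Lemma random_automorphism_exists : exists kappa : R -> autQ,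
  forall t i e, e \in branch t i -> kappa t (pt_x e) = pt_y e.
Proof.
by have [kappa kappaP] := choice (fun t => run_graph (branch_run t)); exists kappa.
Qed.

Definition pinching (psi : autQ) (i : nat) : set (measurableTypeR R) :=
  cell (cells i.+1) @^-1` [set n |
    pinched psi (marked (draw (tree i (n %/ branching i))) (n %% branching i))].

Lemma measurable_pinching psi i : measurable (pinching psi i).
Proof. exact: measurable_cell (cells_gt0 i.+1). Qed.

Lemma pinching_small psi i :
  (uniform01 R (pinching psi i) <= (1 / (2 ^ i.+1)%:R)%:E)%E.
Proof.
have /choice[d dP] q : exists d, forall l, pinched psi (marked (draw (tree i q)) l) -> l = d.
  have [[d d_pinched]|none] := pselect (exists d, pinched psi (marked (draw (tree i q)) d)).
    exists d => l l_pinched; apply: pinched_unique l_pinched d_pinched => j.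
    exact/legal_descends/draw_legal/tree_legal.
  by exists 0 => l l_pinched; case: none; exists l.
apply: (le_trans (uniform01_sparse R (cells_gt0 i) (branching_gt0 i) (fun n => dP _ _))).
rewrite lee_fin.
have two_cells : ((cells i).+1 <= 2 * cells i)%N by have := cells_gt0 i; lia.
have parts_gt0 : (0 < cells i * branching i)%N := cells_gt0 i.+1.
rewrite ler_pdivrMr ?ltr0n// mulrAC mul1r.
rewrite ler_pdivlMr ?ltr0n ?expn_gt0// -natrM ler_nat /branching (expnS 2 i.+1) mulnA.
by rewrite leq_mul2r mulnC two_cells orbT.
Qed.

Lemma pinching_io_null psi : uniform01 R (lim_sup_set (pinching psi)) = 0%E.
Proof.
apply: lim_sup_set_cvg0; first exact: measurable_pinching.
apply: (@le_lt_trans _ _ 1%:E); last by rewrite ltry.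
apply: (le_trans _ (epsilon_trick0 xpredT ler01)).
by apply: lee_nneseries => // i _; exact: pinching_small.
Qed.

Lemma unpinched_branch psi t : ~ lim_sup_set (pinching psi) t ->
  exists N, forall i e, e \in branch t i -> e \notin branch t N -> ~~ pinched psi e.
Proof.
move=> finitely_often.
have [N NP] : exists N, forall i, (N <= i)%N -> ~ pinching psi i t.
  apply: contrapT => often; apply: finitely_often => N _; apply: contrapT => never.
  by apply: often; exists N => i Ni ti; apply: never; exists i.
exists N; elim=> [//|i IH] e.
have [iN|Ni] := leqP i.+1 N.
  by move=> /(run_sub (branch_run t) iN) ->.
rewrite branch_step inE => /predU1P[-> _|]; last exact: IH.
apply/negP => new_pinched; apply: (NP _ Ni).
by rewrite /pinching /preimage /= cell_divn ?branching_gt0.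
Qed.

Variable kappa : R -> autQ.
Hypothesis kappa_graph : forall t i e, e \in branch t i -> kappa t (pt_x e) = pt_y e.

Lemma measurable_kappa : measurable_fun setT
  (kappa : measurableTypeR R -> g_sigma_algebraType (@open autQ)).
Proof.
apply: measurable_fun_autQ => p v; rewrite (_ : [set _ | _] = \bigcup_i
    (cell (cells i) @^-1` [set n | exists2 e, e \in tree i n & pt_x e = p /\ pt_y e = v])).
  by apply: bigcupT_measurable => i; exact: measurable_cell (cells_gt0 i).
apply/seteqP; split=> [t tp|t [i _ [e es [<- <-]]]]; last exact: kappa_graph es.
have [i [e es ep]] := run_dom (branch_run t) p.
by exists i => //; exists e => //; split=> //; rewrite -(kappa_graph es) ep.
Qed.

Lemma kappa_not_atypical psi t : ~ lim_sup_set (pinching psi) t ->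
  ~ atypical (psi^-1 * kappa t)%g.
Proof.
move=> /unpinched_branch[N unpinched].
exact: unpinched_not_atypical (branch_run t) (@kappa_graph t) unpinched.
Qed.

End RandomAutomorphism.

(** * Haar null classes *)

Lemma zexpg_continuous (G : topGroupType) n : continuous (fun g : G => zexpg g n).
Proof.
have expg_cont k : continuous (fun g : G => (g ^+ k)%g).
  elim: k => [|k IH] g; first exact: cvg_cst.
  rewrite (_ : (fun x => x ^+ k.+1)%g = (fun x => x * x ^+ k)%g :> (G -> G)); last first.
    by apply/funext => x; rewrite expgS.
  by apply: cvg_mulg; [exact: cvg_id|exact: IH].
case: n => k g; first exact: expg_cont.
apply: (@continuous_comp G G G (fun x => x ^+ k.+1)%g (fun x => x^-1)%g).
  exact: expg_cont.
exact: invg_continuous.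
Qed.

Lemma open_same_orbital p q : open [set g : autQ | same_orbital g p q].
Proof.
have open_zexpg n (A : set rat) : open [set g : autQ | A (zexpg g n p)].
  apply: (@open_comp _ _ (fun g : autQ => zexpg g n) _ _ (open_eval p A)) => g _.
  exact: zexpg_continuous.
rewrite (_ : [set _ | _] = \bigcup_i \bigcup_j
    ([set g : autQ | zexpg g i p <= q] `&` [set g : autQ | q <= zexpg g j p])).
  apply: bigcup_open => i _; apply: bigcup_open => j _; apply: openI.
    exact: (open_zexpg i [set v | v <= q]).
  exact: (open_zexpg j [set v | q <= v]).
apply/seteqP; split=> g.
  by move=> [i [j /andP[iq qj]]]; exists i => //; exists j.
by move=> [i _ [j _ [iq qj]]]; exists i, j; apply/andP.
Qed.

Lemma measurable_finite_fixed_points :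
  measurable ([set g | finite_set (fixed_points g)] : set (g_sigma_algebraType (@open autQ))).
Proof.
rewrite (_ : [set _ | _] = \bigcup_(s : seq rat)
    ~` [set g : autQ | exists2 x, x \notin s & g x = x]).
  apply: countable_bigcupT_measurable => [|s]; first exact: countableP.
  apply: measurableC; apply: open_measurable_autQ.
  rewrite (_ : [set _ | _] = \bigcup_(x in [set x | x \notin s]) [set g : autQ | g x = x]).
    by apply: bigcup_open => x _; exact: (open_eval x [set x]).
  by apply/seteqP; split=> g [x]; exists x.
apply/seteqP; split=> g.
  move=> /finite_seqP[s fixE]; exists s => // -[x xs gx].
  by move/negP: xs; apply; have : fixed_points g x := gx; rewrite fixE.
move=> [s _ fix_s]; apply: (@sub_finite_set _ _ [set` s]) => [x gx|]; last exact: finite_seq.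
by apply: contrapT => /negP xs; apply: fix_s; exists x.
Qed.

Lemma measurable_touching :
  measurable ([set g | touching g] : set (g_sigma_algebraType (@open autQ))).
Proof.
rewrite (_ : [set _ | _] = \bigcup_(p in [set p : rat * rat | p.1 < p.2])
  ~` ([set g | same_orbital g p.1 p.2] `|`
      \bigcup_(r in [set r | p.1 <= r <= p.2]) [set g : autQ | ~ r < g r])).
  rewrite bigcup_mkcond; apply: countable_bigcupT_measurable => [|p]; first exact: countableP.
  case: ifP => // _; apply: measurableC; apply: open_measurable_autQ.
  apply: openU; first exact: open_same_orbital.
  by apply: bigcup_open => r _; exact: (open_eval r [set v | ~ r < v]).
apply/seteqP; split=> g.
  move=> [p1 [p2 [p12 apart up]]]; exists (p1, p2) => // -[//|[r /up r_up]].
  exact.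
move=> [[p1 p2] p12 /not_orP[apart up]]; exists p1, p2; split=> // r p12r.
by apply: contrapT => nr; apply: up; exists r.
Qed.

Lemma borel_atypical : borel atypical.
Proof.
have := measurableU _ _ (measurableC measurable_finite_fixed_points) measurable_touching.
exact.
Qed.

Lemma autQJ (z h : autQ) x : (z ^ h)%g x = (h^-1)%g (z (h x)).
Proof. by []. Qed.

Lemma fixed_points_conj (h z : autQ) : fixed_points (z ^ h)%g = (h^-1)%g @` fixed_points z.
Proof.
apply/seteqP; split=> [x zhx|_ [x zx <-]].
  exists (h x); last exact: autQK.
  by apply: (@autQ_inj (h^-1)%g); rewrite autQK.
by rewrite /fixed_points /mkset autQJ autQVK zx.
Qed.

Lemma same_orbital_conj (h z : autQ) p q :
  same_orbital (z ^ h)%g p q <-> same_orbital z (h p) (h q).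
Proof.
by split=> -[i [j ij]]; exists i, j; move: ij;
  rewrite !zexpgJ !autQJ autQ_leV autQ_geV.
Qed.

Lemma atypical_conj (h z : autQ) : atypical z -> atypical (z ^ h)%g.
Proof.
case=> [inf|[p1 [p2 [p12 apart up]]]]; [left|right].
  rewrite fixed_points_conj => fin; apply: inf.
  suff -> : fixed_points z = h @` ((h^-1)%g @` fixed_points z) by exact: finite_image.
  rewrite image_comp (_ : h \o _ = id) ?image_id//.
  by apply/funext => x; exact: autQVK.
exists ((h^-1)%g p1), ((h^-1)%g p2); split; first by rewrite autQ_lt_mono.
  by rewrite same_orbital_conj !autQVK.
move=> r; rewrite autQ_leV autQ_geV => /up.
by rewrite autQJ autQ_gtV.
Qed.

Lemma borel_haar_null_inv (G : topGroupType) (R : realType) (B : set G) :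
  borel_haar_null R B -> borel_haar_null R [set x | B (x^-1)%g].
Proof.
move=> [bB [mu mu0]]; split; first exact: borel_preimage (@invg_continuous G) _ bB.
pose T := g_sigma_algebraType (@open G).
have m_inv : measurable_fun setT ((fun x => x^-1)%g : T -> T).
  by move=> _ C bC; rewrite setTI; exact: borel_preimage (@invg_continuous G) _ bC.
exists (distribution mu (mfun_Sub (mem_set m_inv))) => g h.
rewrite -[RHS](mu0 (h^-1)%g (g^-1)%g) !translateE; congr (mu _).
by apply/funext => x; rewrite /= !invgM !invgK mulgA.
Qed.

Lemma haar_null_atypical (R : realType) : borel_haar_null R atypical.
Proof.
have [draw draw_legal] := strategy_exists.
have [kappa kappa_graph] := random_automorphism_exists R draw_legal.
have m_kappa := measurable_kappa draw_legal kappa_graph.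
split; first exact: borel_atypical.
exists (distribution (uniform01 R) (mfun_Sub (mem_set m_kappa))) => g h.
rewrite -[LHS]/(uniform01 R (kappa @^-1` translate g h atypical)).
apply/eqP; rewrite eq_le measure_ge0 andbT -(pinching_io_null R draw_legal (g * h)%g).
apply: le_measure; rewrite ?inE.
- by have := m_kappa measurableT _ (borel_translate g h borel_atypical); rewrite setTI.
- apply: bigcapT_measurable => n; apply: bigcup_measurable => i _.
  exact: measurable_pinching.
move=> t; rewrite translateE => /(atypical_conj h) atyp; apply: contrapT.
move=> /(kappa_not_atypical draw_legal kappa_graph); apply.
by move: atyp; rewrite /conjg mulgVK invgM !mulgA.
Qed.

Lemma not_sign_alternating f : ~ sign_alternating f -> touching f \/ touching (f^-1)%g.
Proof.
move=> not_alt; apply: contrapT => /not_orP[no_touch no_touchV].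
apply: not_alt => p q pq apart spq sp0; apply: contrapT => none.
have const r : p <= r <= q -> sg_at f r = sg_at f p.
  case/andP; rewrite !le_eqVlt => /predU1P[<-//|pr] /predU1P[->//|rq].
  by apply/eqP; apply: contrapT => /negP sr; apply: none; exists r.
move: sp0; case: (sg_atP f p) const => // [_ const|_ const] _.
  apply: no_touch; exists p, q; split=> // r /const/eqP.
  by rewrite sg_at_eq1.
apply: no_touchV; exists p, q; split=> //; first by rewrite same_orbitalV.
by move=> r /const/eqP; rewrite sg_at_eqN1 autQ_gtV.
Qed.

Lemma haar_null_class (R : realType) f :
  ~ (finite_set (fixed_points f) /\ sign_alternating f) -> haar_null R (conjugacy_class f).
Proof.
have null_of_atypical : atypical f -> haar_null R (conjugacy_class f).
  move=> f_atyp; exists atypical; split; first exact: haar_null_atypical.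
  by move=> _ [h _ <-]; exact: atypical_conj.
move=> /not_andP[inf|/not_sign_alternating[f_touch|fV_touch]].
- by apply: null_of_atypical; left.
- by apply: null_of_atypical; right.
exists [set x | atypical (x^-1)%g]; split.
  exact: borel_haar_null_inv (haar_null_atypical R).
by move=> _ [h _ <-]; rewrite /= -conjVg; apply: atypical_conj; right.
Qed.

Theorem theorem3p4 (R : realType) (f : autQ) :
  (~ haar_null R (conjugacy_class f) <->
     finite_set (fixed_points f) /\
     forall O1 O2 : set rat,
       orbitals f O1 -> orbitals f O2 -> orbital_lt O1 O2 ->
       (parity f O1 = 1 /\ parity f O2 = 1) \/
       (parity f O1 = -1 /\ parity f O2 = -1) ->
       exists O3 : set rat,
         [/\ orbitals f O3, orbital_lt O1 O3, orbital_lt O3 O2 &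
             parity f O3 <> parity f O1])
  /\ (~ haar_null R (conjugacy_class f) -> compact_biter (conjugacy_class f))
  /\ (~ haar_null R (conjugacy_class f) ->
      (forall g : autQ, conjugacy_class f g -> fixed_points g = set0) ->
      compact_catcher (conjugacy_class f)).
Proof.
have not_null : ~ haar_null R (conjugacy_class f) <->
    finite_set (fixed_points f) /\ sign_alternating f.
  split=> [f_nonnull|[f_fin f_alt]]; last exact: class_not_haar_null.
  by apply: contrapT => /haar_null_class/f_nonnull.
rewrite -sign_alternating_orbitals; split; [exact: not_null|split].
- by move=> /not_null[f_fin f_alt]; exact: compact_biter_class.
- move=> /not_null[_ f_alt] no_fix; apply: compact_catcher_class => //.
  by apply: no_fix; exists 1%g => //; rewrite conjg1.
Qed.
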